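(* Let $p$ and $q$ be fixed distributions over $[k]$, let $\mathcal C\in\{\mathcal T_{\ell,k},\mathcal P^\epsilon_{\ell,k}\}$, and let $\mathcal A=\{(\mathbf Tp,\mathbf Tq):\mathbf T\in\mathcal C\}$. Let $g:\mathcal A\to\mathbb R$ be a jointly quasi-convex, permutation-invariant function. When $\mathcal C=\mathcal T_{\ell,k}$, there is an algorithm that solves $\max_{\mathbf T\in\mathcal C}g(\mathbf Tp,\mathbf Tq)$ in time polynomial in $k^\ell$. When $\mathcal C=\mathcal P^\epsilon_{\ell,k}$, there is an algorithm that solves $\max_{\mathbf T\in\mathcal C}g(\mathbf Tp,\mathbf Tq)$ in time polynomial in $k^{\ell^2}$ and $2^{\ell^3\log\ell}$.
   Context: $[k]=\{1,\dots,k\}$. $\mathcal T_{\ell,k}$ is the set of all channels from $[k]$ to $[\ell]$, i.e. column-stochastic $\ell\times k$ matrices; $\mathcal P^\epsilon_{\ell,k}$ is the subset of $\epsilon$-LDP channels, those with $\mathbf T(y,x)\le e^\epsilon\,\mathbf T(y,x')$ for all inputs $x,x'$ and outputs $y$. $\mathbf Tp$ is the matrix-vector product. Jointly quasi-convex: all sublevel sets $\{(p',q'):g(p',q')\le t\}$, $t\in\mathbb R$, are convex. Permutation-invariant: $g(p',q')=g(\Pi p',\Pi q')$ for all permutation matrices $\Pi$. The bit-complexity of linear inequalities is assumed to be bounded. *)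

(* Defs.v *)
From mathcomp Require Import all_boot all_order all_algebra perm.
From mathcomp Require Import all_classical all_reals all_analysis.

Set Implicit Arguments.
Unset Strict Implicit.
Unset Printing Implicit Defensive.

Import Order.TTheory GRing.Theory Num.Theory.

Local Open Scope classical_set_scope.
Local Open Scope ring_scope.

(** * Distributions, channels and objective functions *)

Definition is_distr (R : realType) (k : nat) (p : 'cV[R]_k) : Prop :=
  (forall x, 0 <= p x 0) /\ \sum_x p x 0 = 1.

Definition channels (R : realType) (l k : nat) : set 'M[R]_(l, k) :=
  [set T | (forall y x, 0 <= T y x) /\ (forall x, \sum_y T y x = 1)].

Definition ldp_channels (R : realType) (eps : R) (l k : nat) :
    set 'M[R]_(l, k) :=
  [set T | channels T /\ forall y x x', T y x <= expR eps * T y x'].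

Definition output_pairs (R : realType) (l k : nat) (C : set 'M[R]_(l, k))
    (p q : 'cV[R]_k) : set ('cV[R]_l * 'cV[R]_l) :=
  [set (T *m p, T *m q) | T in C].

(** A function [A -> R] is represented by a total function [g] of which only
    the values on [A] are ever constrained or used. *)

Definition jointly_quasi_convex (R : realType) (l : nat)
    (A : set ('cV[R]_l * 'cV[R]_l)) (g : 'cV[R]_l * 'cV[R]_l -> R) : Prop :=
  forall t : R, convex_set [set z | A z /\ g z <= t].

Definition permutation_invariant (R : realType) (l : nat)
    (A : set ('cV[R]_l * 'cV[R]_l)) (g : 'cV[R]_l * 'cV[R]_l -> R) : Prop :=
  forall (s : 'S_l) z, A z -> g z = g (perm_mx s *m z.1, perm_mx s *m z.2).

(** * A real random access machine with an evaluation oracle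

    A program is a single finite object, independent of all inputs.  The memory
    consists of arrays of natural numbers and arrays of exact real numbers, all
    initially zero outside the input; array names are fixed in the program,
    indices are computed.  Integers support only addition and truncated
    subtraction (a unit-cost product on integers of unbounded length would make
    the machine unreasonably powerful), reals support the field operations and
    comparison (with [x / 0 = 0]).  There is no way to convert a real to an
    integer, and the only literals are natural numbers.  Every arithmetic
    operation, memory access, test, assignment and oracle call costs one. *)

Inductive nexp : Type :=
| NLit of nat
| NGet of nat & nexp                  (* [NGet a i]: cell [i] of array [a] *)
| NAdd of nexp & nexp
| NSub of nexp & nexp.

Inductive rexp : Type :=
| RLit of nat
| RGet of nat & nexp
| RAdd of rexp & rexp
| RSub of rexp & rexp
| RMul of rexp & rexp
| RDiv of rexp & rexp.

Inductive bexp : Type :=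
| BLeN of nexp & nexp
| BLeR of rexp & rexp
| BNot of bexp
| BAnd of bexp & bexp.

Inductive cmd : Type :=
| Skip
| NSet of nat & nexp & nexp           (* array, index, value *)
| RSet of nat & nexp & rexp           (* array, index, value *)
| Query of nat & nexp & nat & nat     (* array, index, two argument arrays *)
| Seq of cmd & cmd
| If of bexp & cmd & cmd
| While of bexp & cmd.

Record state (R : realType) : Type := State {
  nmem : nat -> nat -> nat;
  rmem : nat -> nat -> R
}.

Definition upd (X : Type) (m : nat -> nat -> X) (a i : nat) (v : X) :
    nat -> nat -> X :=
  fun b j => if (b == a) && (j == i) then v else m b j.

Fixpoint neval (R : realType) (s : state R) (e : nexp) : nat :=
  match e with
  | NLit c => c
  | NGet a i => nmem s a (neval s i)
  | NAdd e1 e2 => (neval s e1 + neval s e2)%N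
  | NSub e1 e2 => (neval s e1 - neval s e2)%N
  end.

Fixpoint reval (R : realType) (s : state R) (e : rexp) : R :=
  match e with
  | RLit c => c%:R
  | RGet a i => rmem s a (neval s i)
  | RAdd e1 e2 => reval s e1 + reval s e2
  | RSub e1 e2 => reval s e1 - reval s e2
  | RMul e1 e2 => reval s e1 * reval s e2
  | RDiv e1 e2 => reval s e1 / reval s e2
  end.

Fixpoint beval (R : realType) (s : state R) (b : bexp) : bool :=
  match b with
  | BLeN e1 e2 => (neval s e1 <= neval s e2)%N
  | BLeR e1 e2 => reval s e1 <= reval s e2
  | BNot b1 => ~~ beval s b1
  | BAnd b1 b2 => beval s b1 && beval s b2
  end.

Fixpoint ncost (e : nexp) : nat :=
  match e with
  | NLit _ => 1
  | NGet _ i => (ncost i).+1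
  | NAdd e1 e2 | NSub e1 e2 => (ncost e1 + ncost e2).+1
  end.

Fixpoint rcost (e : rexp) : nat :=
  match e with
  | RLit _ => 1
  | RGet _ i => (ncost i).+1
  | RAdd e1 e2 | RSub e1 e2 | RMul e1 e2 | RDiv e1 e2 =>
      (rcost e1 + rcost e2).+1
  end.

Fixpoint bcost (b : bexp) : nat :=
  match b with
  | BLeN e1 e2 => (ncost e1 + ncost e2).+1
  | BLeR e1 e2 => (rcost e1 + rcost e2).+1
  | BNot b1 => (bcost b1).+1
  | BAnd b1 b2 => (bcost b1 + bcost b2).+1
  end.

Definition read_col (R : realType) (l : nat) (s : state R) (a : nat) :
    'cV[R]_l :=
  \col_(y < l) rmem s a y.

(** [exec A g c s t s']: started in [s], the program [c] halts in [s'] after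
    [t] steps, the oracle being [g] on [A].  An oracle call outside [A] has no
    outcome, so a program making one does not halt in this sense. *)
Inductive exec (R : realType) (l : nat) (A : set ('cV[R]_l * 'cV[R]_l))
    (g : 'cV[R]_l * 'cV[R]_l -> R) :
    cmd -> state R -> nat -> state R -> Prop :=
| ExecSkip s : exec A g Skip s 1 s
| ExecNSet s a i e :
    exec A g (NSet a i e) s (ncost i + ncost e).+1
      (State (upd (nmem s) a (neval s i) (neval s e)) (rmem s))
| ExecRSet s a i e :
    exec A g (RSet a i e) s (ncost i + rcost e).+1
      (State (nmem s) (upd (rmem s) a (neval s i) (reval s e)))
| ExecQuery s a i b c :
    A (read_col l s b, read_col l s c) ->
    exec A g (Query a i b c) s (ncost i).+1
      (State (nmem s)
         (upd (rmem s) a (neval s i) (g (read_col l s b, read_col l s c))))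
| ExecSeq c1 c2 s1 t1 s2 t2 s3 :
    exec A g c1 s1 t1 s2 -> exec A g c2 s2 t2 s3 ->
    exec A g (Seq c1 c2) s1 (t1 + t2) s3
| ExecIfTrue b c1 c2 s t s' :
    beval s b -> exec A g c1 s t s' ->
    exec A g (If b c1 c2) s (bcost b + t).+1 s'
| ExecIfFalse b c1 c2 s t s' :
    ~~ beval s b -> exec A g c2 s t s' ->
    exec A g (If b c1 c2) s (bcost b + t).+1 s'
| ExecWhileFalse b c s :
    ~~ beval s b -> exec A g (While b c) s (bcost b).+1 s
| ExecWhileTrue b c s1 t1 s2 t2 s3 :
    beval s1 b -> exec A g c s1 t1 s2 -> exec A g (While b c) s2 t2 s3 ->
    exec A g (While b c) s1 (bcost b + t1 + t2).+1 s3.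

Lemma exec_det (R : realType) (l : nat) (A : set ('cV[R]_l * 'cV[R]_l))
    (g : 'cV[R]_l * 'cV[R]_l -> R) c s t1 s1 t2 s2 :
  exec A g c s t1 s1 -> exec A g c s t2 s2 -> t1 = t2 /\ s1 = s2.
Proof.
move=> h; elim: h t2 s2 => {c s t1 s1};
  intros; match goal with h : exec _ _ _ _ ?t ?s |- _ = ?t /\ _ = ?s =>
    inversion h; subst; clear h end;
  try by match goal with h1 : is_true ?b, h2 : is_true (~~ ?b) |- _ =>
    rewrite h1 in h2 end.
all: repeat match goal with
  | ih : forall t s, exec _ _ ?c ?x t s -> _, h : exec _ _ ?c ?x _ _ |- _ =>
    case: (ih _ _ h) => ? ?; subst; clear ih h
  end; by [].
Qed.

(** Input convention: integer array 0 holds [k, l]; real arrays 0 and 1 hold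
    [p] and [q]; real array 2 holds the remaining real data [w]. *)
Definition init_state (R : realType) (l k : nat) (p q : 'cV[R]_k)
    (w : seq R) : state R :=
  State
    (fun a i => if a == 0%N then nth 0%N [:: k; l] i else 0%N)
    (fun a i => match a with
       | 0%N => if insub i is Some x then p x 0 else 0
       | 1%N => if insub i is Some x then q x 0 else 0
       | 2%N => nth 0 w i
       | _ => 0
       end).

(** Output convention: real array 3 holds the matrix in row-major order, and
    cell 0 of real array 4 holds the optimal value. *)
Definition output_mx (R : realType) (l k : nat) (s : state R) : 'M[R]_(l, k) :=
  \matrix_(y < l, x < k) rmem s 3 (y * k + x)%N.

Definition output_val (R : realType) (s : state R) : R := rmem s 4 0%N.

Definition is_maximizer (R : realType) (l k : nat) (C : set 'M[R]_(l, k))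
    (p q : 'cV[R]_k) (g : 'cV[R]_l * 'cV[R]_l -> R) (T : 'M[R]_(l, k)) : Prop :=
  C T /\ forall T', C T' -> g (T' *m p, T' *m q) <= g (T *m p, T *m q).

Definition solves_max_within (R : realType) (l k : nat)
    (C : set 'M[R]_(l, k)) (p q : 'cV[R]_k) (w : seq R)
    (g : 'cV[R]_l * 'cV[R]_l -> R) (c : cmd) (bound : R) : Prop :=
  exists (t : nat) (s : state R),
    [/\ exec (output_pairs C p q) g c (init_state l p q w) t s,
        t%:R <= bound,
        is_maximizer C p q g (output_mx l k s)
      & output_val s = g (output_mx l k s *m p, output_mx l k s *m q)].

(* Main.v *)
Require Import Defs.
From mathcomp Require Import all_boot all_order all_algebra perm.
From mathcomp Require Import all_classical all_reals all_analysis.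
From mathcomp Require Import ring lra zify.

(** By quasi-convexity it is enough to query finitely many candidate channels
    whose images have the whole joint range in their convex hull; by separation
    this means that every linear functional of [(T p, T q)] is maximised by a
    candidate.  Such a functional gives input [x] the coefficients
    [a y * p x + b y * q x], whose order over the outputs [y] depends on [x]
    only through the likelihood ratio and changes at most once for each pair
    of outputs.

    For all channels, [x] is sent to an output of largest coefficient; once the
    outputs are sorted by slope this is monotone in the likelihood ratio, so the
    candidates are the partitions of the inputs by [l - 1] thresholds, up to a
    permutation of the outputs.

    For private channels let [m y] be the smallest entry of row [y].  Given [m],
    each column solves a fractional knapsack problem on the box [[m, e^eps m]],
    whose solution depends only on the order of the coefficients; hence columns
    can be made constant between [l ^ 2] thresholds.  What is left is a linear
    program in [m] and [l ^ 2 + 1] columns.  At a vertex every column has at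
    most one entry off the boundary of the box, and [m] solves a square system
    of size [l] with coefficients in [{0, 1, e^eps}].  The program guesses the
    thresholds, the pattern of the entries, the system and the pivots of its
    elimination, and discards the guesses that do not give a private channel. *)

Set Implicit Arguments.
Unset Strict Implicit.
Unset Printing Implicit Defensive.

Import Order.TTheory GRing.Theory Num.Theory.
Import numFieldNormedType.Exports.

Local Open Scope classical_set_scope.
Local Open Scope ring_scope.

(** * Structured programs: semantics, frames and running time *)

(** The oracle answers only on [A], so a candidate must pass exact tests before it is queried. In
    return a wrong guess is harmless: a division by zero still yields a matrix, which is then
    tested. Only the existence of one right guess has to be proved, and that is why even the pivots
    are guessed. The machine has neither a product of integers nor a conversion from reals, so
    thresholds are named by inputs, and guesses are decoded by repeated subtraction, bounded by the
    number of guesses. A bound polynomial in [k ^ l] leaves no room for the [l!] orders of the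
    outputs: they span the convex hull in the proof but are never run, since [g] is invariant. At
    [k = 1] the bound is even a constant, so one input gets its own program of constant cost. In the
    private case about [l ^ 3] digits in radix [l + 2] are guessed, which gives [l ^ (l ^ 3)] up to
    powers; the logarithm of the bound is natural, and [ln 2 >= 1/2] limits the loss to a square. An
    input of probability zero under both distributions has no likelihood ratio; it is left out of
    the comparisons, as its coefficients vanish. *)

Inductive prog : Type :=
| PSkip
| PNSet of nat & nexp & nexp
| PRSet of nat & nexp & rexp
| PQuery of nat & nexp & nat & nat
| PSeq of prog & prog
| PIf of bexp & prog & prog
| PFor of nat & nexp & prog.

Fixpoint compile (P : prog) : cmd :=
  match P with
  | PSkip => Skip
  | PNSet a i e => NSet a i e
  | PRSet a i e => RSet a i e
  | PQuery a i b c => Query a i b c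
  | PSeq p q => Seq (compile p) (compile q)
  | PIf b p q => If b (compile p) (compile q)
  | PFor v e p =>
      Seq (NSet v (NLit 0) (NLit 0))
        (While (BLeN (NAdd (NGet v (NLit 0)) (NLit 1)) e)
           (Seq (compile p)
              (NSet v (NLit 0) (NAdd (NGet v (NLit 0)) (NLit 1)))))
  end.

Fixpoint nreads (e : nexp) : seq nat :=
  match e with
  | NLit _ => [::]
  | NGet a i => a :: nreads i
  | NAdd e1 e2 | NSub e1 e2 => nreads e1 ++ nreads e2
  end.

Fixpoint nwrites (P : prog) : seq nat :=
  match P with
  | PNSet a _ _ => [:: a]
  | PSeq p q | PIf _ p q => nwrites p ++ nwrites q
  | PFor v _ p => v :: nwrites p
  | _ => [::]
  end.

Fixpoint rwrites (P : prog) : seq nat :=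
  match P with
  | PRSet a _ _ | PQuery a _ _ _ => [:: a]
  | PSeq p q | PIf _ p q => rwrites p ++ rwrites q
  | PFor _ _ p => rwrites p
  | _ => [::]
  end.

Fixpoint bounds (P : prog) : seq nexp :=
  match P with
  | PSeq p q | PIf _ p q => bounds p ++ bounds q
  | PFor _ e p => e :: bounds p
  | _ => [::]
  end.

Fixpoint loop_vars_ok (P : prog) : bool :=
  match P with
  | PSeq p q | PIf _ p q => loop_vars_ok p && loop_vars_ok q
  | PFor v _ p => (v \notin nwrites p) && loop_vars_ok p
  | _ => true
  end.

Definition unwritten (W : seq nat) (e : nexp) := ~~ has (mem W) (nreads e).

(** Loop bounds read no integer array that the program writes, so they keep their initial values and
    the running time can be bounded in the initial state. *)
Definition frozen (P : prog) : bool :=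
  loop_vars_ok P && all (unwritten (nwrites P)) (bounds P).

Fixpoint query_free (P : prog) : bool :=
  match P with
  | PQuery _ _ _ _ => false
  | PSeq p q | PIf _ p q => query_free p && query_free q
  | PFor _ _ p => query_free p
  | _ => true
  end.

(** [N] stands for a common bound on all loop bounds. Besides the evaluation of [e], an iteration
    pays 6 for the test and 6 for the increment of the counter; the last summand covers the
    initialisation and the failing test. *)
Fixpoint cost_bound (P : prog) (N : nat) : nat :=
  match P with
  | PSkip => 1
  | PNSet _ i e => (ncost i + ncost e).+1
  | PRSet _ i e => (ncost i + rcost e).+1
  | PQuery _ i _ _ => (ncost i).+1
  | PSeq p q => (cost_bound p N + cost_bound q N)%N
  | PIf b p q => (bcost b + (cost_bound p N + cost_bound q N)).+1
  | PFor _ e p => (N * (cost_bound p N + (ncost e + 12)) + (ncost e + 12))%N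
  end.

(** Each loop contributes one factor [N], so the degree depends only on the text of the program;
    this is what makes the running time polynomial in the largest loop bound. *)
Lemma cost_bound_poly (P : prog) :
  exists c d : nat, forall N, (cost_bound P N <= c * N.+1 ^ d)%N.
Proof.
elim: P => [|a i e|a i e|a i b c|p [c1 [d1 h1]] q [c2 [d2 h2]]
   |b p [c1 [d1 h1]] q [c2 [d2 h2]]|v e p [c [d h]]] /=.
- by exists 1%N, 0%N => N; rewrite muln1.
- by exists (ncost i + ncost e).+1, 0%N => N; rewrite muln1.
- by exists (ncost i + rcost e).+1, 0%N => N; rewrite muln1.
- by exists (ncost i).+1, 0%N => N; rewrite muln1.
- exists (c1 + c2)%N, (d1 + d2)%N => N; rewrite mulnDl leq_add//.
    by rewrite (leq_trans (h1 N))// leq_mul2l leq_pexp2l ?orbT// leq_addr.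
  by rewrite (leq_trans (h2 N))// leq_mul2l leq_pexp2l ?orbT// leq_addl.
- exists ((bcost b).+1 + (c1 + c2))%N, (d1 + d2)%N => N.
  rewrite -addSn !mulnDl leq_add//; first by rewrite leq_pmulr// expn_gt0.
  rewrite leq_add//.
    by rewrite (leq_trans (h1 N))// leq_mul2l leq_pexp2l ?orbT// leq_addr.
  by rewrite (leq_trans (h2 N))// leq_mul2l leq_pexp2l ?orbT// leq_addl.
- exists (c + (ncost e + 12))%N, d.+1 => N.
  rewrite mulnDr -addnA -mulSnr mulnDl leq_add//.
    rewrite expnSr mulnA mulnC leq_mul//.
  rewrite mulnC leq_mul2l expnS leq_pmulr ?orbT// expn_gt0//.
Qed.

Section Semantics.
Variables (R : realType) (l : nat).
Variables (A : set ('cV[R]_l * 'cV[R]_l)) (g : 'cV[R]_l * 'cV[R]_l -> R).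
Implicit Types (s : state R) (P p q : prog).

Definition setn s a i v : state R :=
  locked (State (upd (nmem s) a i v) (rmem s)).
Definition setr s a i v : state R :=
  locked (State (nmem s) (upd (rmem s) a i v)).

Fixpoint den_rec P s : state R :=
  match P with
  | PSkip => s
  | PNSet a i e => setn s a (neval s i) (neval s e)
  | PRSet a i e => setr s a (neval s i) (reval s e)
  | PQuery a i b c =>
      setr s a (neval s i) (g (read_col l s b, read_col l s c))
  | PSeq p q => den_rec q (den_rec p s)
  | PIf b p q => if beval s b then den_rec p s else den_rec q s
  | PFor v e p =>
      setn (iteri (neval s e) (fun i s' => den_rec p (setn s' v 0 i)) s)
        v 0 (neval s e)
  end.

(* Locked, so that conversion never unfolds programs during rewriting. *)
Definition den := locked den_rec.

Lemma den_skip s : den PSkip s = s.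
Proof. by rewrite /den -lock. Qed.

Lemma den_nset a i e s : den (PNSet a i e) s = setn s a (neval s i) (neval s e).
Proof. by rewrite /den -lock. Qed.

Lemma den_rset a i e s : den (PRSet a i e) s = setr s a (neval s i) (reval s e).
Proof. by rewrite /den -lock. Qed.

Lemma den_query a i b c s : den (PQuery a i b c) s =
  setr s a (neval s i) (g (read_col l s b, read_col l s c)).
Proof. by rewrite /den -lock. Qed.

Lemma den_seq p q s : den (PSeq p q) s = den q (den p s).
Proof. by rewrite /den -lock. Qed.

Lemma den_if b p q s :
  den (PIf b p q) s = if beval s b then den p s else den q s.
Proof. by rewrite /den -lock. Qed.

Lemma den_forE v e p s : den (PFor v e p) s =
  setn (iteri (neval s e) (fun i s' => den p (setn s' v 0 i)) s)
    v 0 (neval s e).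
Proof. by rewrite /den -lock. Qed.

Lemma nmem_setn s a i v b j :
  nmem (setn s a i v) b j = if (b == a) && (j == i) then v else nmem s b j.
Proof. by rewrite /setn -lock. Qed.

Lemma rmem_setn s a i v : rmem (setn s a i v) = rmem s.
Proof. by rewrite /setn -lock. Qed.

Lemma rmem_setr s a i v b j :
  rmem (setr s a i v) b j = if (b == a) && (j == i) then v else rmem s b j.
Proof. by rewrite /setr -lock. Qed.

Lemma nmem_setr s a i v : nmem (setr s a i v) = nmem s.
Proof. by rewrite /setr -lock. Qed.

(** The meaning [den] applies [g] everywhere; that queries stay in [A] is tracked apart, so that
    query-free parts need no argument. *)
Fixpoint safe P s : Prop :=
  match P with
  | PQuery _ _ b c => A (read_col l s b, read_col l s c)
  | PSeq p q => safe p s /\ safe q (den p s)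
  | PIf b p q => if beval s b then safe p s else safe q s
  | PFor v e p => forall i, (i < neval s e)%N ->
      safe p (setn (iteri i (fun j s' => den p (setn s' v 0 j)) s) v 0 i)
  | _ => True
  end.

Lemma query_free_safe P s : query_free P -> safe P s.
Proof.
elim: P s => //= [p ihp q ihq s|b p ihp q ihq s|v e p ih s].
- by move=> /andP[hp hq]; split; [exact: ihp|exact: ihq].
- by move=> /andP[hp hq]; case: ifP => _; [exact: ihp|exact: ihq].
- by move=> hp i _; exact: ih.
Qed.

Definition agree (W V : seq nat) s s' :=
  (forall a, a \notin W -> nmem s' a = nmem s a) /\
  (forall a, a \notin V -> rmem s' a = rmem s a).

Lemma agree_refl W V s : agree W V s s.
Proof. by []. Qed.

Lemma agree_trans W V s2 s1 s3 :
  agree W V s1 s2 -> agree W V s2 s3 -> agree W V s1 s3.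
Proof.
by move=> [n1 r1] [n2 r2]; split=> a ha; rewrite ?n2 ?n1 ?r2 ?r1.
Qed.

Lemma agree_sub W V W' V' s s' :
  {subset W <= W'} -> {subset V <= V'} -> agree W V s s' -> agree W' V' s s'.
Proof.
move=> sW sV [n r]; split=> a ha; [apply: n|apply: r].
  by apply: contra ha; apply: sW.
by apply: contra ha; apply: sV.
Qed.

Lemma agree_setn a i v s : agree [:: a] [::] s (setn s a i v).
Proof.
split=> [b|b _]; last by rewrite rmem_setn.
by rewrite inE => /negbTE hb; apply/funext => j; rewrite nmem_setn hb.
Qed.

Lemma agree_setr a i v s : agree [::] [:: a] s (setr s a i v).
Proof.
split=> [b _|b]; first by rewrite nmem_setr.
by rewrite inE => /negbTE hb; apply/funext => j; rewrite rmem_setr hb.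
Qed.

Lemma agree_den P s : agree (nwrites P) (rwrites P) s (den P s).
Proof.
elim: P s => /=.
- by move=> s; rewrite den_skip; exact: agree_refl.
- by move=> a i e s; rewrite den_nset; exact: agree_setn.
- by move=> a i e s; rewrite den_rset; exact: agree_setr.
- by move=> a i b c s; rewrite den_query; exact: agree_setr.
- move=> p ihp q ihq s; rewrite den_seq; apply: (@agree_trans _ _ (den p s)).
    by apply: agree_sub (ihp s) => a ha; rewrite mem_cat ha.
  by apply: agree_sub (ihq _) => a ha; rewrite mem_cat ha orbT.
- move=> b p ihp q ihq s; rewrite den_if; case: ifP => _.
    by apply: agree_sub (ihp s) => a ha; rewrite mem_cat ha.
  by apply: agree_sub (ihq s) => a ha; rewrite mem_cat ha orbT.
- move=> v e p ih s; rewrite den_forE; set n := neval s e.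
  suff h m : agree (v :: nwrites p) (rwrites p) s
      (iteri m (fun i s' => den p (setn s' v 0 i)) s).
    apply: agree_trans (h n) _; apply: agree_sub (agree_setn _ _ _ _) => //.
    by move=> a; rewrite !inE => /eqP->; rewrite eqxx.
  elim: m => [|m ihm] //=; apply: agree_trans ihm _.
  apply: (@agree_trans _ _ (setn (iteri m (fun i s' => den p (setn s' v 0 i)) s) v 0 m)).
    apply: agree_sub (agree_setn _ _ _ _) => //.
    by move=> a; rewrite !inE => /eqP->; rewrite eqxx.
  by apply: agree_sub (ih _) => // a ha; rewrite inE ha orbT.
Qed.

Lemma nmem_den P s a : a \notin nwrites P -> nmem (den P s) a = nmem s a.
Proof. exact: (agree_den P s).1. Qed.

Lemma rmem_den P s a : a \notin rwrites P -> rmem (den P s) a = rmem s a.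
Proof. exact: (agree_den P s).2. Qed.

Lemma agree_iter v e p i s :
  agree (nwrites (PFor v e p)) (rwrites (PFor v e p)) s
    (iteri i (fun j s' => den p (setn s' v 0 j)) s).
Proof.
elim: i => [|i ih] /=; first exact: agree_refl.
apply: agree_trans ih _.
set s1 := iteri _ _ _.
apply: (@agree_trans _ _ (setn s1 v 0 i)).
  by apply: agree_sub (agree_setn _ _ _ _) => // a; rewrite !inE => /eqP->; rewrite eqxx.
by apply: agree_sub (agree_den _ _) => // a ha; rewrite inE ha orbT.
Qed.

Lemma neval_agree W V e s s' :
  agree W V s s' -> unwritten W e -> neval s' e = neval s e.
Proof.
move=> [hn _]; rewrite /unwritten; elim: e => //= [a i ih|e1 ih1 e2 ih2|e1 ih1 e2 ih2].
- by rewrite negb_or => /andP[ha hi]; rewrite ih// hn.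
- by rewrite has_cat negb_or => /andP[/ih1-> /ih2->].
- by rewrite has_cat negb_or => /andP[/ih1-> /ih2->].
Qed.

(** The loop rule. An iteration may also use that arrays outside the write sets are as in [s], so an
    invariant mentions only what changes; [s'] is the state before the counter gets its final
    value. *)
Lemma den_for (I : nat -> state R -> Prop) v e p s :
  I 0%N s ->
  (forall i s', (i < neval s e)%N ->
     agree (nwrites (PFor v e p)) (rwrites (PFor v e p)) s s' ->
     I i s' -> I i.+1 (den p (setn s' v 0 i))) ->
  exists s', [/\ den (PFor v e p) s = setn s' v 0 (neval s e),
    agree (nwrites (PFor v e p)) (rwrites (PFor v e p)) s s' &
    I (neval s e) s'].
Proof.
move=> I0 step; set n := neval s e; set F := fun i s' => den p (setn s' v 0 i).
exists (iteri n F s); split; [exact: den_forE|exact: (agree_iter v e p n s)|].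
suff h i : (i <= n)%N -> I i (iteri i F s) by exact: h.
elim: i => [//|i ih hi] /=; apply: step => //.
  exact: (agree_iter v e p i s).
exact/ih/ltnW.
Qed.

Lemma unwritten_sub (W W' : seq nat) : {subset W' <= W} ->
  subpred (unwritten W) (unwritten W').
Proof.
move=> sW e; apply: contra => /hasP[a ha ha'].
by apply/hasP; exists a => //; exact: sW.
Qed.

Lemma bounded_agree W V (es : seq nexp) s s' N :
  agree W V s s' -> all (unwritten W) es ->
  all (fun e => neval s e <= N)%N es -> all (fun e => neval s' e <= N)%N es.
Proof.
move=> ag fr bd; have : all (predI (unwritten W) (fun e => neval s e <= N)%N) es.
  by rewrite all_predI fr bd.
by apply: sub_all => e /= /andP[fe]; rewrite (neval_agree ag fe).
Qed.

Lemma exec_den P s N :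
  frozen P -> safe P s -> all (fun e => neval s e <= N)%N (bounds P) ->
  exists2 t : nat, exec A g (compile P) s t (den P s) & (t <= cost_bound P N)%N.
Proof.
rewrite /frozen => /andP[].
elim: P s => /=.
- move=> s _ _ _ _; exists 1%N => //; rewrite den_skip; exact: ExecSkip.
- move=> a i e s _ _ _ _; rewrite den_nset /setn -lock.
  by eexists; first exact: ExecNSet.
- move=> a i e s _ _ _ _; rewrite den_rset /setr -lock.
  by eexists; first exact: ExecRSet.
- move=> a i b c s _ _ hs _; rewrite den_query /setr -lock.
  by eexists; first exact: ExecQuery.
- move=> p ihp q ihq s /andP[lp lq].
  rewrite !all_cat => /andP[fp fq] [sp sq] /andP[bp bq].
  have subl : {subset nwrites p <= nwrites p ++ nwrites q}.
    by move=> a ha; rewrite mem_cat ha.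
  have subr : {subset nwrites q <= nwrites p ++ nwrites q}.
    by move=> a ha; rewrite mem_cat ha orbT.
  have [t1 e1 h1] := ihp s lp (sub_all (unwritten_sub subl) fp) sp bp.
  have bq' := bounded_agree (agree_den p s) (sub_all (unwritten_sub subl) fq) bq.
  have [t2 e2 h2] := ihq _ lq (sub_all (unwritten_sub subr) fq) sq bq'.
  exists (t1 + t2)%N; first by rewrite den_seq; exact: ExecSeq e1 e2.
  exact: leq_add.
- move=> b p ihp q ihq s /andP[lp lq].
  rewrite !all_cat => /andP[fp fq] + /andP[bp bq].
  have subl : {subset nwrites p <= nwrites p ++ nwrites q}.
    by move=> a ha; rewrite mem_cat ha.
  have subr : {subset nwrites q <= nwrites p ++ nwrites q}.
    by move=> a ha; rewrite mem_cat ha orbT.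
  rewrite den_if; case: ifP => hb hs.
    have [t e h] := ihp s lp (sub_all (unwritten_sub subl) fp) hs bp.
    eexists; first exact: ExecIfTrue e.
    by rewrite ltnS leq_add2l (leq_trans h)// leq_addr.
  have [t e h] := ihq s lq (sub_all (unwritten_sub subr) fq) hs bq.
  eexists; first by apply: ExecIfFalse e; rewrite hb.
  by rewrite ltnS leq_add2l (leq_trans h)// leq_addl.
- move=> v e p ih s /andP[vp lp] /andP[fe fr] sf /andP[nN bd].
  set n := neval s e in nN sf *; set F := fun i s' => den p (setn s' v 0 i).
  set w := While _ _.
  have agi i v' : agree (v :: nwrites p) (rwrites p) s (setn (iteri i F s) v 0 v').
    apply: agree_trans (agree_iter v e p i s) _.
    apply: agree_sub (agree_setn _ _ _ _) => // a; rewrite !inE => /eqP->.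
    by rewrite eqxx.
  have ev i v' : neval (setn (iteri i F s) v 0 v') e = n.
    by rewrite (neval_agree (agi i v') fe).
  have sub : {subset nwrites p <= v :: nwrites p}.
    by move=> a ha; rewrite inE ha orbT.
  (* Induction on the number [j] of iterations left; [ncost e + 6] pays for the failing test that
     ends the loop. *)
  suff h j i : (i + j)%N = n -> exists2 t : nat,
      exec A g w (setn (iteri i F s) v 0 i) t (setn (iteri n F s) v 0 n) &
      (t <= j * (cost_bound p N + (ncost e + 12)) + (ncost e + 6))%N.
    have [t et ht] := h n 0%N (add0n n).
    eexists.
      rewrite den_forE; apply: ExecSeq et; rewrite /setn -lock; exact: ExecNSet.
    move: ht => /=; set K := (cost_bound p N + _)%N => ht.
    have : (n * K <= N * K)%N by rewrite leq_mul2r nN orbT.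
    by move: ht; set a := (n * K)%N; set b := (N * K)%N; lia.
  elim: j i => [|j ihj] i hij.
    rewrite addn0 in hij; rewrite hij; eexists.
      by apply: ExecWhileFalse; rewrite /= ev nmem_setn !eqxx/= -ltnNge addn1.
    by rewrite /=; lia.
  have lin : (i < n)%N by lia.
  have [t1 e1 h1] := ih _ lp (sub_all (unwritten_sub sub) fr) (sf i lin)
    (bounded_agree (agi i i) fr bd).
  have hij' : (i.+1 + j = n)%N by lia.
  have [t2 e2 h2] := ihj i.+1 hij'.
  have e3 : exec A g (NSet v (NLit 0) (NAdd (NGet v (NLit 0)) (NLit 1)))
      (F i (iteri i F s)) 6 (setn (iteri i.+1 F s) v 0 i.+1).
    have -> : setn (iteri i.+1 F s) v 0 i.+1 =
          State (upd (nmem (F i (iteri i F s))) v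
              (neval (F i (iteri i F s)) (NLit 0))
              (neval (F i (iteri i F s)) (NAdd (NGet v (NLit 0)) (NLit 1))))
            (rmem (F i (iteri i F s))).
      rewrite {1}/setn -lock /=; congr (State (upd _ _ _ _) _).
      by rewrite /F nmem_den// nmem_setn !eqxx addn1.
    exact: ExecNSet.
  eexists.
    apply: ExecWhileTrue e2; last exact: ExecSeq e1 e3.
    by rewrite /= ev nmem_setn !eqxx/= addn1.
  rewrite /=; move: h1 h2; rewrite mulSn.
  set K := (cost_bound p N + _)%N; set J := (j * K)%N.
  by rewrite /K; lia.
Qed.

End Semantics.

Lemma neval_setn (R : realType) (s : state R) a i v e :
  unwritten [:: a] e -> neval (setn s a i v) e = neval s e.
Proof. by move=> h; apply: neval_agree h; exact: agree_setn. Qed.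

Definition denE := (den_skip, den_nset, den_rset, den_query, den_seq, den_if).
Definition stateE := (nmem_setn, rmem_setn, rmem_setr, nmem_setr).

Ltac forloop I := lazymatch goal with
  |- context [den ?g (PFor ?v ?e ?p) ?s] => case: (@den_for _ _ g I v e p s) end.

Ltac subset_dec := let x := fresh "x" in let hx := fresh "hx" in
  first [by [] | move=> x; rewrite /= !inE => hx;
    do ?[case/orP: hx => hx]; by rewrite hx /= ?orbT].
Ltac unw h := apply: unwritten_sub h; subset_dec.

(** * Convex geometry *)

Lemma coord_continuous_rV (R : realType) n (i : 'I_n) :
  continuous (fun v : 'rV[R]_n => v ord0 i).
Proof. exact: coord_continuous. Qed.

Lemma continuous_sum_fun (R : realType) (T : topologicalType) (I : Type)
    (r : seq I) (f : I -> T -> R) :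
  (forall i, continuous (f i)) -> continuous (fun x => \sum_(i <- r) f i x).
Proof.
move=> cf; elim: r => [|i r ih].
  by under eq_fun do rewrite big_nil; exact: cst_continuous.
under eq_fun do rewrite big_cons.
by move=> x; apply: cvgD; [exact: cf|exact: ih].
Qed.

Lemma compact_box_slice (R : realType) n (m M : 'I_n -> R) (h : 'rV[R]_n -> R)
    (a : R) :
  continuous h ->
  compact [set v : 'rV[R]_n | (forall i, m i <= v ord0 i <= M i) /\ h v = a].
Proof.
move=> ch.
apply: (@subclosed_compact _ _ [set v : 'rV[R]_n | forall i, `[m i, M i]%classic (v ord0 i)]).
- rewrite (_ : mkset _ = (\bigcap_(i in [set: 'I_n])
     ((fun v : 'rV[R]_n => v ord0 i) @^-1` `[m i, M i]%classic)) `&` h @^-1` [set a]); last first.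
    apply/seteqP; split => v /=.
      by move=> [hb hs]; split => // i _ /=; rewrite in_itv/=; exact: hb.
    by move=> [hb hs]; split => // i; have := hb i Logic.I; rewrite /= in_itv.
  apply: closedI.
    apply: closed_bigI => i _; apply: closed_comp => [x _|]; first exact: coord_continuous_rV.
    exact: itv_closed.
  apply: closed_comp => [x _|]; first exact: ch.
  exact: closed_eq.
- by apply: (@rV_compact _ _ (fun i => `[m i, M i]%classic)) => i; exact: segment_compact.
- by move=> v /= [hb _] i; rewrite in_itv/=.
Qed.

(** The weights are not normalised, so that the induction can drop the last one; only the case where
    the remaining weights all vanish is separate. *)
Lemma convex_set_sum (R : realType) (M : lmodType R) (A : set (convex_lmodType M))
    n (lam : 'I_n -> R) (x : 'I_n -> M) :
  convex_set A -> (forall i, 0 <= lam i) -> (forall i, A (x i)) ->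
  0 < \sum_i lam i -> A ((\sum_i lam i)^-1 *: \sum_i lam i *: x i).
Proof.
move=> cA; elim: n lam x => [|n ih] lam x l0 Ax; first by rewrite big_ord0 ltxx.
rewrite !big_ord_recr/=; set S := \sum_(i < n) _; set L := lam ord_max.
set X := \sum_(i < n) _; set y := x ord_max => SL.
have S0 : 0 <= S by exact: sumr_ge0.
have L0 : 0 <= L by exact: l0.
move: S0; rewrite le_eqVlt => /orP[/eqP S0|S0].
  have X0 : X = 0.
    rewrite /X big1// => i _; have /eqP : 0 = S := S0.
    rewrite eq_sym psumr_eq0// => /allP/(_ i); rewrite mem_index_enum => /(_ isT)/eqP->.
    by rewrite scale0r.
  rewrite -S0 X0 !add0r scalerA mulVf ?scale1r; last by move: SL; rewrite -S0 add0r => /gt_eqF->.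
  exact: Ax.
have Q := ih (fun i => lam (widen_ord (leqnSn n) i))
  (fun i => x (widen_ord (leqnSn n) i)) (fun i => l0 _) (fun i => Ax _) S0.
have t01 : 0 <= S / (S + L) <= 1.
  by rewrite divr_ge0 ?(ltW S0) ?(ltW SL)//= ler_pdivrMr// mul1r lerDl.
pose t : {i01 R} := Itv01 (andP t01).1 (andP t01).2.
have := cA (S^-1 *: X) y t; rewrite !inE => /(_ Q (Ax _)).
congr (A _); rewrite /conv /= scalerA.
have SLn : S + L != 0 by rewrite gt_eqF.
have Sn : S != 0 by rewrite gt_eqF.
rewrite scalerDr scalerA /unstable.onem.
congr (_ *: _ + _ *: _); by field; rewrite SLn ?Sn.
Qed.

Lemma convex_set_sum1 (R : realType) (M : lmodType R) (A : set (convex_lmodType M))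
    n (lam : 'I_n -> R) (x : 'I_n -> M) :
  convex_set A -> (forall i, 0 <= lam i) -> (forall i, A (x i)) ->
  \sum_i lam i = 1 -> A (\sum_i lam i *: x i).
Proof.
move=> cA l0 Ax S1; have := convex_set_sum cA l0 Ax.
by rewrite S1 invr1 scale1r; apply.
Qed.

(** The simplex of weights is compact, so the hull has a point nearest to [w]. If it is not [w]
    itself, the vector from it to [w] is the separating functional. *)
Lemma hull_or_separated (R : realType) (F : finType) n (z : 'I_n.+1 -> F -> R)
    (w : F -> R) :
  (exists lam : 'I_n.+1 -> R, [/\ forall i, 0 <= lam i, \sum_i lam i = 1
      & forall f, w f = \sum_i lam i * z i f]) \/
  (exists c : F -> R, forall i, \sum_f c f * z i f < \sum_f c f * w f).
Proof.
pose y (v : 'rV[R]_n.+1) f := \sum_i v ord0 i * z i f.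
pose h (v : 'rV[R]_n.+1) := - \sum_f (w f - y v f) ^+ 2.
pose D := [set v : 'rV[R]_n.+1 | (forall i, 0 <= v ord0 i <= 1) /\ \sum_i v ord0 i = 1].
have cS : continuous (fun v : 'rV[R]_n.+1 => \sum_i v ord0 i).
  by apply: continuous_sum_fun => i; exact: coord_continuous_rV.
have cy f : continuous (fun v => y v f).
  apply: continuous_sum_fun => i v.
  apply: (@continuousM R _ (fun v : 'rV[R]_n.+1 => v ord0 i) (fun=> z i f)).
    exact: coord_continuous_rV.
  exact: cst_continuous.
have ch : continuous h.
  have c2 : continuous (fun v => \sum_f (w f - y v f) ^+ 2).
    apply: continuous_sum_fun => f u.
    have cd : {for u, continuous (fun v => w f - y v f)}.
      apply: (@continuousB _ _ _ (fun=> w f) (fun v => y v f)).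
        exact: cst_continuous.
      exact: cy.
    exact: (@continuousM _ _ _ _ _ cd cd).
  by move=> v; apply: (@continuousN _ _ _ _ _ (c2 v)).
have [||u uD umax] := @EVT_max_rV R _ h D _ (@compact_box_slice R _ (fun=> 0) (fun=> 1) _ 1 cS).
- exists (\row_i (i == ord0)%:R); split => [i|].
    by rewrite mxE; case: (i == ord0); rewrite /= ?lexx ?ler01.
  rewrite (bigD1 ord0)//= mxE eqxx big1 ?addr0// => i /negbTE hi.
  by rewrite mxE hi.
- exact: continuous_subspaceT.
move: uD; rewrite inE => -[u01 u1].
have [r0|] := pselect (forall f, w f = y u f).
  by left; exists (fun i => u ord0 i); split => // i; have /andP[] := u01 i.
move=> /existsNP[f0 /eqP f0n]; right; exists (fun f => w f - y u f) => i.
have N0 : 0 < \sum_f (w f - y u f) ^+ 2.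
  rewrite (bigD1 f0)//= ltr_pwDl ?exprn_even_gt0 ?subr_eq0//.
  by apply: sumr_ge0 => f _; exact: sqr_ge0.
set c := fun f => w f - y u f.
pose d f := z i f - y u f.
suff cd : \sum_f c f * d f <= 0.
  rewrite -subr_gt0 -sumrB.
  rewrite (_ : \sum_(i0 in F) _ = \sum_f (w f - y u f) ^+ 2 - \sum_f c f * d f).
    by lra.
  by rewrite -sumrB; apply: eq_bigr => f _; rewrite /c /d; ring.
(* Moving the weights by [t] towards vertex [i] stays in the simplex and cannot come closer to [w];
   expanding the squared distance and dividing by [t] leaves this inequality. *)
have key (t : R) : 0 < t <= 1 ->
    2 * \sum_f c f * d f <= t * \sum_f d f ^+ 2.
  move=> /andP[t0 t1].
  pose v : 'rV[R]_n.+1 := \row_j ((1 - t) * u ord0 j + t * (j == i)%:R).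
  have vD : D v.
    split=> [j|].
      rewrite mxE; have /andP[a0 a1] := u01 j.
      case: (j == i); rewrite ?mulr1 ?mulr0 ?addr0/=; first by apply/andP; split; nra.
      by apply/andP; split; nra.
    under eq_bigr do rewrite mxE.
    rewrite big_split/= -mulr_sumr u1 -mulr_sumr (bigD1 i)//= eqxx big1 ?addr0 => [|j /negbTE->//].
    by rewrite !mulr1 subrK.
  have yv f : y v f = y u f + t * d f.
    rewrite /y; under eq_bigr do rewrite mxE mulrDl -!mulrA.
    rewrite big_split/= -!mulr_sumr -/(y u f) [X in t * X](bigD1 i)//= eqxx mul1r big1 ?addr0.
      by rewrite /d; ring.
    by move=> j /negbTE->; rewrite mul0r.
  have := umax v; rewrite inE => /(_ vD); rewrite /h lerN2.
  have -> : \sum_f (w f - y v f) ^+ 2 = \sum_f (w f - y u f) ^+ 2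
      - t * (2 * \sum_f c f * d f) + t * (t * \sum_f d f ^+ 2).
    rewrite !mulr_sumr -sumrB -big_split/=; apply: eq_bigr => f _.
    by rewrite yv /c; ring.
  set X := \sum_f _ ^+ 2; set Y := 2 * _; set Z := t * \sum_f _ => XX.
  have : t * Y <= t * Z by lra.
  by rewrite ler_pM2l.
set X := \sum_f c f * d f in key *; set Y := \sum_f _ in key.
rewrite leNgt; apply/negP => X0.
have Y0 : 0 <= Y by apply: sumr_ge0 => f _; exact: sqr_ge0.
(* This step size is admissible and small enough that [t * Y <= X], against [2 * X <= t * Y] with
   [X] positive. *)
have /key : 0 < X / (X + Y + 1) <= 1.
  by rewrite divr_gt0/= ?ler_pdivrMr; lra.
have : X / (X + Y + 1) * Y <= X.
  rewrite mulrAC -mulrA ger_pMr// ler_pdivrMr; lra.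
lra.
Qed.

(** No functional separates [w] from the candidates, so [w] is in their hull; the sublevel set at
    the largest candidate value is convex and contains that hull. *)
Lemma quasi_convex_max (R : realType) l (A : set ('cV[R]_l * 'cV[R]_l)) g n
    (z : 'I_n.+1 -> 'cV[R]_l * 'cV[R]_l) (w : 'cV[R]_l * 'cV[R]_l) :
  jointly_quasi_convex A g -> (forall i, A (z i)) ->
  (forall a b : 'I_l -> R, exists i, \sum_y (a y * w.1 y 0 + b y * w.2 y 0)
     <= \sum_y (a y * (z i).1 y 0 + b y * (z i).2 y 0)) ->
  exists i, g w <= g (z i).
Proof.
move=> qc Az sup.
pose coord (u : 'cV[R]_l * 'cV[R]_l) (f : 'I_l * bool) :=
  if f.2 then u.2 f.1 0 else u.1 f.1 0.
have [[lam [l0 l1 lw]]|[c hc]] := hull_or_separated (fun i => coord (z i)) (coord w).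
  have [i _ imax] := @arg_maxP _ _ _ ord0 xpredT (fun i => g (z i)) isT.
  exists i; have := qc (g (z i)) => cv.
  have [] // := convex_set_sum1 cv l0 _ l1 (x := z) => [j|_].
    by split; [exact: Az|exact: imax].
  suff -> : \sum_j lam j *: z j = w by [].
  have e1 : (\sum_j lam j *: z j).1 = w.1.
    rewrite (raddf_sum (@fst _ _ : {additive _ -> _})).
    apply/colP => y; rewrite summxE; rewrite -[RHS]/(coord w (y, false)) lw.
    by apply: eq_bigr => j _; rewrite mxE.
  have e2 : (\sum_j lam j *: z j).2 = w.2.
    rewrite (raddf_sum (@snd _ _ : {additive _ -> _})).
    apply/colP => y; rewrite summxE; rewrite -[RHS]/(coord w (y, true)) lw.
    by apply: eq_bigr => j _; rewrite mxE.
  by move: e1 e2; case: (\sum_j _) => x1 x2 /= -> ->; case: (w).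
have E u : \sum_f c f * coord u f =
    \sum_y (c (y, false) * u.1 y 0 + c (y, true) * u.2 y 0).
  transitivity (\sum_y \sum_(b : bool) c (y, b) * coord u (y, b)).
    by rewrite pair_bigA; apply: eq_bigr => -[].
  by apply: eq_bigr => y _; rewrite big_bool /= addrC.
have [i] := sup (fun y => c (y, false)) (fun y => c (y, true)).
by rewrite -!E leNgt hc.
Qed.

(* Moving along a direction that respects the tight constraints, with the sign
   making the objective nondecreasing, tightens one more constraint. *)
Lemma vertex_improve (R : realFieldType) (V : lmodType R) (I : finType)
    (a : I -> V -> R) (b : I -> R) (c : V -> R) (P D : V -> Prop) (z : V) :
  (forall i u v t, a i (u + t *: v) = a i u + t * a i v) ->
  (forall u v t, c (u + t *: v) = c u + t * c v) ->
  (forall u v t, P u -> D v -> P (u + t *: v)) ->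
  (forall v, D v -> D (- v)) ->
  (forall v, D v -> v != 0 -> exists i, 0 < a i v) ->
  P z -> (forall i, a i z <= b i) ->
  exists z', [/\ P z', forall i, a i z' <= b i, c z <= c z' &
    forall v, D v -> (forall i, a i z' = b i -> a i v = 0) -> v = 0].
Proof.
move=> aL cL PD DN bd Pz fz.
have aN i v : a i (- v) = - a i v.
  have h0 : a i 0 = 0.
    by have := aL i 0 0 1; rewrite scaler0 addr0 mul1r; lra.
  by have := aL i 0 v (-1); rewrite scaleN1r add0r h0 => ->; lra.
have cN v : c (- v) = - c v.
  have h0 : c 0 = 0.
    by have := cL 0 0 1; rewrite scaler0 addr0 mul1r; lra.
  by have := cL 0 v (-1); rewrite scaleN1r add0r h0 => ->; lra.
have [n] := ubnP #|[pred i | a i z != b i]|.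
elim: n z Pz fz => // n ih z Pz fz hn.
have [hv|] := pselect (forall v, D v -> (forall i, a i z = b i -> a i v = 0) -> v = 0).
  by exists z.
move=> /existsNP[v0 /not_implyP[Dv0 /not_implyP[tv0 /eqP v0n]]].
have [v [Dv tv vn cv]] : exists v, [/\ D v, forall i, a i z = b i -> a i v = 0,
    v != 0 & 0 <= c v].
  have [c0|c0] := leP 0 (c v0); first by exists v0.
  exists (- v0); split; rewrite ?oppr_eq0 ?cN ?oppr_ge0 ?(ltW c0)//; first exact: DN.
  by move=> i /tv0; rewrite aN => ->; rewrite oppr0.
(* [bd] excludes rays, so some constraint limits the move; the ratio test selects the first one to
   become tight. *)
have [i0 i0p] := bd v Dv vn.
have [j jp jmin] := @arg_minP _ _ _ i0 (fun i => 0 < a i v)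
  (fun i => (b i - a i z) / a i v) i0p.
set t := (b j - a j z) / a j v in jmin.
have t0 : 0 <= t by rewrite divr_ge0 ?subr_ge0 ?(ltW jp).
have fz' i : a i (z + t *: v) <= b i.
  rewrite aL; have [ip|ip] := ltP 0 (a i v).
    by have := jmin i ip; rewrite ler_pdivlMr//; lra.
  by have := fz i; nra.
have [|z1 [Pz1 fz1 cz1 hz1]] := ih _ (PD _ _ t Pz Dv) fz'.
  apply: leq_trans (_ : #|[pred i | a i z != b i]| <= n)%N; last by rewrite -ltnS.
  apply: proper_card; apply/properP; split.
    apply/fintype.subsetP => i; rewrite !inE; apply: contra => /eqP ti.
    by rewrite aL tv// mulr0 addr0 ti.
  exists j; rewrite !inE.
    by apply/eqP => tj; rewrite (tv j tj) ltxx in jp.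
  by apply/negPn/eqP; rewrite aL /t divfK ?gt_eqF//; lra.
exists z1; split => //; apply: le_trans cz1; rewrite cL.
by have := mulr_ge0 t0 cv; lra.
Qed.

(** * Threshold channels *)

Definition mem_of (R : realType) (k : nat) (p : 'cV[R]_k) (i : nat) : R :=
  if insub i is Some x then p x 0 else 0.

Lemma mem_ofE (R : realType) (k : nat) (p : 'cV[R]_k) (x : 'I_k) :
  mem_of p x = p x 0.
Proof. by rewrite /mem_of valK. Qed.

(* The likelihood ratio of [x] is at least that of [t]; the sentinel [t = k]
   stands for a threshold that no input reaches. *)
Definition reaches (R : realType) (P Q : nat -> R) (k t x : nat) : bool :=
  (t < k)%N && (Q t * P x <= P t * Q x).

(** Counting makes the order in which the thresholds are guessed immaterial. *)
Definition level (R : realType) (P Q : nat -> R) (k n : nat) (t : nat -> nat)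
    (x : nat) : nat :=
  \sum_(j < n) reaches P Q k (t j) x.

Lemma level_le (R : realType) (P Q : nat -> R) k n t x :
  (level P Q k n t x <= n)%N.
Proof.
rewrite -[X in (_ <= X)%N]card_ord -sum1_card; apply: leq_sum => j _.
exact: leq_b1.
Qed.

Section Thresholds.
Variables (R : realType) (k : nat) (P Q : nat -> R).
Hypotheses (P0 : forall x : 'I_k, 0 <= P x) (Q0 : forall x : 'I_k, 0 <= Q x).

(** The member of [U] with the least ratio is a threshold for it, and [k] serves if there is none.
    Ratios are compared through [Q / (P + Q)], which also makes sense where [P] vanishes. *)
Lemma threshold_exists (U : pred 'I_k) :
  (forall x x' : 'I_k, 0 < P x + Q x -> 0 < P x' + Q x' ->
     Q x * P x' <= P x * Q x' -> U x -> U x') ->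
  exists t, [/\ (t <= k)%N, (t < k)%N -> 0 < P t + Q t &
    forall x : 'I_k, 0 < P x + Q x -> reaches P Q k t x = U x].
Proof.
move=> Uup; pose N := [pred x : 'I_k | (0 < P x + Q x) && U x].
have [x0 x0N|N0] := pickP N; last first.
  exists k; split; rewrite ?ltnn// => x nx; rewrite /reaches ltnn/=.
  by have := N0 x; rewrite /N /= nx.
have [t /andP[nt Ut] tmin] := @arg_minP _ _ _ x0 N (fun x => Q x / (P x + Q x)) x0N.
exists t; split=> [|//|x nx]; first exact/ltnW.
rewrite /reaches ltn_ord/=; apply/idP/idP => [h|Ux]; first exact: Uup h Ut.
have /tmin : N x by rewrite /N /= nx.
rewrite ler_pdivrMr// mulrAC ler_pdivlMr// mulrDr mulrDr [Q x * Q t]mulrC.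
by rewrite lerD2r [P t * _]mulrC.
Qed.

(** A difference of two quotients with denominators cleared: [(al * x + be * y) / (x + y)] moves in
    the direction of the sign of [be - al] as the likelihood ratio grows. *)
Lemma slope_identity (al be x y x' y' : R) :
  (al * x' + be * y') * (x + y) - (al * x + be * y) * (x' + y') =
  (be - al) * (x * y' - y * x').
Proof. by ring. Qed.

(** By [slope_identity], the inputs where the form is nonnegative are closed upwards if [al <= be],
    and those where it is negative are if [be < al]; either way one threshold separates the two
    signs. *)
Lemma sign_threshold (al be : R) :
  exists t, [/\ (t <= k)%N, (t < k)%N -> 0 < P t + Q t &
    forall x x' : 'I_k, 0 < P x + Q x -> 0 < P x' + Q x' ->
    reaches P Q k t x = reaches P Q k t x' ->
    (0 <= al * P x + be * Q x) = (0 <= al * P x' + be * Q x')].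
Proof.
have [ab|ba] := leP al be.
  have [x x' nx nx' h fx|t [tk tn ht]] := @threshold_exists (fun x => 0 <= al * P x + be * Q x).
    have := slope_identity al be (P x) (Q x) (P x') (Q x').
    have : 0 <= (be - al) * (P x * Q x' - Q x * P x') by rewrite mulr_ge0 ?subr_ge0.
    set f' := al * P x' + _ => h1 h2.
    rewrite -(pmulr_lge0 _ nx).
    have : 0 <= (al * P x + be * Q x) * (P x' + Q x') by rewrite mulr_ge0 ?(ltW nx').
    by lra.
  by exists t; split=> // x x' nx nx'; rewrite !ht.
have [x x' nx nx' h fx|t [tk tn ht]] := @threshold_exists (fun x => al * P x + be * Q x < 0).
  have := slope_identity al be (P x) (Q x) (P x') (Q x').
  have : (be - al) * (P x * Q x' - Q x * P x') <= 0.
    by rewrite mulr_le0_ge0 ?subr_ge0// subr_le0 ltW.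
  set f' := al * P x' + _ => h1 h2.
  rewrite -(pmulr_llt0 _ nx).
  have : (al * P x + be * Q x) * (P x' + Q x') < 0 by rewrite pmulr_llt0.
  by lra.
by exists t; split=> // x x' nx nx'; rewrite !ht// !leNgt => ->.
Qed.

(* The sets of reached thresholds are totally ordered by inclusion, so their
   cardinality determines them. *)
Lemma level_inj n (t : nat -> nat) (x x' : 'I_k) :
  (forall j, (j < n)%N -> (t j < k)%N -> 0 < P (t j) + Q (t j)) ->
  0 < P x + Q x -> 0 < P x' + Q x' ->
  level P Q k n t x = level P Q k n t x' ->
  forall j, (j < n)%N -> reaches P Q k (t j) x = reaches P Q k (t j) x'.
Proof.
move=> nt.
wlog xx' : x x' / Q x * P x' <= P x * Q x'.
  move=> wl nx nx' e j jn; have [h|/ltW h] := leP (Q x * P x') (P x * Q x').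
    exact: wl.
  by apply/esym/wl => //; rewrite mulrC [P x' * _]mulrC.
move=> nx nx' e.
have mono (j : 'I_n) : (reaches P Q k (t j) x <= reaches P Q k (t j) x')%N.
  rewrite /reaches; case: ltnP => //= tk; case: leP => //= h.
  have ntj := nt j (ltn_ord j) tk.
  have [Pt Qt] : 0 <= P (t j) /\ 0 <= Q (t j).
    by have := P0 (Ordinal tk); have := Q0 (Ordinal tk).
  have h' : Q (t j) * P x' <= P (t j) * Q x'.
    rewrite -(ler_pM2l nx) -subr_ge0.
    have [x0 y0] := (P0 x, Q0 x); have [x0' y0'] := (P0 x', Q0 x').
    rewrite (_ : _ - _ = (P (t j) * Q x - Q (t j) * P x) * (P x' + Q x') +
      (P (t j) + Q (t j)) * (P x * Q x' - Q x * P x')); last by ring.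
    by apply: addr_ge0; apply: mulr_ge0; rewrite ?subr_ge0// addr_ge0.
  by rewrite h'.
move=> j jn; have : forall i : 'I_n, true -> (reaches P Q k (t i) x <= reaches P Q k (t i) x' ?=
    iff (reaches P Q k (t i) x == reaches P Q k (t i) x'))%N.
  by move=> i _; split; [exact: mono|case: reaches; case: reaches].
move/leqif_sum => -[_]; rewrite -/(level P Q k n t x) -/(level P Q k n t x') e eqxx.
by move/esym/forallP/(_ (Ordinal jn))/eqP.
Qed.

End Thresholds.

(** * Linear functionals of the joint range and their threshold maximisers *)

Definition functional (R : realType) l k (a b : 'I_l -> R) (p q : 'cV[R]_k)
    (T : 'M[R]_(l, k)) : R :=
  \sum_y (a y * (T *m p) y 0 + b y * (T *m q) y 0).

Lemma functionalE (R : realType) l k (a b : 'I_l -> R) (p q : 'cV[R]_k) T :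
  functional a b p q T = \sum_x \sum_y T y x * (a y * p x 0 + b y * q x 0).
Proof.
rewrite /functional exchange_big/=; apply: eq_bigr => y _.
rewrite !mxE !mulr_sumr -big_split/=; apply: eq_bigr => x _.
by ring.
Qed.

(** The rank of [y] is the number of predecessors in the order by [f], with ties broken by index so
    that ranks are distinct. *)
Lemma rank_perm (R : realType) l (f : 'I_l -> R) :
  exists s : 'S_l, forall y y' : 'I_l, (s y <= s y')%N -> f y <= f y'.
Proof.
pose lt (y y' : 'I_l) := (f y < f y') || (f y == f y') && (y < y')%N.
have lt_irr y : lt y y = false by rewrite /lt ltxx ltnn andbF.
have lt_tr y1 y2 y3 : lt y1 y2 -> lt y2 y3 -> lt y1 y3.
  rewrite /lt => /orP[h1|/andP[/eqP e1 h1]] /orP[h2|/andP[/eqP e2 h2]].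
  - by rewrite (lt_trans h1 h2).
  - by rewrite -e2 h1.
  - by rewrite e1 h2.
  - by rewrite e1 e2 eqxx (ltn_trans h1 h2) orbT.
have lt_total y y' : y != y' -> lt y y' || lt y' y.
  rewrite /lt; case: (ltgtP (f y) (f y')) => //= e ny.
  by move: ny; rewrite -val_eqE/=; case: ltngtP.
pose r (y : 'I_l) := #|[pred y' | lt y' y]|.
have r_lt y : (r y < l)%N.
  rewrite -[X in (_ < X)%N]card_ord; apply: proper_card; apply/properP; split.
    exact/fintype.subsetP.
  by exists y; rewrite ?inE// lt_irr.
have r_mono y y' : lt y y' -> (r y < r y')%N.
  move=> h; apply: proper_card; apply/properP; split.
    by apply/fintype.subsetP => z; rewrite !inE => hz; exact: lt_tr hz h.
  by exists y; rewrite !inE ?lt_irr.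
pose R' y := Ordinal (r_lt y).
have R'_inj : injective R'.
  move=> y y' /(congr1 val)/= e; apply/eqP/contraT => /lt_total/orP[]/r_mono;
    by rewrite e ltnn.
exists (perm R'_inj) => y y'; rewrite !permE /= => h.
rewrite leNgt; apply/negP => h'.
have : lt y' y by rewrite /lt h'.
by move/r_mono; rewrite ltnNge h.
Qed.

Lemma sum_ltn_ord (m r : nat) : (r <= m)%N -> (\sum_(j < m) (j < r) = r)%N.
Proof.
elim: m => [|m ih]; first by rewrite leqn0 => /eqP->; rewrite big_ord0.
rewrite leq_eqVlt => /orP[/eqP->|].
  rewrite (eq_bigr (fun=> 1%N)) => [|i _]; last by rewrite ltn_ord.
  by rewrite sum1_card card_ord.
by rewrite ltnS big_ord_recr/= ltnNge => h; rewrite ih// h addn0.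
Qed.

(** Among the outputs of largest coefficient at [x], the one of highest slope rank is taken. This
    tie-break makes the rank of the chosen output monotone in the likelihood ratio, so threshold [j]
    can mark where the rank exceeds [j], and the level is the rank. *)
Lemma channel_functional_max (R : realType) (l k : nat) (p q : 'cV[R]_k)
    (a b : 'I_l -> R) (T : 'M[R]_(l, k)) :
  (0 < l)%N -> (forall x, 0 <= p x 0) -> (forall x, 0 <= q x 0) ->
  channels T ->
  exists t, [/\ forall j, (t j <= k)%N &
    exists s : 'S_l, functional a b p q T <= functional a b p q
      (perm_mx s *m \matrix_(y, x)
        (level (mem_of p) (mem_of q) k l.-1 t x == y :> nat)%:R)].
Proof.
case: l a b T => // l a b T _ p0 q0 [T0 T1].
set P := mem_of p; set Q := mem_of q.
have P0 (x : 'I_k) : 0 <= P x by rewrite /P mem_ofE.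
have Q0 (x : 'I_k) : 0 <= Q x by rewrite /Q mem_ofE.
have [s hs] := rank_perm (fun y => b y - a y).
pose c y (x : 'I_k) := a y * P x + b y * Q x.
have /choice[Y hY] (x : 'I_k) : exists y, (forall y', c y' x <= c y x) /\
    (forall y', (forall y'', c y'' x <= c y' x) -> (s y' <= s y)%N).
  have [y1 _ h1] := @arg_maxP _ _ _ (ord0 : 'I_l.+1) xpredT (fun y => c y x) isT.
  have h1' : [forall y', c y' x <= c y1 x] by apply/forallP => y'; exact: h1.
  have [y hy ymax] := @arg_maxnP _ y1 (fun y => [forall y', c y' x <= c y x])
    (fun y => s y) h1'.
  exists y; split; first exact/forallP.
  by move=> y' h; apply: ymax; apply/forallP.
have /choice[t ht] (j : nat) : exists t, (t <= k)%N /\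
    forall x : 'I_k, 0 < P x + Q x -> reaches P Q k t x = (j < s (Y x))%N.
  have [x x' nx nx' h jx|t [tk _ th]] := @threshold_exists _ _ P Q (fun x => j < s (Y x))%N.
    (* If the output chosen at [x'] had smaller rank than the one chosen at [x], its slope would be
       no larger. The latter output, optimal at [x], would then still be optimal at [x'], against
       the tie-break there. *)
    apply: leq_trans jx _; rewrite leqNgt; apply/negP => lts.
    have sl := hs _ _ (ltnW lts).
    have [m1 m2] := hY x; have [m1' m2'] := hY x'.
    move: (lts); rewrite ltnNge => /negP; apply.
    apply: m2' => y; apply: le_trans (m1' y) _.
    rewrite -subr_ge0 -(pmulr_lge0 _ nx).
    have := slope_identity (a (Y x) - a (Y x')) (b (Y x) - b (Y x'))
      (P x) (Q x) (P x') (Q x').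
    have : 0 <= (b (Y x) - b (Y x') - (a (Y x) - a (Y x'))) * (P x * Q x' - Q x * P x').
      by rewrite mulr_ge0 ?subr_ge0//; lra.
    have : 0 <= (c (Y x) x - c (Y x') x) * (P x' + Q x').
      by rewrite mulr_ge0 ?(ltW nx')// subr_ge0.
    rewrite /c => h1 h2 h3.
    set u := (X in 0 <= X); set w := (X in _ = X) in h3.
    have -> : u = (a (Y x) * P x + b (Y x) * Q x - (a (Y x') * P x + b (Y x') * Q x)) *
      (P x' + Q x') + w by rewrite -h3 /u; ring.
    by rewrite addr_ge0.
  by exists t.
exists t; split=> [j|]; first exact: (ht j).1.
exists s; rewrite !functionalE; apply: ler_sum => x _.
rewrite (eq_bigr (fun y => T y x * c y x)); last by move=> y _; rewrite /c /P /Q !mem_ofE.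
rewrite [leRHS](eq_bigr (fun y => (level P Q k l t x == s y :> nat)%:R * c y x)); last first.
  by move=> y _; rewrite -row_permE !mxE /c /P /Q !mem_ofE.
have [nx|] := ltP 0 (P x + Q x); last first.
  move=> z; have Px : P x = 0 by have := P0 x; have := Q0 x; lra.
  have Qx : Q x = 0 by have := P0 x; have := Q0 x; lra.
  by rewrite !big1// => y _; rewrite /c Px Qx !mulr0 addr0 mulr0.
have -> : level P Q k l t x = s (Y x).
  rewrite /level (eq_bigr (fun j : 'I_l => (j < s (Y x) : nat)%N)).
    by rewrite sum_ltn_ord// -ltnS.
  by move=> j _; rewrite (ht j).2.
rewrite [leRHS](bigD1 (Y x))//= eqxx mul1r [X in _ + X]big1; last first.
  move=> y /negbTE hy.
  by rewrite (inj_eq val_inj) (inj_eq perm_inj) eq_sym hy mul0r.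
rewrite addr0 -[leRHS]mul1r -(T1 x) mulr_suml; apply: ler_sum => y _.
by rewrite ler_wpM2l//; have [] := hY x.
Qed.

(** * Private channels: reduction to vertices *)

(* Fractional knapsack: an optimum for [c] is characterised by an exchange
   condition that depends only on the order of the coefficients. *)
Lemma box_common_max (R : realType) l (m M c t0 : 'I_l -> R) :
  (forall y, m y <= t0 y <= M y) -> \sum_y t0 y = 1 ->
  exists t : 'I_l -> R, [/\ forall y, m y <= t y <= M y, \sum_y t y = 1 &
    forall c' t' : 'I_l -> R,
      (forall y y', c y <= c y' -> c' y <= c' y') ->
      (forall y, m y <= t' y <= M y) -> \sum_y t' y = 1 ->
      \sum_y t' y * c' y <= \sum_y t y * c' y].
Proof.
move=> t0b t01.
have csum (d : 'I_l -> R) : continuous (fun v : 'rV[R]_l => \sum_y v ord0 y * d y).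
  apply: continuous_sum_fun => y v.
  apply: (@continuousM R _ (fun v : 'rV[R]_l => v ord0 y) (fun=> d y)).
    exact: coord_continuous_rV.
  exact: cst_continuous.
have [|u] := @EVT_max_rV R _ _ _ _ (@compact_box_slice R _ m M _ 1 (csum (fun=> 1)))
    (continuous_subspaceT (csum c)).
  exists (\row_y t0 y); split => [y|]; first by rewrite mxE.
  by rewrite -[RHS]t01; apply: eq_bigr => y _; rewrite mxE mulr1.
rewrite inE => -[ub u1] umax.
have {}u1 : \sum_y u ord0 y = 1 by rewrite -[RHS]u1; apply: eq_bigr => y _; rewrite mulr1.
pose t y := u ord0 y.
have exch y y' : c y' < c y -> t y = M y \/ t y' = m y'.
  move=> cyy; have [|ny] := eqVneq (t y) (M y); first by left.
  have [|ny'] := eqVneq (t y') (m y'); first by right.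
  have /andP[a1 a2] : m y <= t y <= M y := ub y.
  have /andP[b1 b2] : m y' <= t y' <= M y' := ub y'.
  have yy' : y != y' by apply: contraTneq cyy => ->; rewrite ltxx.
  have gy : t y < M y by rewrite lt_neqAle ny a2.
  have gy' : m y' < t y' by rewrite lt_neqAle eq_sym ny' b1.
  (* Moving mass [e] from [y'] to [y] respects the box and the sum and gains [e * (c y - c y')],
     which optimality forbids. *)
  pose e := Num.min (M y - t y) (t y' - m y').
  have e0 : 0 < e by rewrite lt_min !subr_gt0 gy gy'.
  have e1 : e <= M y - t y by rewrite ge_min lexx.
  have e2 : e <= t y' - m y' by rewrite ge_min lexx orbT.
  pose v : 'rV[R]_l := \row_z (t z + e * (z == y)%:R - e * (z == y')%:R).
  have sv (d : 'I_l -> R) : \sum_z v ord0 z * d z = \sum_z t z * d z + e * (d y - d y').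
    transitivity (\sum_z (t z * d z + (z == y)%:R * (e * d z) - (z == y')%:R * (e * d z))).
      by apply: eq_bigr => z _; rewrite mxE; ring.
    rewrite sumrB big_split/= (bigD1 y (P := xpredT) (F := fun z => (z == y)%:R * _))//= eqxx mul1r.
    rewrite [X in _ + (_ + X)]big1 => [|z /negbTE->]; last by rewrite mul0r.
    rewrite (bigD1 y' (P := xpredT) (F := fun z => (z == y')%:R * _))//= eqxx mul1r.
    rewrite [X in _ - (_ + X)]big1 => [|z /negbTE->]; last by rewrite mul0r.
    by ring.
  have /umax : v \in [set v : 'rV[R]_l | (forall i, m i <= v ord0 i <= M i) /\
      \sum_y v ord0 y * 1 = 1].
    rewrite inE; split=> [z|]; last first.
      rewrite sv subrr mulr0 addr0 -[RHS]u1.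
      by apply: eq_bigr => z _; rewrite mulr1.
    rewrite mxE; have [->|zy] := eqVneq z y.
      rewrite (negbTE yy') mulr1 mulr0 subr0; apply/andP; split; lra.
    rewrite mulr0 addr0; have [->|zy'] := eqVneq z y'.
      by rewrite mulr1; apply/andP; split; lra.
    by rewrite mulr0 subr0; exact: ub.
  rewrite sv => h; have : e * (c y - c y') <= 0 by rewrite /t in h; lra.
  by rewrite pmulr_rle0// subr_le0 leNgt cyy.
exists t; split => // c' t' hc t'b t'1.
rewrite -subr_le0 -sumrB.
have sd : \sum_y (t' y - t y) = 0 by rewrite sumrB t'1 u1 subrr.
(* [y0] maximises [c'] among the outputs below their upper bound. Outputs with larger [c'] are full
   and those with smaller [c'] are at their lower bound, so after subtracting [c' y0] every term has
   the right sign. If all outputs are full, the sum forces [t' = t]. *)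
have [y1 y1n|hM] := pickP (fun y => t y != M y).
  have [y0 y0n ymax] := @arg_maxP _ _ _ y1 (fun y => t y != M y) c' y1n.
  rewrite (eq_bigr (fun y => (t' y - t y) * (c' y - c' y0) + (t' y - t y) * c' y0));
    last by move=> y _; ring.
  rewrite big_split/= -mulr_suml sd mul0r addr0; apply: sumr_le0 => y _.
  have [h|h|->] := ltgtP (c' y) (c' y0); last by rewrite subrr mulr0.
    have : c y < c y0 by rewrite ltNge; apply/negP => /hc; rewrite leNgt h.
    move=> /exch[] e; first by rewrite e eqxx in y0n.
    by rewrite mulr_ge0_le0 ?subr_le0 ?(ltW h)// subr_ge0 e; have /andP[] := t'b y.
  have e : t y = M y.
    apply/eqP/contraT => ny; have : c' y <= c' y0 := ymax y ny.
    by rewrite leNgt h.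
  by rewrite mulr_le0_ge0 ?subr_ge0 ?(ltW h)// subr_le0 e; have /andP[] := t'b y.
have d0 y : t y - t' y = 0.
  have d0 z : 0 <= t z - t' z.
    have /negbFE/eqP-> := hM z; rewrite subr_ge0; by have /andP[] := t'b z.
  have /eqP : \sum_z (t z - t' z) = 0 by rewrite sumrB t'1 u1 subrr.
  by rewrite psumr_eq0// => /allP/(_ y); rewrite mem_index_enum => /(_ isT)/eqP.
by rewrite big1// => y _; rewrite -mulrBl -opprB d0 oppr0 mul0r.
Qed.

(** [m y] may be any lower bound of its row, not just the minimum: this keeps the constraints linear
    in [m] and [C] jointly. *)
Definition ldp_polytope (R : realType) (E : R) l K (m : 'cV[R]_l)
    (C : 'M[R]_(l, K)) : Prop :=
  [/\ forall y, 0 <= m y 0, forall y j, m y 0 <= C y j <= E * m y 0 &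
    forall j, \sum_y C y j = 1].

(** Extremality in algebraic form: no nonzero direction keeps all tight constraints tight. *)
Definition ldp_vertex (R : realType) (E : R) l K (m : 'cV[R]_l)
    (C : 'M[R]_(l, K)) : Prop :=
  forall (v : 'cV[R]_l) (D : 'M[R]_(l, K)),
    (forall j, \sum_y D y j = 0) ->
    (forall y, m y 0 = 0 -> v y 0 = 0) ->
    (forall y j, C y j = m y 0 -> D y j = v y 0) ->
    (forall y j, C y j = E * m y 0 -> D y j = E * v y 0) ->
    v = 0 /\ D = 0.

Lemma ldp_vertex_exists (R : realType) (E : R) l K (m : 'cV[R]_l)
    (C : 'M[R]_(l, K.+1)) (c : 'I_l -> 'I_K.+1 -> R) :
  ldp_polytope E m C ->
  exists m' C', [/\ @ldp_polytope R E l K.+1 m' C', ldp_vertex E m' C' &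
    \sum_y \sum_j C y j * c y j <= \sum_y \sum_j C' y j * c y j].
Proof.
move=> [m0 mC C1].
pose V := ('cV[R]_l * 'M[R]_(l, K.+1))%type.
pose a (i : 'I_l + 'I_l * 'I_K.+1 * bool) (z : V) : R :=
  match i with
  | inl y => - z.1 y 0
  | inr (y, j, b) => if b then z.2 y j - E * z.1 y 0 else z.1 y 0 - z.2 y j
  end.
pose f (z : V) := \sum_y \sum_j z.2 y j * c y j.
have [||||||| [m' C'] [P' F' cc hv]] := @vertex_improve R V _ a (fun=> 0) f
  (fun z => forall j, \sum_y z.2 y j = 1) (fun z => forall j, \sum_y z.2 y j = 0) (m, C).
- by move=> [y|[[y j] []]] u v t; rewrite /a /= !mxE; ring.
- move=> u v t; rewrite /f mulr_sumr -big_split/=; apply: eq_bigr => y _.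
  by rewrite mulr_sumr -big_split/=; apply: eq_bigr => j _; rewrite !mxE; ring.
- move=> u v t hu hv j; under eq_bigr do rewrite !mxE.
  by rewrite big_split/= -mulr_sumr hu hv mulr0 addr0.
- by move=> v hv j; under eq_bigr do rewrite mxE; rewrite sumrN hv oppr0.
(* No rays: otherwise [0 <= v y <= D y j] with columns summing to zero, so [D = 0], and then [v = 0]
   because there is at least one column. *)
- move=> [v D] /= hD; apply: contra_neqP => /forallNP hi.
  have {}hi i : a i (v, D) <= 0 by rewrite leNgt; apply/negP; exact: hi.
  have v0 y : 0 <= v y 0 by have := hi (inl y); rewrite /a /= oppr_le0.
  have vD y j : v y 0 <= D y j by have := hi (inr (y, j, false)); rewrite /a /= subr_le0.
  have D0 y j : D y j = 0.
    have /eqP := hD j; rewrite psumr_eq0 => [|z _]; last exact: le_trans (v0 z) (vD z j).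
    by move=> /allP/(_ y); rewrite mem_index_enum => /(_ isT)/eqP.
  congr pair; last by apply/matrixP => y j; rewrite D0 mxE.
  apply/colP => y; rewrite mxE; apply/eqP; rewrite eq_le v0 andbT.
  by have := vD y ord0; rewrite D0.
- by [].
- move=> [y|[[y j] []]]; rewrite /a /= ?oppr_le0 ?subr_le0//; by have /andP[] := mC y j.
exists m', C'; split => //.
- split=> [y|y j|//].
    by have := F' (inl y); rewrite /a /= oppr_le0.
  have := F' (inr (y, j, false)); have := F' (inr (y, j, true)).
  by rewrite /a /= !subr_le0 => -> ->.
- move=> v D hD h1 h2 h3.
  suff : (v, D) = 0 :> V by move=> [-> ->].
  apply: hv => // -[y|[[y j] []]]; rewrite /a /=.
  + by move=> /eqP; rewrite oppr_eq0 => /eqP/h1->; rewrite oppr0.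
  + by move=> /eqP; rewrite subr_eq0 => /eqP/h3->; rewrite subrr.
  + by move=> /eqP; rewrite subr_eq0 eq_sym => /eqP/h2->; rewrite subrr.
Qed.

(** Threshold [y * l + y'] marks where the comparison of the coefficients of [y] and [y'] changes.
    Inputs of equal level order the outputs alike and so share an optimal column of the knapsack
    problem. *)
Lemma ldp_functional_max (R : realType) (eps : R) (l k : nat) (p q : 'cV[R]_k)
    (a b : 'I_l -> R) (T : 'M[R]_(l, k)) :
  (0 < k)%N -> (forall x, 0 <= p x 0) -> (forall x, 0 <= q x 0) ->
  ldp_channels eps T ->
  exists t m (C : 'M[R]_(l, (l * l).+1)), [/\ forall j, (t j <= k)%N,
    ldp_polytope (expR eps) m C, ldp_vertex (expR eps) m C &
    functional a b p q T <= functional a b p q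
      (\matrix_(y, x) C y (inord (level (mem_of p) (mem_of q) k (l * l) t x)))].
Proof.
move=> k0 p0 q0 [[T0 T1] TE].
set P := mem_of p; set Q := mem_of q; set E := expR eps.
have P0 (x : 'I_k) : 0 <= P x by rewrite /P mem_ofE.
have Q0 (x : 'I_k) : 0 <= Q x by rewrite /Q mem_ofE.
pose c y (x : 'I_k) := a y * P x + b y * Q x.
pose x0 := Ordinal k0.
have /choice[m hm] (y : 'I_l) : exists m : R, 0 <= m /\ forall x, m <= T y x <= E * m.
  have [x1 _ h1] := @arg_minP _ _ _ x0 xpredT (fun x => T y x) isT.
  by exists (T y x1); split=> // x; rewrite h1//= TE.
pose ab (f : 'I_l -> R) (i : nat) := if insub i is Some y then f y else 0.
have abE f (y : 'I_l) : ab f y = f y by rewrite /ab valK.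
have /choice[t ht] (j : nat) := @sign_threshold R k P Q
  (ab a (j %% l)%N - ab a (j %/ l)%N) (ab b (j %% l)%N - ab b (j %/ l)%N).
have same_order (x x' : 'I_k) : 0 < P x + Q x -> 0 < P x' + Q x' ->
    level P Q k (l * l) t x = level P Q k (l * l) t x' ->
    forall y y', c y x <= c y' x -> c y x' <= c y' x'.
  move=> nx nx' e y y'.
  have jl : (y * l + y' < l * l)%N.
    by rewrite (leq_trans (_ : _ < y.+1 * l)%N) ?leq_mul2r ?ltn_ord ?orbT// mulSnr ltn_add2l.
  have [_ _ /(_ _ _ nx nx')] := ht (y * l + y')%N.
  have [e1 e2] : ((y * l + y') %/ l = y /\ (y * l + y') %% l = y')%N.
    have l0 : (0 < l)%N by exact: leq_ltn_trans (ltn_ord y).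
    by rewrite divnMDl// divn_small// addn0 modnMDl modn_small.
  rewrite e1 e2 !abE (level_inj P0 Q0 _ nx nx' e jl); last first.
    by move=> i _; have [_ ]:= ht i.
  move=> /(_ erefl) h; rewrite -[c y x <= _]subr_ge0 -[c y x' <= _]subr_ge0 /c.
  rewrite (_ : _ - _ = (a y' - a y) * P x + (b y' - b y) * Q x); last by ring.
  by rewrite h => h'; rewrite (le_trans h')// le_eqVlt; apply/orP; left; apply/eqP; ring.
have /choice[col hcol] (j : 'I_(l * l).+1) : exists col : 'I_l -> R,
    [/\ forall y, m y <= col y <= E * m y, \sum_y col y = 1 &
      forall x : 'I_k, 0 < P x + Q x -> level P Q k (l * l) t x = j ->
        \sum_y T y x * c y x <= \sum_y col y * c y x].
  have [x1 /andP[nx1 /eqP lx1]|none] :=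
    pickP (fun x : 'I_k => (0 < P x + Q x) && (level P Q k (l * l) t x == j)).
    have [col [h1 h2 h3]] := @box_common_max R l m (fun y => E * m y) (fun y => c y x1)
      (fun y => T y x1) (fun y => (hm y).2 x1) (T1 x1).
    exists col; split => // x nx lx; apply: h3 => //.
      by apply: same_order => //; rewrite lx.
    by move=> y; exact: (hm y).2.
  (* No input of positive weight has this level, so any column in the box will do. *)
  exists (fun y => T y x0); split=> [y||x nx lx]; [exact: (hm y).2|exact: T1|].
  by have := none x; rewrite nx lx eqxx.
pose C0 : 'M[R]_(l, (l * l).+1) := \matrix_(y, j) col j y.
pose lev (x : 'I_k) : 'I_(l * l).+1 := inord (level P Q k (l * l) t x).
have levE (x : 'I_k) : level P Q k (l * l) t x = lev x by rewrite inordK// ltnS level_le.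
(* Summing the coefficients over the inputs of a level makes the objective linear in the [l * l + 1]
   columns. *)
have [|m1 [C [hC vC leC]]] := @ldp_vertex_exists R E l (l * l) (\col_y m y) C0
  (fun y j => \sum_(x | lev x == j) c y x).
  split=> [y|y j|j]; first by rewrite mxE; have [] := hm y.
    by rewrite !mxE; have [] := hcol j.
  by under eq_bigr do rewrite mxE; have [] := hcol j.
have fE (D : 'M[R]_(l, (l * l).+1)) :
    \sum_y \sum_j D y j * (\sum_(x | lev x == j) c y x) =
    \sum_x \sum_y D y (lev x) * c y x.
  rewrite [RHS]exchange_big/=; apply: eq_bigr => y _.
  rewrite [RHS](partition_big lev xpredT)//=; apply: eq_bigr => j _.
  by rewrite mulr_sumr; apply: eq_bigr => x /eqP->.
rewrite !fE in leC.
exists t, m1, C; split => // [j|]; first by have [] := ht j.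
rewrite !functionalE.
have cE (D : 'M[R]_(l, k)) : \sum_x \sum_y D y x * (a y * p x 0 + b y * q x 0) =
    \sum_x \sum_y D y x * c y x.
  by apply: eq_bigr => x _; apply: eq_bigr => y _; rewrite /c /P /Q !mem_ofE.
rewrite !cE [leRHS](eq_bigr (fun x => \sum_y C y (lev x) * c y x)); last first.
  by move=> x _; apply: eq_bigr => y _; rewrite mxE.
apply: le_trans leC; apply: ler_sum => x _.
rewrite [leRHS](eq_bigr (fun y => col (lev x) y * c y x)); last by move=> y _; rewrite mxE.
have [nx|z] := ltP 0 (P x + Q x); first by have [_ _] := hcol (lev x); apply => //; rewrite levE.
have Px : P x = 0 by have := P0 x; have := Q0 x; lra.
have Qx : Q x = 0 by have := P0 x; have := Q0 x; lra.
by rewrite !big1// => y _; rewrite /c Px Qx !mulr0 addr0 mulr0.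
Qed.

(** * Elimination with prescribed pivots *)

Section Gauss.
Variable (R : realType).
Implicit Types (A : nat -> nat -> R) (b : nat -> R).

Definition pivot_mx A c r : nat -> nat -> R :=
  fun i j => if i == r then A i j else A i j - A i c / A r c * A r j.

Definition pivot_rhs A b c r : nat -> R :=
  fun i => if i == r then b i else b i - A i c / A r c * b r.

Fixpoint gauss A b (rho : nat -> nat) n : (nat -> nat -> R) * (nat -> R) :=
  if n is n'.+1 then
    let: (A', b') := gauss A b rho n' in
    (pivot_mx A' n' (rho n'), pivot_rhs A' b' n' (rho n'))
  else (A, b).

Lemma gauss_ext A b rho rho' n :
  (forall c, (c < n)%N -> rho c = rho' c) -> gauss A b rho n = gauss A b rho' n.
Proof.
elim: n => //= n ih h; rewrite ih ?h// => c cn; exact/h/ltnW.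
Qed.

(** Gauss-Jordan elimination: a pivot column is cleared in all other rows, also the earlier pivot
    rows, so each unknown is finally read off a single row. A trivial kernel guarantees that a new
    pivot row can always be found. *)
Lemma gauss_pivots l A b (m : nat -> R) :
  (forall v : nat -> R, (forall i, (i < l)%N -> \sum_(j < l) A i j * v j = 0) ->
     forall j, (j < l)%N -> v j = 0) ->
  (forall i, (i < l)%N -> \sum_(j < l) A i j * m j = b i) ->
  exists rho, (forall c, (c < l)%N -> (rho c < l)%N) /\
    forall c, (c < l)%N ->
      m c = (gauss A b rho l).2 (rho c) / (gauss A b rho l).1 (rho c) c.
Proof.
move=> ker sol.
suff [rho] : exists rho, let: (An, bn) := gauss A b rho l in
    [/\ (forall c, (c < l)%N -> (rho c < l)%N) /\
      (forall c c', (c < l)%N -> (c' < l)%N -> rho c = rho c' -> c = c'),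
      forall c i, (c < l)%N -> (i < l)%N -> i != rho c -> An i c = 0,
      forall c, (c < l)%N -> An (rho c) c != 0,
      forall v : nat -> R, (forall i, (i < l)%N -> \sum_(j < l) An i j * v j = 0) ->
        forall j, (j < l)%N -> v j = 0 &
      forall i, (i < l)%N -> \sum_(j < l) An i j * m j = bn i].
  case gE : gauss => [An bn] [[rl rinj] An0 Ad0 _ sl].
  exists rho; split => // c cl; rewrite gE /=.
  rewrite -sl ?rl// (bigD1 (Ordinal cl))//= big1 ?addr0; first by rewrite mulrAC mulfV ?mul1r ?Ad0.
  move=> i ic; rewrite An0 ?mul0r ?rl//; apply: contra ic => /eqP/rinj e.
  by rewrite -val_eqE /= e.
have : (l <= l)%N by [].
(* Only the occurrences of [l] that count processed columns are generalised; those that give the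
   dimension stay. *)
move: {1 3 4 6 7 8 10}l => n; elim: n => [_|n ih nl].
  by exists (fun=> 0%N).
have [rho] := ih (ltnW nl).
case gE : gauss => [An bn] [[rl rinj] An0 Ad0 kn sn].
have [r [rlt rn rA]] : exists r, [/\ (r < l)%N, forall c, (c < n)%N -> rho c != r & An r n != 0].
  apply: contrapT => /forallNP no.
  have {}no i : (i < l)%N -> (forall c, (c < n)%N -> rho c != i) -> An i n = 0.
    by move=> il ic; apply/eqP/negPn/negP => h; apply: (no i).
  pose v c : R := if c == n then 1 else
    if (c < n)%N then - (An (rho c) n / An (rho c) c) else 0.
  have : v n = 0; last by rewrite /v eqxx => /eqP; rewrite oner_eq0.
  apply: (kn v _ n nl) => i il.
  have [[c [cn ci]]|nc] := pselect (exists c, (c < n)%N /\ rho c = i).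
    have cl := ltn_trans cn nl.
    rewrite (bigD1 (Ordinal cl))//= (bigD1 (Ordinal nl))/=; last first.
      by rewrite -val_eqE/= gtn_eqF.
    rewrite big1 ?addr0.
      rewrite /v (ltn_eqF cn) cn eqxx ci mulr1 -ci mulrN mulrC divfK ?Ad0//.
      by rewrite addNr.
    move=> [j jl] /andP[]; rewrite -!val_eqE/= => jc jn.
    rewrite /v (negbTE jn); case: ltnP => h; last by rewrite mulr0.
    rewrite An0 ?mul0r//; apply: contra jc => /eqP e; apply/eqP.
    by apply: rinj => //; rewrite ci e.
  rewrite big1// => -[j jl] _ /=.
  have {}nc c : (c < n)%N -> rho c != i.
    by move=> cn; apply/negP => /eqP e; apply: nc; exists c.
  rewrite /v; have [->|_] := eqVneq j n; first by rewrite no// mul0r.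
  by case: ltnP => h; rewrite ?mulr0// An0 ?mul0r// eq_sym nc.
exists (fun c => if c == n then r else rho c).
have -> /= : gauss A b (fun c => if c == n then r else rho c) n.+1 =
    (pivot_mx An n r, pivot_rhs An bn n r).
  rewrite /= (@gauss_ext _ _ _ rho) ?gE ?eqxx//.
  by move=> c /ltn_eqF->.
(* The new pivot row is zero in the earlier pivot columns, so subtracting its multiples leaves them
   cleared. *)
have rc0 c : (c < n)%N -> An r c = 0.
  by move=> cn; rewrite An0// eq_sym rn.
split; first split.
- move=> c; rewrite ltnS leq_eqVlt; case: (c == n) => /= [_|]; first exact: rlt.
  exact: rl.
- move=> c c'; rewrite !ltnS (leq_eqVlt c) (leq_eqVlt c').
  have [->|_] := eqVneq c n; have [->|_] := eqVneq c' n => //= h1 h2.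
  + by move=> e; have := rn _ h2; rewrite e eqxx.
  + by move=> e; have := rn _ h1; rewrite e eqxx.
  + exact: rinj.
- move=> c i; rewrite ltnS leq_eqVlt.
  have [->|_] := eqVneq c n => /= cn il ir.
    by rewrite /pivot_mx (negbTE ir) divfK// subrr.
  rewrite /pivot_mx (rc0 c)// mulr0 subr0 if_same.
  exact: An0.
- move=> c; rewrite ltnS leq_eqVlt.
  have [->|_] := eqVneq c n => /= cn; first by rewrite /pivot_mx eqxx.
  by rewrite /pivot_mx (rc0 c)// mulr0 subr0 if_same Ad0.
- move=> v hv; apply: kn => i il.
  have hr : \sum_(j < l) An r j * v j = 0.
    rewrite -[RHS](hv r rlt); apply: eq_bigr => j _.
    by rewrite /pivot_mx eqxx.
  have [->//|ir] := eqVneq i r.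
  transitivity (\sum_(j < l) pivot_mx An n r i j * v j + An i n / An r n * \sum_(j < l) An r j * v j).
    rewrite mulr_sumr -big_split/=; apply: eq_bigr => j _.
    by rewrite /pivot_mx (negbTE ir); ring.
  by rewrite hv// hr mulr0 addr0.
- move=> i il; rewrite /pivot_rhs -(sn i il) -(sn r rlt).
  have [->|ir] := eqVneq i r.
    by apply: eq_bigr => j _; rewrite /pivot_mx eqxx.
  rewrite mulr_sumr -sumrB; apply: eq_bigr => j _.
  by rewrite /pivot_mx (negbTE ir) mulrBl mulrA.
Qed.

End Gauss.

(** * The linear system at a vertex and its encoding by digits *)

Definition coef (R : realType) (E : R) (d : nat) : R :=
  if d == 1 then 1 else if d == 2 then E else 0.

Lemma coef0 (R : realType) (E : R) : coef E 0 = 0.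
Proof. by []. Qed.

Lemma coef1 (R : realType) (E : R) : coef E 1 = 1.
Proof. by []. Qed.

(* A vertex is determined by [m], which solves a square linear system whose
   coefficients and right-hand side are [0], [1] or [E], and by the pattern [e]
   of its entries: [1] for the lower bound [m y], [2] for the upper bound
   [E * m y], [0] for the at most one entry per column that is neither. *)
Lemma vertex_system (R : realType) (E : R) l K (m : 'cV[R]_l) (C : 'M[R]_(l, K)) :
  ldp_polytope E m C -> ldp_vertex E m C ->
  exists (e : 'I_l -> 'I_K -> nat) (w : 'I_l -> 'I_l -> nat) (d : 'I_l -> nat),
    [/\ (forall y j, e y j <= 2)%N /\ (forall r y, w r y <= 2)%N /\
        (forall r, d r <= 2)%N,
      forall y j, C y j = if e y j == 0%N then 1 - \sum_y' coef E (e y' j) * m y' 0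
        else coef E (e y j) * m y 0,
      forall v : 'cV[R]_l, (forall r, \sum_y coef E (w r y) * v y 0 = 0) -> v = 0 &
      forall r, \sum_y coef E (w r y) * m y 0 = coef E (d r)].
Proof.
move=> [m0 mC C1] vx.
pose e (y : 'I_l) (j : 'I_K) : nat :=
  if C y j == m y 0 then 1%N else if C y j == E * m y 0 then 2%N else 0%N.
have e2 y j : (e y j <= 2)%N by rewrite /e; case: ifP => //; case: ifP.
have eC y j : e y j != 0%N -> C y j = coef E (e y j) * m y 0.
  rewrite /e /coef; case: (C y j =P m y 0) => [->|_] /=; first by rewrite mul1r.
  by case: (C y j =P E * m y 0).
have free y j : e y j = 0%N -> C y j != m y 0 /\ C y j != E * m y 0.
  by rewrite /e; case: (C y j == m y 0); case: (C y j == E * m y 0).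
(* Two free entries of a column could trade mass with [m] fixed, which a vertex forbids. *)
have free1 y1 y2 j : e y1 j = 0%N -> e y2 j = 0%N -> y1 = y2.
  move=> /free[f1 f1'] /free[f2 f2']; apply/eqP/contraT => ny.
  have [||||_ /matrixP/(_ y1 j)] := vx 0 (\matrix_(y, j')
    (((y == y1) && (j' == j))%:R - ((y == y2) && (j' == j))%:R)).
  - move=> j'; under eq_bigr do rewrite mxE.
    rewrite sumrB (bigD1 y1)//= eqxx big1 => [|y /negbTE->//].
    rewrite [X in _ - X](bigD1 y2)//= eqxx big1 => [|y /negbTE->//].
    by rewrite !addr0 subrr.
  - by move=> y _; rewrite mxE.
  - move=> y j' h; rewrite !mxE.
    have [yy|/=] := eqVneq y y1; have [yy'|/=] := eqVneq y y2; rewrite ?subrr//=.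
    + by move: h f1; have [->|/=] := eqVneq j' j; rewrite ?subrr// yy => -> /eqP.
    + by move: h f2; have [->|/=] := eqVneq j' j; rewrite ?subrr// yy' => -> /eqP.
  - move=> y j' h; rewrite !mxE mulr0.
    have [yy|/=] := eqVneq y y1; have [yy'|/=] := eqVneq y y2; rewrite ?subrr//=.
    + by move: h f1'; have [->|/=] := eqVneq j' j; rewrite ?subrr// yy => -> /eqP.
    + by move: h f2'; have [->|/=] := eqVneq j' j; rewrite ?subrr// yy' => -> /eqP.
  by rewrite !mxE !eqxx (negbTE ny)/= => /eqP; rewrite subr0 oner_eq0.
have sum_free (v : 'cV[R]_l) y j : e y j = 0%N ->
    \sum_y' coef E (e y' j) * v y' 0 = \sum_(y' | y' != y) coef E (e y' j) * v y' 0.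
  by move=> h; rewrite (bigD1 y)//= h /coef/= mul0r add0r.
have CE y j : C y j = if e y j == 0%N then 1 - \sum_y' coef E (e y' j) * m y' 0
        else coef E (e y j) * m y 0.
  case: eqP => [h|/eqP]; last exact: eC.
  rewrite (sum_free _ y)// -(C1 j) (bigD1 y)//= -[LHS]addr0 -addrA; congr +%R.
  apply/esym/eqP; rewrite subr_eq0; apply/eqP; apply: eq_bigr => y' ny.
  by apply: eC; apply: contra ny => /eqP h'; rewrite (free1 _ _ _ h h').
(* The equations for [m]: a column without a free entry sums to one, and a vanishing [m y'] is zero.
   A column with a free entry gives none, since that entry absorbs its sum. *)
pose wf (i : 'I_K + 'I_l) (y : 'I_l) : nat :=
  match i with
  | inl j => if [forall y', e y' j != 0%N] then e y j else 0%N
  | inr y' => if m y' 0 == 0 then (y == y' : nat) else 0%N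
  end.
pose df (i : 'I_K + 'I_l) : nat :=
  if i is inl j then ([forall y', e y' j != 0%N] : nat) else 0%N.
(* A kernel vector extends to a direction [D] respecting all tight constraints, the free entry of a
   column compensating the others; at a vertex both vanish. *)
have wker (v : 'cV[R]_l) : (forall i, \sum_y coef E (wf i y) * v y 0 = 0) -> v = 0.
  move=> hv.
  pose D : 'M[R]_(l, K) := \matrix_(y, j) if e y j == 0%N
    then - \sum_y' coef E (e y' j) * v y' 0 else coef E (e y j) * v y 0.
  have [||||//] := vx v D.
  - move=> j; have [/existsP[y /eqP h]|] := boolP [exists y, e y j == 0%N].
      rewrite (bigD1 y)//= mxE h eqxx (sum_free _ y)//.
      rewrite [X in _ + X](eq_bigr (fun y' => coef E (e y' j) * v y' 0)) ?addNr// => y' ny.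
      rewrite mxE ifN//; apply: contra ny => /eqP h'.
      by rewrite (free1 _ _ _ h h').
    rewrite negb_exists => hf; rewrite -[RHS](hv (inl j)) /wf hf.
    by apply: eq_bigr => y _; rewrite mxE ifN//; exact: (forallP hf).
  - move=> y hy; have := hv (inr y); rewrite /wf hy eqxx (bigD1 y)//= eqxx.
    rewrite big1 => [|y' /negbTE->]; last by rewrite /coef/= mul0r.
    by rewrite /coef/= mul1r addr0.
  - by move=> y j h; rewrite mxE /e h eqxx /= /coef/= mul1r.
  - move=> y j h; rewrite mxE /e h eqxx.
    (* The pattern prefers the lower bound. Where the two bounds coincide, either [E = 1], or
       [m y = 0] and its equation gives [v y = 0]. *)
    case: (E * m y 0 =P m y 0) => [h'|_] /=; last by rewrite /coef.
    rewrite /coef /= mul1r.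
    have : (E - 1) * m y 0 = 0 by rewrite mulrBl mul1r h' subrr.
    move=> /eqP; rewrite mulf_eq0 subr_eq0 => /orP[/eqP->|/eqP hm]; first by rewrite mul1r.
    have := hv (inr y); rewrite /wf hm eqxx (bigD1 y)//= eqxx.
    rewrite big1 => [|y' /negbTE->]; last by rewrite /coef/= mul0r.
    by rewrite /coef/= mul1r addr0 => ->; rewrite mulr0.
have wm i : \sum_y coef E (wf i y) * m y 0 = coef E (df i).
  case: i => [j|y'] /=.
    case: (boolP [forall y', e y' j != 0%N]) => hf.
      rewrite coef1 -(C1 j); apply: eq_bigr => y _.
      by rewrite -eC//; exact: (forallP hf).
    by rewrite big1// => y _; rewrite coef0 mul0r.
  rewrite big1// => y _; case: eqP => [h|_]; last by rewrite coef0 mul0r.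
  by have [->|_] := eqVneq y y'; rewrite ?h ?mulr0//= ?coef0 mul0r.
pose M : 'M[R]_(K + l, l) := \matrix_(i, y) coef E (wf (fintype.split i) y).
have Mker (v : 'cV[R]_l) : M *m v = 0 -> v = 0.
  move=> h; apply: wker => i.
  transitivity ((M *m v) (fintype.unsplit i) 0); last by rewrite h mxE.
  by rewrite mxE; apply: eq_bigr => y _; rewrite mxE unsplitK.
(* A trivial kernel means rank [l], so [l] of the [K + l] equations form an invertible square
   system. *)
have Mfull : row_full M.
  rewrite /row_full -mxrank_tr; apply: inj_row_free => u hu.
  by apply: trmx_inj; rewrite trmx0; apply: Mker; apply: trmx_inj; rewrite trmx_mul trmxK trmx0.
pose f := fullrankfun Mfull.
exists e, (fun r y => wf (fintype.split (f r)) y), (fun r => df (fintype.split (f r))); split => //.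
- split=> //; split=> [r y|r].
    rewrite /wf; case: fintype.split => [j|y']; first by case: ifP.
    by case: ifP => // _; case: eqP.
  by rewrite /df; case: fintype.split => // j; case: [forall _, _].
- move=> v hv; have Mu := fullrowsub_unit Mfull.
  rewrite -[v](mulKmx Mu) (_ : _ *m v = 0) ?mulmx0//.
  apply/colP => r; rewrite !mxE -[RHS](hv r); apply: eq_bigr => y _.
  by rewrite !mxE.
Qed.

Definition digit_mx (R : realType) (E : R) l (D : nat -> nat) (o r c : nat) : R :=
  coef E (D ((o + r) * l + c)%N).

(* Rows [0 .. K-1] of the digit table hold the pattern, the next [l] rows the
   linear system, then one row for its right-hand side and one for the pivots. *)
Lemma vertex_digits (R : realType) (E : R) l K (m : 'cV[R]_l) (C : 'M[R]_(l, K)) :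
  ldp_polytope E m C -> ldp_vertex E m C ->
  exists D : nat -> nat,
    let A := digit_mx E l D K in
    let b := digit_mx E l D (K + l) 0 in
    let rho c := D ((K + l).+1 * l + c)%N in
    let G := gauss A b rho l in
    let mu c := G.2 (rho c) / G.1 (rho c) c in
    [/\ forall i, (D i < l + 2)%N,
      forall c, (c < l)%N -> (rho c < l)%N &
      forall (y : 'I_l) (j : 'I_K), C y j =
        if D (j * l + y)%N == 0%N
        then 1 - \sum_(y' < l) coef E (D (j * l + y')%N) * mu y'
        else coef E (D (j * l + y)%N) * mu y].
Proof.
move=> hp hv.
have [e [w [d [[e2 [w2 d2]] eC wk wm]]]] := vertex_system hp hv.
have [l0|l0] := posnP l.
  exists (fun=> 0%N) => /=; split=> [i|c|y]; first by rewrite addn2.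
    by rewrite l0.
  by have := ltn_ord y; rewrite {2}l0.
pose od n (d0 : nat) (F : 'I_n -> nat) i : nat := if insub i is Some x then F x else d0.
have odE n d0 F (i : 'I_n) : od n d0 F i = F i by rewrite /od valK.
pose A0 (r c : nat) : R := coef E (od l 0%N (fun r => od l 0%N (w r) c) r).
pose b0 (r : nat) : R := coef E (od l 0%N d r).
have [||rho [rl rhoE]] := @gauss_pivots R l A0 b0 (fun y => mem_of m y).
- move=> v h.
  have v0 : (\col_(y < l) v y : 'cV[R]_l) = 0.
    apply: wk => r; rewrite -[RHS](h r (ltn_ord r)); apply: eq_bigr => y _.
    by rewrite mxE /A0 !odE.
  by move=> j jl; have /colP/(_ (Ordinal jl)) := v0; rewrite !mxE.
- move=> i il; rewrite /b0 (odE l 0%N d (Ordinal il)) -wm; apply: eq_bigr => y _.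
  by rewrite mem_ofE /A0 (odE l 0%N _ (Ordinal il)) odE.
(* The [minn] leaves [rho c] unchanged for [c < l] and makes the bound on the digits immediate. *)
pose D i : nat := let r := (i %/ l)%N in let c := (i %% l)%N in
  if (r < K)%N then od K 0%N (fun j => od l 0%N (fun y => e y j) c) r else
  if (r < K + l)%N then od l 0%N (fun r => od l 0%N (w r) c) (r - K)%N else
  if (r == K + l)%N then od l 0%N d c else
  if (r == (K + l).+1)%N then minn (rho c) l.-1 else 0%N.
have DE r c : (c < l)%N -> ((r * l + c) %/ l = r /\ (r * l + c) %% l = c)%N.
  by move=> cl; rewrite divnMDl// divn_small// addn0 modnMDl modn_small.
have De j y : (j < K)%N -> (y < l)%N ->
    D (j * l + y)%N = od K 0%N (fun j => od l 0%N (fun y => e y j) y) j.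
  by move=> jK yl; rewrite /D /= (DE _ _ yl).1 (DE _ _ yl).2 jK.
have DA r c : (r < l)%N -> (c < l)%N -> digit_mx E l D K r c = A0 r c.
  move=> rl' cl; rewrite /digit_mx /D /= (DE _ _ cl).1 (DE _ _ cl).2.
  by rewrite ltnNge leq_addr/= ltn_add2l rl' addKn.
have Db c : (c < l)%N -> digit_mx E l D (K + l) 0 c = b0 c.
  move=> cl; rewrite /digit_mx addn0 /D /= (DE _ _ cl).1 (DE _ _ cl).2.
  by rewrite ltnNge leq_addr/= ltnn eqxx.
have Dr c : (c < l)%N -> D ((K + l).+1 * l + c)%N = rho c.
  move=> cl; rewrite /D /= (DE _ _ cl).1 (DE _ _ cl).2.
  rewrite ltnNge (leq_trans (leq_addr l K) (leqnSn _))/= ltnNge leqnSn/= gtn_eqF// eqxx.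
  by apply/minn_idPl; rewrite -ltnS prednK// rl.
exists D => /=; set G := gauss _ _ _ _.
have GE i j : (i < l)%N -> (j < l)%N -> G.1 i j = (gauss A0 b0 rho l).1 i j /\
    G.2 i = (gauss A0 b0 rho l).2 i.
  rewrite /G (@gauss_ext _ _ _ _ rho l) => [|c /Dr//].
  suff h n : (n <= l)%N -> forall i j, (i < l)%N -> (j < l)%N ->
      (gauss (digit_mx E l D K) (digit_mx E l D (K + l) 0) rho n).1 i j =
        (gauss A0 b0 rho n).1 i j /\
      (gauss (digit_mx E l D K) (digit_mx E l D (K + l) 0) rho n).2 i =
        (gauss A0 b0 rho n).2 i by exact: h.
  elim: n => [_ i' j' hi hj|n ih nl i' j' hi hj] /=; first by rewrite DA ?Db.
  have rn := rl n nl; move: (ih (ltnW nl)).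
  case: gauss => A1 b1; case: gauss => A2 b2 /= {}ih.
  rewrite /pivot_mx /pivot_rhs.
  have [-> ->] := ih i' j' hi hj; have [-> _] := ih i' n hi nl.
  by have [-> ->] := ih (rho n) n rn nl; have [-> _] := ih (rho n) j' rn hj.
split.
- move=> i; rewrite addn2 /D /od.
  case: ifP => _.
    case: insubP => // j _ _; case: insubP => // y _ _.
    by rewrite (leq_ltn_trans (e2 y j)).
  case: ifP => _.
    case: insubP => // j _ _; case: insubP => // y _ _.
    by rewrite (leq_ltn_trans (w2 j y)).
  case: ifP => _; first by case: insubP => // y _ _; rewrite (leq_ltn_trans (d2 y)).
  case: ifP => _ //; rewrite (leq_ltn_trans (geq_minr _ _))//.
  by lia.
- by move=> c cl; rewrite Dr// rl.
- move=> y j.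
  have muE (y' : 'I_l) : m y' 0 = G.2 (D ((K + l).+1 * l + y')%N) /
      G.1 (D ((K + l).+1 * l + y')%N) y'.
    rewrite Dr// -mem_ofE rhoE//.
    by have [-> ->] := GE (rho y') y' (rl _ (ltn_ord y')) (ltn_ord y').
  have DeE (y' : 'I_l) : D (j * l + y')%N = e y' j by rewrite De// !odE.
  rewrite eC DeE -muE; case: ifP => // _; congr (1 - _).
  by apply: eq_bigr => y' _; rewrite DeE muE.
Qed.

(** * The search program *)

Definition cell (a : nat) : nexp := NGet a (NLit 0).
Definition rcell (a : nat) : rexp := RGet a (NLit 0).
Definition kE : nexp := NGet 0 (NLit 0).
Definition lE : nexp := NGet 0 (NLit 1).
(* Memory layout.  Integer arrays: 2 and 4 hold the multiples of [k] and [l],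
   cell 0 of 3 holds [l * l], cell 0 of 5 the number of guesses, cell 0 of 7
   what remains to be decoded of the current guess, 9 its digits, 10 the
   thresholds, 11 the levels of the inputs; cell 0 of 12 tells whether the
   candidate is valid, cell 0 of 13 whether one has been found; 20 to 27 are
   loop counters.  Real arrays: 6 holds the candidate, 7 its distinct columns,
   8 the coefficients [0, 1, e^eps], 9 and 10 the linear system, 12 its
   solution, 14 and 15 the arguments of the oracle, 5 its answer. *)
Definition at_k (i j : nexp) : nexp := NAdd (NGet 2 i) j.
Definition at_l (i j : nexp) : nexp := NAdd (NGet 4 i) j.
Definition KE : nexp := NAdd (cell 3) (NLit 1).

(** Row-major addresses are products, which the machine lacks for integers; multiples are tabulated
    by repeated addition. *)
Definition set_tables : prog :=
  PSeq (PFor 20 lE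
    (PNSet 2 (NAdd (cell 20) (NLit 1)) (NAdd (NGet 2 (cell 20)) kE)))
  (PFor 20 lE (PNSet 3 (NLit 0) (NAdd (cell 3) lE))).

(** The table reaches beyond the last row of the digits, to [l * l + l + 4], so that their number
    [(l * l + l + 3) * l] can be read from it too. *)
Definition set_table_l : prog :=
  PFor 20 (NAdd (cell 3) (NAdd lE (NLit 4)))
    (PNSet 4 (NAdd (cell 20) (NLit 1)) (NAdd (NGet 4 (cell 20)) lE)).

Definition mul_power (r n : nexp) : prog :=
  PFor 20 n (PSeq (PNSet 6 (NLit 0) (NLit 0))
    (PSeq (PFor 21 r (PNSet 6 (NLit 0) (NAdd (cell 6) (cell 5))))
      (PNSet 5 (NLit 0) (cell 6)))).

(** The number of guesses bounds the dividend and hence the number of subtractions; the remaining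
    iterations do nothing. *)
Definition divide (r : nexp) : prog :=
  PFor 24 (cell 5)
    (PIf (BLeN r (cell 7))
       (PSeq (PNSet 7 (NLit 0) (NSub (cell 7) r))
          (PNSet 8 (NLit 0) (NAdd (cell 8) (NLit 1))))
       PSkip).

Definition decode_digits (a : nat) (r n : nexp) : prog :=
  PFor 23 n
    (PSeq (PNSet 8 (NLit 0) (NLit 0))
    (PSeq (divide r)
    (PSeq (PNSet a (cell 23) (cell 7)) (PNSet 7 (NLit 0) (cell 8))))).

Section Specs.
Variables (R : realType) (l : nat) (g : 'cV[R]_l * 'cV[R]_l -> R).
Implicit Types (s : state R).

Lemma divide_spec (r : nexp) s :
  unwritten [:: 7; 8; 24]%N r -> (0 < neval s r)%N ->
  nmem s 8 0 = 0%N -> (nmem s 7 0 <= nmem s 5 0)%N ->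
  nmem (den g (divide r) s) 8 0 = (nmem s 7 0 %/ neval s r)%N /\
  nmem (den g (divide r) s) 7 0 = (nmem s 7 0 %% neval s r)%N.
Proof.
move=> hr r0 q0 hN; set rv := neval s r in r0 *; set N := nmem s 7 0 in hN *.
rewrite /divide; forloop (fun i s' =>
  (nmem s' 8 0 * rv + nmem s' 7 0)%N = N /\
  ((i <= nmem s' 8 0) \/ (nmem s' 7 0 < rv))%N).
- by rewrite q0; split=> //; left.
- move=> i s1 hi ag [h1 h2]; rewrite !denE /= !stateE.
  have er : neval s1 r = rv by apply: (neval_agree ag); unw hr.
  rewrite neval_setn; last by unw hr.
  rewrite er /=; case: (leqP rv (nmem s1 7 0)) => hq; last first.
    by rewrite !stateE /=; split=> //; right.
  rewrite !stateE /=; split; last by case: h2; lia.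
  by rewrite mulnDl mul1n; lia.
move=> s1 [-> ag [h1 h2]]; rewrite !stateE /=.
(* If every iteration subtracted, the quotient is at least the bound on the dividend, and the
   remainder is zero. *)
have h3 : (nmem s1 7 0 < rv)%N.
  case: h2 => // h2; have : (nmem s 5 0 * rv <= nmem s1 8 0 * rv)%N by rewrite leq_mul2r h2 orbT.
  have : (nmem s 5 0 <= nmem s 5 0 * rv)%N by rewrite leq_pmulr.
  by move: (_ * rv)%N (_ * rv)%N h1 => x y; lia.
by rewrite -h1 divnMDl// modnMDl modn_small// divn_small// addn0.
Qed.

Lemma decode_spec (a : nat) (r n : nexp) s :
  (a = 9 \/ a = 10)%N -> unwritten [:: 7; 8; 9; 10; 23; 24]%N r ->
  (0 < neval s r)%N -> (nmem s 7 0 <= nmem s 5 0)%N ->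
  let s' := den g (decode_digits a r n) s in
  (forall i, (i < neval s n)%N ->
     nmem s' a i = (nmem s 7 0 %/ neval s r ^ i) %% neval s r)%N /\
  nmem s' 7 0 = (nmem s 7 0 %/ neval s r ^ neval s n)%N.
Proof.
move=> ha hr r0 hN; rewrite /decode_digits.
set rv := neval s r in r0 *; set N := nmem s 7 0 in hN *.
forloop (fun i s' =>
  (forall j, (j < i)%N -> nmem s' a j = (N %/ rv ^ j) %% rv)%N /\
  nmem s' 7 0 = (N %/ rv ^ i)%N).
- by split=> //; rewrite expn0 divn1.
- move=> i s1 hi ag [h1 h2].
  rewrite !denE /=; set s2 := setn _ 8 0 0.
  have hr' : unwritten [:: 7; 8; 24]%N r.
    by unw hr.
  have er : neval s2 r = rv.
    rewrite /s2 !neval_setn; try by unw hr.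
    by apply: (neval_agree ag); case: ha => ->; unw hr.
  have n5 : nmem s1 5 = nmem s 5 by case: ha ag => -> ag; exact: (ag.1 5 isT).
  have [|||d1 d2] := @divide_spec r s2 hr'; rewrite ?er//.
  + by rewrite /s2 !stateE.
  + by rewrite /s2 !stateE /= h2 n5 (leq_trans _ hN)// leq_div.
  have d3 := (agree_den g (divide r) s2).1.
  have [[a7 a8] [a23 a8']] : ((a == 7) = false /\ (a == 8) = false) /\
      (a == 23) = false /\ (8 == a) = false by case: ha => ->.
  have er2 : nmem s2 7 0 = (N %/ rv ^ i)%N by rewrite /s2 !stateE.
  have e23 : nmem s2 23 0 = i by rewrite /s2 !stateE.
  split=> [j|]; last by rewrite !stateE a8' /= d1 er er2 expnSr divnMA.
  rewrite !stateE a7 eqxx /= d3// d2 e23 er er2 ltnS leq_eqVlt.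
  case: eqP => //= [->//|_] ji.
  by rewrite d3 ?/s2 ?stateE ?a8 ?a23; [exact: h1|case: ha => ->].
move=> s1 [-> ag [h1 h2]]; rewrite !stateE /= h2; split=> // i hi.
by rewrite !stateE (_ : (a == 23) = false); [exact: h1|case: ha => ->].
Qed.
End Specs.

Lemma index2_inj (k y x y' x' : nat) : (x < k)%N -> (x' < k)%N ->
  (y * k + x = y' * k + x')%N -> y = y' /\ x = x'.
Proof.
move=> xk xk' e; have k0 : (0 < k)%N by exact: leq_ltn_trans xk.
have := congr1 (divn^~ k) e; rewrite !divnMDl// !divn_small// !addn0 => ey.
by split=> //; move: e; rewrite ey => /addnI.
Qed.

(** * Loop patterns: filling arrays, sums and conjunctions *)

Section Loops.
Variables (R : realType) (l : nat) (g : 'cV[R]_l * 'cV[R]_l -> R).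
Implicit Types (s : state R).

Lemma fill_spec v e a f s (val : nat -> R) :
  (forall i s', (i < neval s e)%N -> agree [:: v] [:: a] s s' ->
     nmem s' v 0 = i -> reval s' f = val i) ->
  forall i, (i < neval s e)%N ->
    rmem (den g (PFor v e (PRSet a (cell v) f)) s) a i = val i.
Proof.
move=> hf; forloop (fun n s' => forall i, (i < n)%N -> rmem s' a i = val i).
- by [].
- move=> n s1 hn ag h i; rewrite denE rmem_setr /= nmem_setn !eqxx /= ltnS leq_eqVlt.
  case: eqP => [-> _|_ /=]; last by rewrite rmem_setn; exact: h.
  apply: hf => //; last by rewrite nmem_setn !eqxx.
  by apply: agree_trans ag _; apply: agree_sub (agree_setn _ _ _ _).
- by move=> s1 [-> ag h] i hi; rewrite rmem_setn h.
Qed.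

Lemma fill2_spec v w e e' a ix f s (idx : nat -> nat -> nat) (val : nat -> nat -> R) :
  v != w ->
  unwritten [:: v; w]%N e' ->
  (forall y x s', (y < neval s e)%N -> (x < neval s e')%N ->
     agree [:: v; w] [:: a] s s' -> nmem s' v 0 = y -> nmem s' w 0 = x ->
     neval s' ix = idx y x /\ reval s' f = val y x) ->
  (forall y x y' x', (x < neval s e')%N -> (x' < neval s e')%N ->
     idx y x = idx y' x' -> y = y' /\ x = x') ->
  forall y x, (y < neval s e)%N -> (x < neval s e')%N ->
    rmem (den g (PFor v e (PFor w e' (PRSet a ix f))) s) a (idx y x) = val y x.
Proof.
move=> vw he' hf inj.
forloop (fun n s' => forall y x, (y < n)%N -> (x < neval s e')%N ->
  rmem s' a (idx y x) = val y x).
- by [].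
- move=> n s1 hn ag h.
  have ag1 : agree [:: v; w] [:: a] s (setn s1 v 0 n).
    apply: agree_trans ag _; apply: agree_sub (agree_setn _ _ _ _) => // z.
    by rewrite !inE => ->.
  have eN : neval (setn s1 v 0 n) e' = neval s e' by exact: neval_agree ag1 he'.
  forloop (fun m s' => (forall y x, (y < n)%N -> (x < neval s e')%N ->
    rmem s' a (idx y x) = val y x) /\
    forall x, (x < m)%N -> rmem s' a (idx n x) = val n x).
  + by split=> // y x yn xm; rewrite rmem_setn h.
  + rewrite eN => m s2 hm ag2 [h1 h2]; rewrite denE.
    set s3 := setn s2 w 0 m.
    have ag3 : agree [:: v; w] [:: a] s s3.
      apply: agree_trans ag1 _; apply: (@agree_trans _ _ _ s2).
        by apply: agree_sub ag2; subset_dec.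
      by apply: agree_sub (agree_setn _ _ _ _); subset_dec.
    have [] := hf n m s3 hn hm ag3.
    * rewrite /s3 nmem_setn (negbTE vw) (ag2.1 v) ?nmem_setn ?eqxx//.
      by rewrite inE.
    * by rewrite /s3 nmem_setn !eqxx.
    move=> -> ->; split=> [y x yn xm|x]; rewrite rmem_setr eqxx /=.
      case: eqP => [/inj[]//e1|_]; first by rewrite e1 ltnn in yn.
      by rewrite /s3 rmem_setn h1.
    rewrite ltnS leq_eqVlt; case: eqP => [->|nx /=]; first by rewrite eqxx.
    move=> xm; rewrite ifF; first by rewrite /s3 rmem_setn h2.
    by apply/eqP => /inj[]//; exact: ltn_trans hm.
  + rewrite eN => s2 [-> _ [h1 h2]] y x; rewrite rmem_setn ltnS leq_eqVlt.
    by case: eqP => [->|_ /=] yn xm; [exact: h2|exact: h1].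
- by move=> s1 [-> _ h] y x yn xm; rewrite rmem_setn h.
Qed.

Lemma sum_spec v e a f s (val : nat -> R) :
  (forall i s', (i < neval s e)%N -> agree [:: v] [:: a] s s' ->
     nmem s' v 0 = i -> reval s' f = val i) ->
  rmem (den g (PFor v e (PRSet a (NLit 0) (RAdd (rcell a) f))) s) a 0 =
    rmem s a 0 + \sum_(i < neval s e) val i.
Proof.
move=> hf; forloop (fun n s' => rmem s' a 0 = rmem s a 0 + \sum_(i < n) val i).
- by rewrite big_ord0 addr0.
- move=> n s1 hn ag h; rewrite denE rmem_setr eqxx /= rmem_setn h big_ord_recr/= addrA.
  congr +%R; apply: hf => //; last by rewrite nmem_setn !eqxx.
  by apply: agree_trans ag _; apply: agree_sub (agree_setn _ _ _ _).
- by move=> s1 [-> ag h]; rewrite rmem_setn h.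
Qed.

(** A body that either keeps the flag or clears it computes a conjunction; nested loops reuse the
    lemma with an inner conjunction as [c]. *)
Lemma flag_spec v e P s (c : nat -> bool) : v != 12%N ->
  (forall i s', (i < neval s e)%N ->
     agree (nwrites (PFor v e P)) (rwrites (PFor v e P)) s s' ->
     nmem s' v 0 = i ->
     nmem (den g P s') 12 0 = if c i then nmem s' 12 0 else 0%N) ->
  nmem (den g (PFor v e P) s) 12 0 =
    if [forall i : 'I_(neval s e), c i] then nmem s 12 0 else 0%N.
Proof.
move=> v12 hP; have {}v12 : (12%N == v) = false by rewrite eq_sym (negbTE v12).
forloop (fun n s' => (forall m, (m = n)%N ->
  nmem s' 12 0 = if [forall i : 'I_m, c i] then nmem s 12 0 else 0%N)).
- by move=> m ->; rewrite ifT//; apply/forallP => -[].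
- move=> n s1 hn ag h m ->; rewrite (hP n _ hn).
  + rewrite nmem_setn v12 /= (h n erefl).
    case: ifP => cn.
      rewrite (_ : [forall i : 'I_n.+1, c i] = [forall i : 'I_n, c i])//.
      apply/forallP/forallP => hc i; first exact: (hc (widen_ord (leqnSn n) i)).
      case: i => i /=; rewrite ltnS leq_eqVlt => /orP[/eqP->//|il].
      exact: (hc (Ordinal il)).
    rewrite ifF//; apply/negP => /forallP/(_ ord_max)/=.
    by rewrite cn.
  + apply: agree_trans ag _; apply: agree_sub (agree_setn _ _ _ _) => // z.
    by rewrite !inE => ->.
  + by rewrite nmem_setn !eqxx.
- by move=> s1 [-> ag h]; rewrite nmem_setn v12 /= (h _ erefl).
Qed.

End Loops.

(** * Building, testing and comparing one candidate *)

Definition levels (n : nexp) : prog :=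
  PFor 25 kE (PSeq (PNSet 11 (cell 25) (NLit 0))
    (PFor 26 n
      (PIf (BAnd (BLeN (NAdd (NGet 10 (cell 26)) (NLit 1)) kE)
             (BLeR (RMul (RGet 1 (NGet 10 (cell 26))) (RGet 0 (cell 25)))
                (RMul (RGet 0 (NGet 10 (cell 26))) (RGet 1 (cell 25)))))
         (PNSet 11 (cell 25) (NAdd (NGet 11 (cell 25)) (NLit 1))) PSkip))).

(** Array 7 stores one column per level; an input receives the column of its level. *)
Definition expand_levels : prog :=
  PFor 25 lE (PFor 26 kE (PRSet 6 (at_k (cell 25) (cell 26))
    (RGet 7 (at_l (NGet 11 (cell 26)) (cell 25))))).

Definition tE (i j : nat) : rexp := RGet 6 (at_k (cell i) (cell j)).
Definition require (b : bexp) : prog := PIf b PSkip (PNSet 12 (NLit 0) (NLit 0)).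

Definition check_channel : prog :=
  PSeq (PNSet 12 (NLit 0) (NLit 1))
  (PSeq (PFor 25 lE (PFor 26 kE (require (BLeR (RLit 0) (tE 25 26)))))
  (PFor 26 kE (PSeq (PRSet 13 (NLit 0) (RLit 0))
    (PSeq (PFor 25 lE (PRSet 13 (NLit 0) (RAdd (rcell 13) (tE 25 26))))
      (require (BAnd (BLeR (rcell 13) (RLit 1)) (BLeR (RLit 1) (rcell 13)))))))).

Definition check_ldp : prog :=
  PFor 25 lE (PFor 26 kE (PFor 27 kE
    (require (BLeR (tE 25 26) (RMul (rcell 2) (tE 25 27)))))).

Definition apply_to (src dst : nat) : prog :=
  PFor 25 lE (PSeq (PRSet 13 (NLit 0) (RLit 0))
    (PSeq (PFor 26 kE (PRSet 13 (NLit 0)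
        (RAdd (rcell 13) (RMul (tE 25 26) (RGet src (cell 26))))))
      (PRSet dst (cell 25) (rcell 13)))).

Definition copy_out : prog :=
  PFor 25 lE (PFor 26 kE (PRSet 3 (at_k (cell 25) (cell 26)) (tE 25 26))).

Definition keep_best : prog :=
  PIf (BAnd (BLeN (NLit 1) (cell 13)) (BLeR (rcell 5) (rcell 4))) PSkip
    (PSeq (PRSet 4 (NLit 0) (rcell 5)) (PSeq (PNSet 13 (NLit 0) (NLit 1)) copy_out)).

(** A call outside [A] would have no outcome, so the oracle is consulted only once the flag
    certifies the candidate. *)
Definition try_candidate : prog :=
  PIf (BLeN (NLit 1) (cell 12))
    (PSeq (apply_to 0 14) (PSeq (apply_to 1 15)
      (PSeq (PQuery 5 (NLit 0) 14 15) keep_best))) PSkip.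

Definition search (gen test : prog) : prog :=
  PFor 22 (cell 5) (PSeq (PNSet 7 (NLit 0) (cell 22))
    (PSeq gen (PSeq test try_candidate))).

Section Pieces.
Variables (R : realType) (l k : nat) (g : 'cV[R]_l * 'cV[R]_l -> R).
Variables (p q : 'cV[R]_k).
Implicit Types (s : state R).

Definition tables s : Prop :=
  [/\ nmem s 0 0 = k, nmem s 0 1 = l, forall y, (y <= l)%N -> nmem s 2 y = (y * k)%N,
    nmem s 3 0 = (l * l)%N &
    forall j, (j <= l * l + l + 4)%N -> nmem s 4 j = (j * l)%N] /\
  rmem s 0 = mem_of p /\ rmem s 1 = mem_of q.

Lemma tables_agree W V s s' : agree W V s s' ->
  all (fun a => a \notin W) [:: 0; 2; 3; 4]%N && all (fun a => a \notin V) [:: 0; 1]%N ->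
  tables s -> tables s'.
Proof.
move=> [hn hr] /= /andP[/and5P[n0 n2 n3 n4 _] /and3P[r0 r1 _]].
by rewrite /tables !hn// !hr.
Qed.

Definition mx_at s (a : nat) : 'M[R]_(l, k) := \matrix_(y, x) rmem s a (y * k + x)%N.

Lemma levels_spec (n : nexp) s : tables s -> unwritten [:: 11; 25; 26]%N n ->
  forall x, (x < k)%N -> nmem (den g (levels n) s) 11 x =
    level (mem_of p) (mem_of q) k (neval s n) (nmem s 10) x.
Proof.
move=> [[k0 _ _ _ _] [hp hq]] hn; rewrite /levels.
forloop (fun i s' => forall x, (x < i)%N -> nmem s' 11 x =
  level (mem_of p) (mem_of q) k (neval s n) (nmem s 10) x).
- by [].
- move=> i s1; rewrite /= k0 => ik ag h; rewrite !denE.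
  set s2 := setn _ 11 _ _.
  have e25 : neval (setn s1 25 0 i) (cell 25) = i by rewrite /= nmem_setn !eqxx.
  have ag2 : agree [:: 25; 11; 26; 11]%N [::] s s2.
    apply: agree_trans ag _; apply: (@agree_trans _ _ _ (setn s1 25 0 i)).
      by apply: agree_sub (agree_setn _ _ _ _); subset_dec.
    by apply: agree_sub (agree_setn _ _ _ _); subset_dec.
  have en : neval s2 n = neval s n by apply: (neval_agree ag2); unw hn.
  forloop (fun j s' => (forall x, (x < i)%N -> nmem s' 11 x =
      level (mem_of p) (mem_of q) k (neval s n) (nmem s 10) x) /\
    nmem s' 11 i = (\sum_(j' < j) reaches (mem_of p) (mem_of q) k (nmem s 10 j') i)%N).
  + rewrite big_ord0 /s2; split=> [x xi|]; rewrite nmem_setn e25 eqxx //= ?eqxx//.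
    by rewrite (ltn_eqF xi) nmem_setn /= h.
  + move=> j s3 _ ag3 [h1 h2].
    have n25 : nmem s3 25 0 = i by rewrite (ag3.1 25 isT) /s2 !stateE /=.
    have n10 : nmem s3 10 = nmem s 10 by rewrite (ag3.1 10 isT) (ag2.1 10 isT).
    have n0 : nmem s3 0 0 = k by rewrite (ag3.1 0 isT) (ag2.1 0 isT).
    have r0 : rmem s3 0 = mem_of p by rewrite (ag3.2 0 isT) (ag2.2 0 isT).
    have r1 : rmem s3 1 = mem_of q by rewrite (ag3.2 1 isT) (ag2.2 1 isT).
    rewrite !denE /= !stateE /= n25 n0 n10 addn1.
    rewrite r0 r1 big_ord_recr /= -h2 -/(reaches _ _ _ _ _) addn1.
    case: reaches; rewrite ?addn0.
      rewrite !stateE /= eqxx addn1; split=> // x xi; rewrite !stateE /= (ltn_eqF xi).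
      by rewrite h1.
    by rewrite !stateE /=; split=> // x xi; rewrite !stateE /= h1.
  + rewrite en => s3 [-> _ [h1 h2]] x; rewrite nmem_setn /= ltnS leq_eqVlt.
    by case: eqP => [-> _|_ /=]; [rewrite h2|exact: h1].
- by rewrite /= k0 => s1 [-> _ h] x xk; rewrite nmem_setn /= h.
Qed.

Lemma expand_spec s : tables s -> (forall x, (x < k)%N -> (nmem s 11 x <= l * l)%N) ->
  forall y x, (y < l)%N -> (x < k)%N ->
  rmem (den g expand_levels s) 6 (y * k + x)%N = rmem s 7 (nmem s 11 x * l + y)%N.
Proof.
move=> [[n00 n01 n2 n3 n4] _] hl.
have := @fill2_spec R l g 25%N 26%N lE kE 6 (at_k (cell 25) (cell 26))
  (RGet 7 (at_l (NGet 11 (cell 26)) (cell 25))) s (fun y x => y * k + x)%N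
  (fun y x => rmem s 7 (nmem s 11 x * l + y)%N).
rewrite /= n00 n01; apply => //.
- move=> y x s' yl xk ag -> ->.
  rewrite (ag.1 2 isT) (ag.1 4 isT) (ag.1 11 isT) (ag.2 7 isT) n2 ?(ltnW yl)//.
  by rewrite n4// (leq_trans (hl _ xk))// -addnA leq_addr.
- by move=> y x y' x'; exact: index2_inj.
Qed.

Lemma tE_val W V s s' i j y x : tables s -> agree W V s s' ->
  (2 \notin W)%N -> (6 \notin V)%N -> nmem s' i 0 = y -> nmem s' j 0 = x ->
  (y <= l)%N -> reval s' (tE i j) = rmem s 6 (y * k + x)%N.
Proof.
move=> [[_ _ n2 _ _] _] ag w v /= -> -> yl.
by rewrite (ag.1 2 w) (ag.2 6 v) n2.
Qed.

Lemma copy_out_spec s : tables s -> mx_at (den g copy_out s) 3 = mx_at s 6.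
Proof.
move=> tb; have [[n00 n01 _ _ _] _] := tb.
apply/matrixP => y x; rewrite !mxE.
have := @fill2_spec R l g 25%N 26%N lE kE 3 (at_k (cell 25) (cell 26))
  (tE 25 26) s (fun y x => y * k + x)%N (fun y x => rmem s 6 (y * k + x)%N).
rewrite /= n00 n01; apply => // {y x}.
- move=> y x s' yl xk ag ey ex; have := tE_val tb ag isT isT ey ex (ltnW yl) => /= <-.
  rewrite ey ex; split=> //; have [[_ _ n2 _ _] _] := tb.
  by rewrite (ag.1 2 isT) n2// ltnW.
- by move=> y x y' x'; exact: index2_inj.
Qed.

Lemma apply_to_spec (src dst : nat) (r : 'cV[R]_k) s : tables s ->
  (src == 0)%N || (src == 1)%N -> (dst == 14)%N || (dst == 15)%N ->
  rmem s src = mem_of r ->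
  read_col l (den g (apply_to src dst) s) dst = mx_at s 6 *m r.
Proof.
move=> tb hsrc hdst hr; have [[n00 n01 _ _ _] _] := tb.
suff h y : (y < l)%N -> rmem (den g (apply_to src dst) s) dst y =
    \sum_(x < k) rmem s 6 (y * k + x)%N * mem_of r x.
  apply/colP => y; rewrite !mxE h//; apply: eq_bigr => x _.
  by rewrite mxE mem_ofE.
have d13 : (13%N == dst) = false by case/orP: hdst => /eqP->.
move: y; rewrite /apply_to; forloop (fun i s' => forall y, (y < i)%N ->
  rmem s' dst y = \sum_(x < k) rmem s 6 (y * k + x)%N * mem_of r x).
- by [].
- rewrite /= n01 => i s1 il ag h y; rewrite !denE.
  set s2 := setr _ 13 _ _.
  have ag2 : agree [:: 25; 26]%N [:: 13; 13; dst] s s2.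
    apply: agree_trans ag _; apply: (@agree_trans _ _ _ (setn s1 25 0 i)).
      by apply: agree_sub (agree_setn _ _ _ _); subset_dec.
    by apply: agree_sub (agree_setr _ _ _ _); subset_dec.
  have n0 : neval s2 kE = k by rewrite /= (ag2.1 0 isT).
  have := @sum_spec R l g 26%N kE 13 (RMul (tE 25 26) (RGet src (cell 26))) s2
    (fun x => rmem s 6 (i * k + x)%N * mem_of r x).
  rewrite n0; set s3 := den g _ s2 => h3.
  have {}h3 : rmem s3 13 0 = \sum_(x < k) rmem s 6 (i * k + x)%N * mem_of r x.
    rewrite h3 /s2 ?rmem_setr ?eqxx /= ?add0r// => x s4 xk ag4 ex.
    have ag5 : agree [:: 25; 26]%N [:: 13; 13; dst] s s4.
      apply: agree_trans ag2 _; apply: agree_sub ag4 => z; rewrite !inE => ->//.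
      by rewrite orbT.
    have e25 : nmem s4 25 0 = i by rewrite (ag4.1 25 isT) /s2 !stateE.
    have v6 : (6 \notin [:: 13; 13; dst])%N by case/orP: hdst => /eqP->.
    have := tE_val tb ag5 isT v6 e25 ex (ltnW il) => /= ->.
    congr (_ * _); rewrite ex (ag5.2 src) ?hr//.
    by case/orP: hdst => /eqP->; case/orP: hsrc => /eqP->.
  have ag3 := agree_den g (PFor 26 kE (PRSet 13 (NLit 0)
     (RAdd (rcell 13) (RMul (tE 25 26) (RGet src (cell 26)))))) s2.
  rewrite rmem_setr eqxx /= (ag3.1 25 isT) {1}/s2 !stateE /= h3 ltnS leq_eqVlt.
  case: eqP => [->//|_ /= yi].
  rewrite (ag3.2 dst) /s2; last by case/orP: hdst => /eqP->.
  by rewrite rmem_setr eq_sym d13 /= rmem_setn h.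
- by rewrite /= n01 => s1 [-> _ h] y yl; rewrite rmem_setn h.
Qed.

End Pieces.

Lemma den_require (R : realType) l (g : 'cV[R]_l * 'cV[R]_l -> R) b (s : state R) :
  nmem (den g (require b) s) 12 0 = if beval s b then nmem s 12 0 else 0%N.
Proof. by rewrite /require !denE; case: ifP => // _; rewrite nmem_setn. Qed.

Section Checks.
Variables (R : realType) (l k : nat) (g : 'cV[R]_l * 'cV[R]_l -> R).
Variables (p q : 'cV[R]_k).
Implicit Types (s : state R).
Local Notation tables := (@tables R l k p q).
Local Notation mx_at := (@mx_at R l k).

Lemma check_channel_spec s : tables s ->
  nmem (den g check_channel s) 12 0 = if `[< channels (mx_at s 6) >] then 1%N else 0%N.
Proof.
move=> tb; have [[n00 n01 _ _ _] _] := tb.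
rewrite /check_channel !den_seq.
set s1 := den g (PNSet _ _ _) s; set s2 := den g _ s1.
have ag1 : agree [:: 12]%N [::] s s1 by apply: agree_sub (agree_den g _ _); subset_dec.
have ag2 : agree [:: 12; 25; 26; 12]%N [::] s s2.
  apply: (@agree_trans _ _ _ s1); first by apply: agree_sub ag1; subset_dec.
  apply: agree_sub (agree_den g _ s1); subset_dec.
have f1 : nmem s1 12 0 = 1%N by rewrite /s1 den_nset nmem_setn.
have f2 : nmem s2 12 0 = if [forall y : 'I_l, forall x : 'I_k,
    0 <= rmem s 6 (y * k + x)%N] then 1%N else 0%N.
  pose c (y : nat) := [forall x : 'I_k, 0 <= rmem s 6 (y * k + x)%N].
  rewrite /s2 (@flag_spec _ _ g 25%N lE _ s1 c) // ?f1 => [|y s3 yl ag3 ey].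
    by rewrite /= (ag1.1 0 isT) n01.
  rewrite /= (ag1.1 0 isT) n01 in yl.
  rewrite (@flag_spec _ _ g 26%N kE _ s3 (fun x => 0 <= rmem s 6 (y * k + x)%N))//.
    by rewrite /= (ag3.1 0 isT) (ag1.1 0 isT) n00.
  move=> x s4 xk ag4 ex; rewrite den_require.
  have ag5 : agree [:: 12; 25; 26; 12]%N [::] s s4.
    apply: (@agree_trans _ _ _ s1); first by apply: agree_sub ag1; subset_dec.
    apply: (@agree_trans _ _ _ s3); first by apply: agree_sub ag3; subset_dec.
    by apply: agree_sub ag4; subset_dec.
  have e25 : nmem s4 25 0 = y by rewrite (ag4.1 25 isT).
  by have := tE_val tb ag5 isT isT e25 ex (ltnW yl) => /= ->.
pose c (x : nat) := \sum_(y < l) rmem s 6 (y * k + x)%N == 1.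
rewrite (@flag_spec _ _ g 26%N kE _ s2 c) // ?f2 => [|x s3 xk ag3 ex].
  rewrite /= (ag2.1 0 isT) n00.
  case: asboolP => [[h0 h1]|hn].
    rewrite ifT; last first.
      apply/forallP => x; apply/eqP; rewrite -[RHS](h1 x).
      by apply: eq_bigr => y _; rewrite mxE.
    rewrite ifT//; apply/forallP => y; apply/forallP => x.
    by have := h0 y x; rewrite mxE.
  case: ifP => // /forallP h1; case: ifP => // /forallP h0.
  exfalso; apply: hn; split=> [y x|x]; first by rewrite mxE; have /forallP := h0 y.
  by under eq_bigr do rewrite mxE; exact/eqP/h1.
rewrite /= (ag2.1 0 isT) n00 in xk.
rewrite !den_seq den_require.
set s4 := den g (PRSet _ _ _) s3; set s5 := den g _ s4.
have ag4 : agree [:: 12; 25; 26; 12; 26; 25; 12; 12]%N [:: 13]%N s s4.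
  apply: (@agree_trans _ _ _ s2); first by apply: agree_sub ag2; subset_dec.
  apply: (@agree_trans _ _ _ s3); first by apply: agree_sub ag3; subset_dec.
  by apply: agree_sub (agree_den g _ s3); subset_dec.
have n0 : neval s4 lE = l by rewrite /= (ag4.1 0 isT).
have h5 : rmem s5 13 0 = \sum_(y < l) rmem s 6 (y * k + x)%N.
  have := @sum_spec R l g 25%N lE 13 (tE 25 26) s4 (fun y => rmem s 6 (y * k + x)%N).
  rewrite n0 -/s5 => ->; first by rewrite /s4 den_rset rmem_setr /= add0r.
  move=> y s6 yl ag6 ey.
  have ag7 : agree [:: 12; 25; 26; 12; 26; 25; 12; 12]%N [:: 13]%N s s6.
    apply: (agree_trans ag4); apply: agree_sub ag6; subset_dec.
  have e26 : nmem s6 26 0 = x.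
    by rewrite (ag6.1 26 isT) /s4 den_rset nmem_setr.
  exact: (tE_val tb ag7 isT isT ey e26 (ltnW yl)).
have f5 : nmem s5 12 0 = nmem s3 12 0.
  by rewrite /s5 nmem_den// /s4 den_rset nmem_setr.
by rewrite /= h5 -eq_le -/(c x) f5.
Qed.

Lemma check_ldp_spec s : tables s ->
  nmem (den g check_ldp s) 12 0 = if [forall y : 'I_l, forall x : 'I_k, forall x' : 'I_k,
     rmem s 6 (y * k + x)%N <= rmem s 2 0 * rmem s 6 (y * k + x')%N]
   then nmem s 12 0 else 0%N.
Proof.
move=> tb; have [[n00 n01 _ _ _] _] := tb; rewrite /check_ldp.
pose c2 (y x x' : nat) := rmem s 6 (y * k + x)%N <= rmem s 2 0 * rmem s 6 (y * k + x')%N.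
pose c1 (y x : nat) := [forall x' : 'I_k, c2 y x x'].
pose c0 (y : nat) := [forall x : 'I_k, c1 y x].
rewrite (@flag_spec _ _ g 25%N lE _ s c0) // => [|y s1 yl ag1 ey].
  by rewrite /= n01.
rewrite /= n01 in yl.
rewrite (@flag_spec _ _ g 26%N kE _ s1 (c1 y)) // => [|x s2 xk ag2 ex].
  by rewrite /= (ag1.1 0 isT) n00.
rewrite /= (ag1.1 0 isT) n00 in xk.
rewrite (@flag_spec _ _ g 27%N kE _ s2 (c2 y x)) // => [|x' s3 xk' ag3 ex'].
  by rewrite /= (ag2.1 0 isT) (ag1.1 0 isT) n00.
rewrite den_require.
have ag : agree [:: 25; 26; 27; 12]%N [::] s s3.
  apply: (@agree_trans _ _ _ s1); first by apply: agree_sub ag1; subset_dec.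
  apply: (@agree_trans _ _ _ s2); first by apply: agree_sub ag2; subset_dec.
  by apply: agree_sub ag3; subset_dec.
have e25 : nmem s3 25 0 = y by rewrite (ag3.1 25 isT) (ag2.1 25 isT).
have e26 : nmem s3 26 0 = x by rewrite (ag3.1 26 isT).
have := tE_val tb ag isT isT e25 e26 (ltnW yl).
have := tE_val tb ag isT isT e25 ex' (ltnW yl).
by rewrite /= => -> ->; rewrite (ag.2 2 isT).
Qed.

Lemma try_candidate_spec s : tables s ->
  let T := mx_at s 6 in let v := g (T *m p, T *m q) in
  let s' := den g try_candidate s in
  if (nmem s 12 0 == 0)%N || ((0 < nmem s 13 0)%N && (v <= rmem s 4 0)) then
    [/\ nmem s' 13 0 = nmem s 13 0, rmem s' 4 0 = rmem s 4 0 & rmem s' 3 = rmem s 3]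
  else [/\ nmem s' 13 0 = 1%N, rmem s' 4 0 = v & mx_at s' 3 = T].
Proof.
move=> tb T v; rewrite /try_candidate den_if /= [(0 < nmem s 12 0)%N]lt0n.
have [_|_] := eqVneq (nmem s 12 0) 0%N; first by rewrite /= den_skip.
rewrite /= /keep_best !den_seq den_if.
set s1 := den g (apply_to 0 14) s; set s2 := den g (apply_to 1 15) s1.
have ag1 : agree [:: 25; 26]%N [:: 13; 13; 14]%N s s1 by apply: agree_sub (agree_den g _ _); subset_dec.
have ag2 : agree [:: 25; 26]%N [:: 13; 13; 15]%N s1 s2 by apply: agree_sub (agree_den g _ _); subset_dec.
have tb1 : tables s1 by exact: tables_agree ag1 isT tb.
have h1 : read_col l s1 14 = T *m p.
  by apply: (apply_to_spec g tb) => //; exact: tb.2.1.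
have h2 : read_col l s2 15 = T *m q.
  have -> : T = mx_at s1 6 by apply/matrixP => y x; rewrite !mxE (ag1.2 6 isT).
  by apply: (apply_to_spec g tb1) => //; exact: tb1.2.2.
have h3 : read_col l s2 14 = T *m p.
  by rewrite -h1; apply/colP => y; rewrite !mxE (ag2.2 14 isT).
rewrite den_query h2 h3 -/v; set s3 := setr s2 _ _ _.
have r5 : rmem s3 5 0 = v by rewrite rmem_setr.
have r4 : rmem s3 4 0 = rmem s 4 0.
  by rewrite rmem_setr /= (ag2.2 4 isT) (ag1.2 4 isT).
have r3 : rmem s3 3 = rmem s 3.
  have [_ /(_ 3 isT)->] := agree_setr 5 (neval s2 (NLit 0)) v s2.
  by rewrite (ag2.2 3 isT) (ag1.2 3 isT).
have r6 : rmem s3 6 = rmem s 6.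
  have [_ /(_ 6 isT)->] := agree_setr 5 (neval s2 (NLit 0)) v s2.
  by rewrite (ag2.2 6 isT) (ag1.2 6 isT).
have n13 : nmem s3 13 0 = nmem s 13 0.
  by rewrite nmem_setr (ag2.1 13 isT) (ag1.1 13 isT).
have tb3 : tables s3.
  apply: (tables_agree (agree_setr 5 _ v s2) isT).
  exact: tables_agree ag2 isT tb1.
have -> : beval s3 (BAnd (BLeN (NLit 1) (cell 13)) (BLeR (rcell 5) (rcell 4))) =
    (0 < nmem s 13 0)%N && (v <= rmem s 4 0).
  by rewrite /= n13 r5 r4.
case: ((0 < nmem s 13 0)%N && (v <= rmem s 4 0)); first by rewrite den_skip; split.
rewrite !den_seq; set s4 := den g (PRSet 4 _ _) s3; set s5 := den g (PNSet 13 _ _) s4.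
have ag4 : agree [::] [:: 4]%N s3 s4 by apply: agree_sub (agree_den g _ _); subset_dec.
have ag5 : agree [:: 13]%N [::] s4 s5 by apply: agree_sub (agree_den g _ _); subset_dec.
have tb5 : tables s5.
  by apply: (tables_agree ag5 isT); exact: tables_agree ag4 isT tb3.
split.
- by rewrite nmem_den// /s5 den_nset nmem_setn.
- by rewrite rmem_den// (ag5.2 4 isT) /s4 den_rset rmem_setr /= r5.
- rewrite (copy_out_spec g tb5); apply/matrixP => y x.
  by rewrite !mxE (ag5.2 6 isT) (ag4.2 6 isT) r6.
Qed.

Lemma try_candidate_safe (A : set ('cV[R]_l * 'cV[R]_l)) s : tables s ->
  ((0 < nmem s 12 0)%N -> A (mx_at s 6 *m p, mx_at s 6 *m q)) ->
  safe A g try_candidate s.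
Proof.
move=> tb hA; rewrite /try_candidate; cbn [safe]; case: ifP => // /hA {}hA.
split; first exact: query_free_safe.
split; first exact: query_free_safe.
split; last exact: query_free_safe.
set s1 := den g (apply_to 0 14) s; set s2 := den g (apply_to 1 15) s1.
have ag1 : agree [:: 25; 26]%N [:: 13; 13; 14]%N s s1 by apply: agree_sub (agree_den g _ _); subset_dec.
have ag2 : agree [:: 25; 26]%N [:: 13; 13; 15]%N s1 s2 by apply: agree_sub (agree_den g _ _); subset_dec.
have tb1 : tables s1 by exact: tables_agree ag1 isT tb.
have h1 : read_col l s1 14 = mx_at s 6 *m p.
  by apply: (apply_to_spec g tb) => //; exact: tb.2.1.
have h2 : read_col l s2 15 = mx_at s 6 *m q.
  have -> : mx_at s 6 = mx_at s1 6 by apply/matrixP => y x; rewrite !mxE (ag1.2 6 isT).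
  by apply: (apply_to_spec g tb1) => //; exact: tb1.2.2.
have h3 : read_col l s2 14 = mx_at s 6 *m p.
  by rewrite -h1; apply/colP => y; rewrite !mxE (ag2.2 14 isT).
by rewrite h2 h3.
Qed.

(* [J] collects the facts about constant arrays on which [gen] and [test] rely. *)
Lemma search_spec (C : set 'M[R]_(l, k)) (gen test : prog) (J : state R -> Prop) s :
  let P := search gen test in
  query_free gen -> query_free test ->
  all (fun a => a \notin nwrites gen ++ nwrites test) [:: 13; 22]%N ->
  all (fun a => a \notin rwrites gen ++ rwrites test) [:: 3; 4]%N ->
  (6 \notin rwrites test)%N ->
  (forall s1 s2, J s1 -> agree (nwrites P) (rwrites P) s1 s2 -> J s2) ->
  (forall s1, J s1 -> tables s1) ->
  (forall s1, J s1 -> nmem (den g test s1) 12 0 =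
      if `[< C (mx_at s1 6) >] then 1%N else 0%N) ->
  J s -> nmem s 13 0 = 0%N ->
  let s' := den g P s in
  [/\ safe (output_pairs C p q) g P s,
    (0 < nmem s' 13 0)%N -> C (mx_at s' 3) /\
      rmem s' 4 0 = g (mx_at s' 3 *m p, mx_at s' 3 *m q) &
    forall a T, (a < nmem s 5 0)%N -> C T ->
      (forall s1, J s1 -> nmem s1 7 0 = a -> mx_at (den g gen s1) 6 = T) ->
      (0 < nmem s' 13 0)%N /\ g (T *m p, T *m q) <= rmem s' 4 0].
Proof.
move=> P qg qt wn wr w6 Jag Jtb Jtest Js h0.
have /and3P[n13 n22 _] := wn; have /and3P[r3 r4 _] := wr.
pose W := nwrites P; pose V := rwrites P.
have sub1 (a : nat) : a \in nwrites gen -> a \in W.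
  by move=> h; rewrite /W /= !inE mem_cat h !orbT.
have sub2 (a : nat) : a \in nwrites test -> a \in W.
  by move=> h; rewrite /W /= !inE !mem_cat h !orbT.
have sub1' (a : nat) : a \in rwrites gen -> a \in V.
  by move=> h; rewrite /V /= mem_cat h.
have sub2' (a : nat) : a \in rwrites test -> a \in V.
  by move=> h; rewrite /V /= !mem_cat h !orbT.
have step i s1 : agree W V s s1 ->
    let s2 := setn (setn s1 22 0 i) 7 0 i in
    let s3 := den g gen s2 in let s4 := den g test s3 in
    [/\ den g (PSeq (PNSet 7 (NLit 0) (cell 22)) (PSeq gen (PSeq test try_candidate)))
          (setn s1 22 0 i) = den g try_candidate s4,
      J s2, J s4, nmem s2 7 0 = i & nmem s4 12 0 = if `[< C (mx_at s3 6) >] then 1%N else 0%N] /\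
      [/\ mx_at s4 6 = mx_at s3 6, nmem s4 13 0 = nmem s1 13 0, rmem s4 3 = rmem s1 3 &
         rmem s4 4 = rmem s1 4].
  move=> ag s2 s3 s4.
  have ag2 : agree W V s s2.
    apply: agree_trans ag _; apply: (@agree_trans _ _ _ (setn s1 22 0 i)).
      by apply: agree_sub (agree_setn _ _ _ _) => // a; rewrite !inE /= => ->.
    apply: agree_sub (agree_setn _ _ _ _) => // a; rewrite inE => /eqP->.
    by rewrite /W /= !inE.
  have ag3 : agree W V s s3.
    by apply: agree_trans ag2 _; apply: agree_sub (agree_den g gen s2).
  have ag4 : agree W V s s4.
    by apply: agree_trans ag3 _; apply: agree_sub (agree_den g test s3).
  split; first split.
  - by rewrite !den_seq den_nset /= nmem_setn.
  - exact: Jag Js ag2.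
  - exact: Jag Js ag4.
  - by rewrite /s2 nmem_setn.
  - by apply: Jtest; exact: Jag Js ag3.
  move: n13 r3 r4; rewrite !mem_cat !negb_or => /andP[g13 t13] /andP[g3 t3] /andP[g4 t4].
  split.
  - by apply/matrixP => y x; rewrite !mxE rmem_den.
  - by rewrite !nmem_den// /s2 !stateE.
  - by rewrite !rmem_den// /s2 !rmem_setn.
  - by rewrite !rmem_den// /s2 !rmem_setn.
split.
- move=> i hi.
  have ag := agree_iter g 22%N (cell 5) (PSeq (PNSet 7 (NLit 0) (cell 22))
    (PSeq gen (PSeq test try_candidate))) i s.
  set s1 := iteri _ _ _ in ag *.
  have := step i s1 ag => /= -[[_ J2 J4 _ f4] [m4 _ _ _]].
  split=> //; rewrite den_nset /= nmem_setn /=.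
  split; first exact: query_free_safe.
  split; first exact: query_free_safe.
  apply: try_candidate_safe; first exact: Jtb.
  rewrite f4 m4; case: asboolP => // CT _.
  by exists (mx_at (den g gen (setn (setn s1 22 0 i) 7 0 i)) 6).
- rewrite {1 2 3}/P /search; forloop (fun (i : nat) (s' : state R) => (0 < nmem s' 13 0)%N -> C (mx_at s' 3) /\
      rmem s' 4 0 = g (mx_at s' 3 *m p, mx_at s' 3 *m q)).
  + by rewrite h0.
  + move=> i s1 hi ag h; have := step i s1 ag => /=.
    set s4 := den g test _; move=> [[-> J2 J4 _ f4] [m4 e13 e3 e4]].
    have := try_candidate_spec (Jtb _ J4); set s5 := den g try_candidate s4.
    rewrite f4 e13 e3 e4 m4 /=; case: asboolP => [CT|nC] /=.
      case: ifP => _ [-> a1 a2].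
        have -> : mx_at s5 3 = mx_at s1 3 by apply/matrixP => y x; rewrite !mxE a2.
        by rewrite a1.
      by rewrite a1 a2.
    move=> [-> a1 a2].
    have -> : mx_at s5 3 = mx_at s1 3 by apply/matrixP => y x; rewrite !mxE a2.
    by rewrite a1.
  + move=> s1 [-> _ h].
    have -> : mx_at (setn s1 22 0 (neval s (cell 5))) 3 = mx_at s1 3.
      by apply/matrixP => y x; rewrite !mxE rmem_setn.
    by rewrite nmem_setn rmem_setn /=.
- move=> a T aN CT hT; rewrite /P /search.
  forloop (fun (i : nat) (s' : state R) => (a < i)%N -> (0 < nmem s' 13 0)%N /\ g (T *m p, T *m q) <= rmem s' 4 0).
  + by [].
  + move=> i s1 hi ag h; have := step i s1 ag => /=.
    set s4 := den g test _; move=> [[-> J2 J4 n7 f4] [m4 e13 e3 e4]].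
    have := try_candidate_spec (Jtb _ J4); set s5 := den g try_candidate s4.
    rewrite f4 e13 e3 e4 m4 /= ltnS [(a <= i)%N]leq_eqVlt.
    have [ai|_ /=] := eqVneq a i.
      have -> := hT _ J2 (etrans n7 (esym ai)).
      case: asboolP => //= _; case: ifP => [/andP[b1 b2]|_] [-> -> _] _; first by split.
      by split=> //; rewrite lexx.
    case: asboolP => [CT'|nC] /=; last by move=> [-> -> _].
    case: ifPn => [_|]; first by move=> [-> -> _].
    rewrite negb_and -ltNge => lt [-> -> _] /h[h1 h2]; split=> //.
    by move: lt; rewrite h1 /= => /ltW; exact: le_trans.
  + by move=> s1 [-> _ h]; rewrite nmem_setn rmem_setn /=; apply: h.
Qed.

End Checks.

(** [hi] is what remains after [n] digits; a second block in another radix can be nested there. *)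
Lemma digits_encode (r n hi M : nat) (d : nat -> nat) :
  (0 < r)%N -> (forall i, (i < n)%N -> (d i < r)%N) -> (hi < M)%N ->
  exists a, [/\ (a < r ^ n * M)%N,
    forall i, (i < n)%N -> ((a %/ r ^ i) %% r)%N = d i & (a %/ r ^ n)%N = hi].
Proof.
move=> r0; elim: n d => [|n ih] d dr hM.
  by exists hi; rewrite expn0 mul1n divn1.
have [i hi'|a [aM ad ah]] := ih (fun i => d i.+1) _ hM; first exact: dr.
have d0 := dr 0%N isT.
have ea : ((d 0%N + r * a) %/ r = a)%N by rewrite addnC mulnC divnMDl// divn_small// addn0.
exists (d 0%N + r * a)%N; split.
- rewrite expnS -mulnA (@leq_trans (r * a.+1))//; first by rewrite mulnS ltn_add2r.
  by rewrite leq_mul2l aM orbT.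
- move=> [_|i hi']; first by rewrite expn0 divn1 addnC mulnC modnMDl modn_small.
  by rewrite expnS divnMA ea ad.
- by rewrite expnS divnMA ea.
Qed.

(** * The elimination as a program *)

Definition pivot_row (c : nat) : nexp :=
  NGet 9 (at_l (NAdd (NAdd KE lE) (NLit 1)) (cell c)).
Definition gE (i : nexp) (j : nat) : rexp := RGet 9 (at_l i (cell j)).

Definition load_mx : prog :=
  PFor 25 lE (PFor 26 lE (PRSet 9 (at_l (cell 25) (cell 26))
    (RGet 8 (NGet 9 (at_l (NAdd KE (cell 25)) (cell 26)))))).
Definition load_rhs : prog :=
  PFor 25 lE (PRSet 10 (cell 25) (RGet 8 (NGet 9 (at_l (NAdd KE lE) (cell 25))))).
(** The factor is saved first, because the loop overwrites the entry from which it is computed. *)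
Definition eliminate_row : prog :=
  PSeq (PRSet 11 (NLit 0) (RDiv (gE (cell 26) 25) (gE (pivot_row 25) 25)))
    (PSeq (PFor 27 lE (PRSet 9 (at_l (cell 26) (cell 27))
       (RSub (gE (cell 26) 27) (RMul (rcell 11) (gE (pivot_row 25) 27)))))
    (PRSet 10 (cell 26)
       (RSub (RGet 10 (cell 26)) (RMul (rcell 11) (RGet 10 (pivot_row 25)))))).
Definition eliminate : prog :=
  PFor 25 lE (PFor 26 lE
    (PIf (BAnd (BLeN (cell 26) (pivot_row 25)) (BLeN (pivot_row 25) (cell 26)))
      PSkip eliminate_row)).
Definition solve : prog :=
  PFor 25 lE (PRSet 12 (cell 25) (RDiv (RGet 10 (pivot_row 25)) (gE (pivot_row 25) 25))).
Definition dE : nexp := NGet 9 (at_l (cell 25) (cell 26)).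
Definition columns : prog :=
  PFor 25 KE (PSeq (PRSet 13 (NLit 0) (RLit 0))
    (PSeq (PFor 26 lE (PRSet 13 (NLit 0)
        (RAdd (rcell 13) (RMul (RGet 8 dE) (RGet 12 (cell 26))))))
      (PFor 26 lE (PIf (BLeN dE (NLit 0))
        (PRSet 7 (at_l (cell 25) (cell 26)) (RSub (RLit 1) (rcell 13)))
        (PRSet 7 (at_l (cell 25) (cell 26)) (RMul (RGet 8 dE) (RGet 12 (cell 26)))))))).

Section Eval.
Variables (R : realType).
Implicit Types (s : state R).

Lemma reval_gE s i j :
  reval s (gE i j) = rmem s 9 (nmem s 4 (neval s i) + nmem s j 0)%N.
Proof. by []. Qed.

Lemma reval_get s a i : reval s (RGet a i) = rmem s a (neval s i).
Proof. by []. Qed.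

Lemma reval_div s e1 e2 : reval s (RDiv e1 e2) = reval s e1 / reval s e2.
Proof. by []. Qed.

Lemma reval_mul s e1 e2 : reval s (RMul e1 e2) = reval s e1 * reval s e2.
Proof. by []. Qed.

Lemma reval_sub s e1 e2 : reval s (RSub e1 e2) = reval s e1 - reval s e2.
Proof. by []. Qed.

Lemma neval_cell s a : neval s (cell a) = nmem s a 0.
Proof. by []. Qed.

Lemma neval_at_l s i j : neval s (at_l i j) = (nmem s 4 (neval s i) + neval s j)%N.
Proof. by []. Qed.

Lemma neval_lit s n : neval s (NLit n) = n.
Proof. by []. Qed.

Definition evalE := (reval_gE, reval_get, reval_div, reval_mul, reval_sub,
  neval_cell, neval_at_l, neval_lit).
End Eval.

Section GaussProgram.
Variables (R : realType) (l k : nat) (g : 'cV[R]_l * 'cV[R]_l -> R).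
Variables (p q : 'cV[R]_k) (E : R).
Implicit Types (s : state R).
Local Notation tables := (@tables R l k p q).
Local Notation K := (l * l).+1.

Lemma table_l W V s s' j : tables s -> agree W V s s' -> (4 \notin W)%N ->
  (j <= l * l + l + 4)%N -> nmem s' 4 j = (j * l)%N.
Proof. by move=> [[_ _ _ _ n4] _] ag w hj; rewrite (ag.1 4 w) n4. Qed.

Lemma load_mx_spec s : tables s -> rmem s 8 = coef E ->
  forall i j, (i < l)%N -> (j < l)%N ->
  rmem (den g load_mx s) 9 (i * l + j)%N = digit_mx E l (nmem s 9) K i j.
Proof.
move=> tb r8; have [[n00 n01 n2 n3 n4] _] := tb.
have := @fill2_spec R l g 25%N 26%N lE lE 9 (at_l (cell 25) (cell 26))
  (RGet 8 (NGet 9 (at_l (NAdd KE (cell 25)) (cell 26)))) s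
  (fun y x => y * l + x)%N (fun i j => digit_mx E l (nmem s 9) K i j).
rewrite /= n01; apply => //.
- move=> y x s' yl xl ag -> ->.
  have -> := table_l tb ag isT (_ : y <= _)%N; last by lia.
  rewrite (ag.1 3 isT) n3 (ag.2 8 isT) r8 (ag.1 9 isT).
  have -> := table_l tb ag isT (_ : l * l + 1 + y <= _)%N; last by lia.
  by rewrite /digit_mx addn1.
- by move=> y x y' x'; exact: index2_inj.
Qed.

Lemma load_rhs_spec s : tables s -> rmem s 8 = coef E ->
  forall i, (i < l)%N ->
  rmem (den g load_rhs s) 10 i = digit_mx E l (nmem s 9) (K + l) 0 i.
Proof.
move=> tb r8; have [[n00 n01 n2 n3 n4] _] := tb.
have := @fill_spec R l g 25%N lE 10
  (RGet 8 (NGet 9 (at_l (NAdd KE lE) (cell 25)))) s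
  (fun i => digit_mx E l (nmem s 9) (K + l) 0 i).
rewrite /= n01; apply => i s' il ag ->.
rewrite (ag.1 3 isT) n3 (ag.1 0 isT) n01 (ag.2 8 isT) r8 (ag.1 9 isT).
have -> := table_l tb ag isT (_ : l * l + 1 + l <= _)%N; last by lia.
by rewrite /digit_mx addn0 addn1.
Qed.

Lemma pivot_row_val W V s s' c i : tables s -> agree W V s s' ->
  all (fun a => a \notin W) [:: 0; 3; 4; 9]%N -> nmem s' c 0 = i ->
  neval s' (pivot_row c) = nmem s 9 ((K + l).+1 * l + i)%N.
Proof.
move=> tb ag /and5P[w0 w3 w4 w9 _] /= ->; have [[n00 n01 _ n3 _] _] := tb.
rewrite (ag.1 0 w0) (ag.1 3 w3) n01 n3 (ag.1 9 w9).
have -> := table_l tb ag w4 (_ : l * l + 1 + l + 1 <= _)%N; last by lia.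
by rewrite !addn1 addSn.
Qed.

Lemma eliminate_row_spec s c i (A : nat -> nat -> R) (b : nat -> R) : tables s ->
  let r := nmem s 9 ((K + l).+1 * l + c)%N in
  nmem s 25 0 = c -> nmem s 26 0 = i -> (c < l)%N -> (i < l)%N -> (r < l)%N ->
  i != r ->
  (forall j, (j < l)%N -> rmem s 9 (i * l + j)%N = A i j) ->
  (forall j, (j < l)%N -> rmem s 9 (r * l + j)%N = A r j) ->
  rmem s 10 i = b i -> rmem s 10 r = b r ->
  let s' := den g eliminate_row s in
  [/\ forall j, (j < l)%N -> rmem s' 9 (i * l + j)%N = pivot_mx A c r i j,
    rmem s' 10 i = pivot_rhs A b c r i,
    forall i' j, i' != i -> (j < l)%N -> rmem s' 9 (i' * l + j)%N = rmem s 9 (i' * l + j)%N &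
    forall i', i' != i -> rmem s' 10 i' = rmem s 10 i'].
Proof.
move=> tb r n25 n26 cl il rl ir hi hr bi br; rewrite /eliminate_row !den_seq.
have [[n00 n01 _ n3 _] _] := tb.
set f := A i c / A r c.
set s1 := den g (PRSet 11 _ _) s; set s2 := den g (PFor _ _ _) s1.
have ag1 : agree [::] [:: 11]%N s s1 by apply: agree_sub (agree_den g _ _); subset_dec.
have pr s3 W V : agree W V s s3 -> all (fun a => a \notin W) [:: 0; 3; 4; 9]%N ->
    nmem s3 25 0 = c -> neval s3 (pivot_row 25) = r.
  by move=> ag w e; rewrite (pivot_row_val tb ag w e).
have f1 : rmem s1 11 0 = f.
  rewrite /s1 den_rset !evalE rmem_setr.
  rewrite (pr s [::] [::] (agree_refl _ _ _))// n25 n26.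
  have -> := table_l tb (agree_refl [::] [::] s) isT (_ : i <= _)%N; last by lia.
  have -> := table_l tb (agree_refl [::] [::] s) isT (_ : r <= _)%N; last by lia.
  by rewrite hi// hr.
have h2 : (forall j, (j < l)%N -> rmem s2 9 (i * l + j)%N = pivot_mx A c r i j) /\
    forall i' j, i' != i -> (j < l)%N -> rmem s2 9 (i' * l + j)%N = rmem s 9 (i' * l + j)%N.
  rewrite /s2; forloop (fun n s' => (forall j, (j < l)%N -> rmem s' 9 (i * l + j)%N =
      if (j < n)%N then pivot_mx A c r i j else A i j) /\
    forall i' j, i' != i -> (j < l)%N -> rmem s' 9 (i' * l + j)%N = rmem s 9 (i' * l + j)%N).
  - by rewrite (ag1.2 9 isT); split=> // j jl; rewrite hi.
  - rewrite /= (ag1.1 0 isT) n01 => n s3 nl ag3 [h1 h2].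
    have ag4 : agree [:: 27]%N [:: 11; 9]%N s (setn s3 27 0 n).
      apply: (@agree_trans _ _ _ s1); first by apply: agree_sub ag1; subset_dec.
      apply: (@agree_trans _ _ _ s3); first by apply: agree_sub ag3; subset_dec.
      by apply: agree_sub (agree_setn _ _ _ _); subset_dec.
    have e25 : nmem (setn s3 27 0 n) 25 0 = c by rewrite (ag4.1 25 isT).
    rewrite den_rset !evalE (pr _ _ _ ag4 isT e25).
    have e26 : nmem (setn s3 27 0 n) 26 0 = i by rewrite (ag4.1 26 isT).
    rewrite e26.
    have -> := table_l tb ag4 isT (_ : i <= _)%N; last by lia.
    have -> := table_l tb ag4 isT (_ : r <= _)%N; last by lia.
    have -> : nmem (setn s3 27 0 n) 27 0 = n by rewrite nmem_setn.
    rewrite rmem_setn (ag3.2 11 isT) f1 h1// ltnn h2 1?eq_sym// hr//.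
    split=> [j jl|i' j ni jl]; rewrite rmem_setr /= rmem_setn; case: eqP => [e|ne].
    + have [_ ->] := index2_inj jl nl e.
      by rewrite ltnSn /pivot_mx (negbTE ir).
    + rewrite h1// ltnS [(j <= n)%N]leq_eqVlt; case: (eqVneq j n) => [e|//].
      by exfalso; apply: ne; rewrite e.
    + by have [e1 _] := index2_inj jl nl e; rewrite e1 eqxx in ni.
    + exact: h2.
  - rewrite /= (ag1.1 0 isT) n01 => s3 [-> _ [h1 h2]]; rewrite rmem_setn; split=> // j jl.
    by rewrite h1// jl.
have ag2 : agree [:: 27]%N [:: 11; 9]%N s s2.
  apply: (@agree_trans _ _ _ s1); first by apply: agree_sub ag1; subset_dec.
  by apply: agree_sub (agree_den g _ _); subset_dec.
have e25 : nmem s2 25 0 = c by rewrite (ag2.1 25 isT).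
have f2 : rmem s2 11 0 = f by rewrite /s2 (rmem_den g).
rewrite den_rset !evalE (pr _ _ _ ag2 isT e25) (ag2.1 26 isT) n26.
rewrite f2 (ag2.2 10 isT) bi br; case: h2 => h2 h2'.
split.
- by move=> j jl; rewrite rmem_setr /= h2.
- by rewrite rmem_setr !eqxx /pivot_rhs (negbTE ir).
- by move=> i' j ni jl; rewrite rmem_setr /= h2'.
- by move=> i' ni; rewrite rmem_setr (negbTE ni) /= (ag2.2 10 isT).
Qed.

Lemma eliminate_spec s (A : nat -> nat -> R) (b : nat -> R) : tables s ->
  let rho c := nmem s 9 ((K + l).+1 * l + c)%N in
  (forall c, (c < l)%N -> (rho c < l)%N) ->
  (forall i j, (i < l)%N -> (j < l)%N -> rmem s 9 (i * l + j)%N = A i j) ->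
  (forall i, (i < l)%N -> rmem s 10 i = b i) ->
  let s' := den g eliminate s in
  (forall i j, (i < l)%N -> (j < l)%N ->
     rmem s' 9 (i * l + j)%N = (gauss A b rho l).1 i j) /\
  (forall i, (i < l)%N -> rmem s' 10 i = (gauss A b rho l).2 i).
Proof.
move=> tb rho rl hA hb; have [[n00 n01 _ n3 _] _] := tb.
rewrite /eliminate; forloop (fun n s' => (forall i j, (i < l)%N -> (j < l)%N ->
     rmem s' 9 (i * l + j)%N = (gauss A b rho n).1 i j) /\
  (forall i, (i < l)%N -> rmem s' 10 i = (gauss A b rho n).2 i)).
- by [].
- rewrite /= n01 => c s1 cl ag1 [].
  case: gauss => A' b' /= h1 h2; set r := rho c.
  have rlt : (r < l)%N by exact: rl.
  have ag2 : agree [:: 25; 26; 27]%N [:: 11; 9; 10]%N s (setn s1 25 0 c).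
    apply: (@agree_trans _ _ _ s1); first by apply: agree_sub ag1; subset_dec.
    by apply: agree_sub (agree_setn _ _ _ _); subset_dec.
  forloop (fun n s' => (forall i j, (i < l)%N -> (j < l)%N -> rmem s' 9 (i * l + j)%N =
      if (i < n)%N then pivot_mx A' c r i j else A' i j) /\
    (forall i, (i < l)%N -> rmem s' 10 i = if (i < n)%N then pivot_rhs A' b' c r i else b' i)).
  + by rewrite rmem_setn.
  + rewrite /= (ag2.1 0 isT) n01 => i s3 il ag3 [h3 h4].
    set s4 := setn s3 26 0 i.
    have ag4 : agree [:: 25; 26; 27]%N [:: 11; 9; 10]%N s s4.
      apply: (agree_trans ag2).
      apply: (@agree_trans _ _ _ s3); first by apply: agree_sub ag3; subset_dec.
      by apply: agree_sub (agree_setn _ _ _ _); subset_dec.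
    have e25 : nmem s4 25 0 = c by rewrite nmem_setn /= (ag3.1 25 isT) nmem_setn.
    have e26 : nmem s4 26 0 = i by rewrite nmem_setn.
    have pr : neval s4 (pivot_row 25) = r by rewrite (pivot_row_val tb ag4 isT e25).
    rewrite den_if.
    have -> : beval s4 (BAnd (BLeN (cell 26) (pivot_row 25)) (BLeN (pivot_row 25) (cell 26))) = (i == r).
      rewrite -[beval _ _]/((nmem s4 26 0 <= neval s4 (pivot_row 25))%N &&
        (neval s4 (pivot_row 25) <= nmem s4 26 0)%N).
      by rewrite pr e26 -eqn_leq.
    (* The pivot row reads the same before and after its turn, so all rows are reduced by the same
       row. *)
    have oldr j : (j < l)%N -> rmem s4 9 (r * l + j)%N = A' r j.
      by move=> jl; rewrite rmem_setn h3//; case: ifP => // _; rewrite /pivot_mx eqxx.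
    have oldb : rmem s4 10 r = b' r.
      by rewrite rmem_setn h4//; case: ifP => // _; rewrite /pivot_rhs eqxx.
    have [ir|ir] := eqVneq i r.
      rewrite den_skip; split=> [i' j i'l jl|i' i'l]; rewrite ltnS leq_eqVlt.
        have [->|_ /=] := eqVneq i' i; last by rewrite rmem_setn h3.
        by rewrite ir oldr// /pivot_mx eqxx.
      have [->|_ /=] := eqVneq i' i; last by rewrite rmem_setn h4.
      by rewrite ir oldb// /pivot_rhs eqxx.
    have tb4 : tables s4 by exact: tables_agree ag4 isT tb.
    have er : nmem s4 9 ((K + l).+1 * l + c)%N = r by rewrite (ag4.1 9 isT).
    have := @eliminate_row_spec s4 c i A' b' tb4; rewrite /= er.
    move=> /(_ e25 e26 cl il rlt ir) [||//|//|a1 a2 a3 a4].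
    * by move=> j jl; rewrite rmem_setn h3// ltnn.
    * by [].
    * by rewrite rmem_setn h4// ltnn.
    split=> [i' j i'l jl|i' i'l]; rewrite ltnS leq_eqVlt.
      have [->|ni /=] := eqVneq i' i; first by rewrite a1.
      by rewrite a3// rmem_setn h3.
    have [->|ni /=] := eqVneq i' i; first by rewrite a2.
    by rewrite a4// rmem_setn h4.
  + rewrite /= (ag2.1 0 isT) n01 => s3 [-> _ [h3 h4]]; rewrite rmem_setn.
    by split=> [i j il jl|i il]; rewrite ?h3 ?h4 ?il.
- by rewrite /= n01 => s1 [-> _ [h1 h2]]; rewrite rmem_setn.
Qed.

Lemma solve_spec s : tables s ->
  let rho c := nmem s 9 ((K + l).+1 * l + c)%N in
  (forall c, (c < l)%N -> (rho c < l)%N) ->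
  forall c, (c < l)%N -> rmem (den g solve s) 12 c =
    rmem s 10 (rho c) / rmem s 9 (rho c * l + c)%N.
Proof.
move=> tb rho rl; have [[n00 n01 _ n3 _] _] := tb.
have := @fill_spec R l g 25%N lE 12 (RDiv (RGet 10 (pivot_row 25)) (gE (pivot_row 25) 25)) s
  (fun c => rmem s 10 (rho c) / rmem s 9 (rho c * l + c)%N).
rewrite [neval s lE]/= n01; apply => c s' cl ag e.
rewrite !evalE (pivot_row_val tb ag isT e) -/(rho c) e.
have -> := table_l tb ag isT (_ : rho c <= _)%N; last by have := rl c cl; lia.
by rewrite (ag.2 10 isT) (ag.2 9 isT).
Qed.

Lemma columns_spec s : tables s -> rmem s 8 = coef E ->
  let D := nmem s 9 in
  forall j y, (j < K)%N -> (y < l)%N -> rmem (den g columns s) 7 (j * l + y)%N =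
    if D (j * l + y)%N == 0%N
    then 1 - \sum_(y' < l) coef E (D (j * l + y')%N) * rmem s 12 y'
    else coef E (D (j * l + y)%N) * rmem s 12 y.
Proof.
move=> tb r8 D; have [[n00 n01 _ n3 _] _] := tb.
pose val j y := if D (j * l + y)%N == 0%N
    then 1 - \sum_(y' < l) coef E (D (j * l + y')%N) * rmem s 12 y'
    else coef E (D (j * l + y)%N) * rmem s 12 y.
rewrite /columns.
forloop (fun n s' => (n <= K)%N -> forall j y, (j < n)%N -> (y < l)%N ->
  rmem s' 7 (j * l + y)%N = val j y).
- by [].
- rewrite /= n3 addn1 => j s1 jK ag1 h _; rewrite !den_seq.
  set s2 := den g (PRSet 13 _ _) _; set s3 := den g (PFor _ _ _) s2.
  have ag2 : agree [:: 25; 26]%N [:: 13; 7]%N s s2.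
    apply: (@agree_trans _ _ _ s1); first by apply: agree_sub ag1; subset_dec.
    apply: (@agree_trans _ _ _ (setn s1 25 0 j)); first by apply: agree_sub (agree_setn _ _ _ _); subset_dec.
    by apply: agree_sub (agree_den g _ _); subset_dec.
  have e25 : nmem s2 25 0 = j by rewrite /s2 den_rset nmem_setr nmem_setn.
  have nl2 : neval s2 lE = l by rewrite /= (ag2.1 0 isT).
  have dv s4 y : agree [:: 25; 26]%N [:: 13; 7]%N s s4 -> nmem s4 25 0 = j ->
      nmem s4 26 0 = y -> neval s4 dE = D (j * l + y)%N.
    move=> ag4 /= -> ->; have -> := table_l tb ag4 isT (_ : j <= _)%N; last by lia.
    by rewrite (ag4.1 9 isT).
  have sum3 : rmem s3 13 0 = \sum_(y' < l) coef E (D (j * l + y')%N) * rmem s 12 y'.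
    have := @sum_spec R l g 26%N lE 13 (RMul (RGet 8 dE) (RGet 12 (cell 26))) s2
      (fun y' => coef E (D (j * l + y')%N) * rmem s 12 y').
    rewrite nl2 -/s3 => ->; first by rewrite /s2 den_rset rmem_setr /= add0r.
    move=> y s4 yl ag4 ey.
    have ag5 : agree [:: 25; 26]%N [:: 13; 7]%N s s4.
      by apply: (agree_trans ag2); apply: agree_sub ag4; subset_dec.
    rewrite !evalE (dv s4 y)//; last by rewrite (ag4.1 25 isT).
    by rewrite ey (ag5.2 8 isT) (ag5.2 12 isT) r8.
  have ag3 : agree [:: 25; 26]%N [:: 13; 7]%N s s3.
    by apply: (agree_trans ag2); apply: agree_sub (agree_den g _ _); subset_dec.
  have e25' : nmem s3 25 0 = j by rewrite /s3 nmem_den.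
  have h3 j' y : (j' < j)%N -> (y < l)%N -> rmem s3 7 (j' * l + y)%N = val j' y.
    move=> jj yl; rewrite /s3 rmem_den// /s2 rmem_den// rmem_setn.
    by apply: h => //; lia.
  have nl3 : neval s3 lE = l by rewrite /= (ag3.1 0 isT).
  forloop (fun n s' => (n <= l)%N ->
    (forall j' y, (j' < j)%N -> (y < l)%N -> rmem s' 7 (j' * l + y)%N = val j' y) /\
    forall y, (y < n)%N -> rmem s' 7 (j * l + y)%N = val j y).
  + by [].
  + rewrite nl3 => y s4 yl ag4 h4 _; have {h4}[h4 h5] := h4 (ltnW yl).
    set s5 := setn s4 26 0 y.
    have ag5 : agree [:: 25; 26]%N [:: 13; 7]%N s s5.
      apply: (agree_trans ag3); apply: (@agree_trans _ _ _ s4); first by apply: agree_sub ag4; subset_dec.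
      by apply: agree_sub (agree_setn _ _ _ _); subset_dec.
    have e25s : nmem s5 25 0 = j by rewrite nmem_setn /= (ag4.1 25 isT).
    have e26 : nmem s5 26 0 = y by rewrite nmem_setn.
    have ed := dv s5 y ag5 e25s e26.
    have ix : neval s5 (at_l (cell 25) (cell 26)) = (j * l + y)%N.
      rewrite /= e25s e26; have -> // := table_l tb ag5 isT (_ : j <= _)%N.
      by lia.
    have -> : den g (PIf (BLeN dE (NLit 0))
        (PRSet 7 (at_l (cell 25) (cell 26)) (RSub (RLit 1) (rcell 13)))
        (PRSet 7 (at_l (cell 25) (cell 26)) (RMul (RGet 8 dE) (RGet 12 (cell 26))))) s5 =
        setr s5 7 (j * l + y)%N (val j y).
      rewrite den_if !den_rset ix.
      rewrite -[beval _ _]/(neval s5 dE <= 0)%N ed leqn0 /val.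
      case: ifP => _; congr setr.
        by rewrite /= rmem_setn (ag4.2 13 isT) sum3.
      by rewrite !evalE ed e26 (ag5.2 8 isT) (ag5.2 12 isT) r8.
    split=> [j' y' jj yl'|y']; rewrite rmem_setr eqxx /=.
      case: eqP => [e|_]; last by rewrite rmem_setn h4.
      by have [e1 _] := index2_inj yl' yl e; rewrite e1 ltnn in jj.
    rewrite ltnS leq_eqVlt; case: eqP => [->|ne /= yy]; first by rewrite eqxx.
    by rewrite (inj_eq (@addnI _)) (introF eqP ne) rmem_setn h5.
  + rewrite nl3 => s4 [-> _ /(_ (leqnn _)) [h4 h5]] j' y; rewrite rmem_setn ltnS leq_eqVlt.
    by case: eqP => [->|_ /= jj] // yl; [exact: h5|exact: h4].
- rewrite /= n3 addn1 => s1 [-> _ h] j y jK yl; rewrite rmem_setn.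
  exact: h.
Qed.

End GaussProgram.

(** * Tables of multiples and the number of guesses *)

Section Setup.
Variables (R : realType) (l k : nat) (g : 'cV[R]_l * 'cV[R]_l -> R).
Implicit Types (s : state R).

Lemma set_tables_spec s : nmem s 0 0 = k -> nmem s 0 1 = l ->
  nmem s 2 0 = 0%N -> nmem s 3 0 = 0%N ->
  (forall y, (y <= l)%N -> nmem (den g set_tables s) 2 y = (y * k)%N) /\
  nmem (den g set_tables s) 3 0 = (l * l)%N.
Proof.
move=> n00 n01 n2 n3; rewrite /set_tables den_seq.
set s1 := den g _ s.
have ag1 : agree [:: 20; 2]%N [::] s s1 by apply: agree_sub (agree_den g _ _); subset_dec.
have h1 y : (y <= l)%N -> nmem s1 2 y = (y * k)%N.
  move: y; rewrite /s1; forloop (fun n s' => forall y, (y <= n)%N -> nmem s' 2 y = (y * k)%N).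
  - by move=> y; rewrite leqn0 => /eqP->.
  - rewrite /= n01 => i s2 il ag h y; rewrite den_nset /= !nmem_setn /=.
    rewrite (ag.1 0 isT) n00 addn1; case: eqP => [-> _|ny yi]; first by rewrite h// mulSnr.
    by rewrite h//; lia.
  - by rewrite /= n01 => s2 [-> _ h] y yl; rewrite nmem_setn h.
split=> [y yl|]; first by rewrite nmem_den// h1.
forloop (fun n s' => nmem s' 3 0 = (n * l)%N).
- by rewrite (ag1.1 3 isT) n3.
- move=> i s2 il ag h; rewrite den_nset /= !nmem_setn /= h (ag.1 0 isT) (ag1.1 0 isT) n01.
  by rewrite mulSnr.
- by rewrite /= (ag1.1 0 isT) n01 => s2 [-> _ h]; rewrite nmem_setn.
Qed.

Lemma set_table_l_spec s : nmem s 0 1 = l -> nmem s 3 0 = (l * l)%N ->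
  nmem s 4 0 = 0%N ->
  forall j, (j <= l * l + l + 4)%N -> nmem (den g set_table_l s) 4 j = (j * l)%N.
Proof.
move=> n01 n3 n4; rewrite /set_table_l.
forloop (fun n s' => forall y, (y <= n)%N -> nmem s' 4 y = (y * l)%N).
- by move=> y; rewrite leqn0 => /eqP->.
- rewrite /= n01 n3 => i s2 il ag h y; rewrite den_nset /= !nmem_setn /=.
  rewrite (ag.1 0 isT) n01 addn1; case: eqP => [-> _|ny yi]; first by rewrite h// mulSnr.
  by rewrite h//; lia.
- by rewrite /= n01 n3 addnA => s2 [-> _ h] y yl; rewrite nmem_setn h.
Qed.

Lemma mul_power_spec (r n : nexp) s : unwritten [:: 5; 6; 20; 21]%N r ->
  nmem (den g (mul_power r n) s) 5 0 = (nmem s 5 0 * neval s r ^ neval s n)%N.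
Proof.
move=> hr; rewrite /mul_power.
forloop (fun n s' => nmem s' 5 0 = (nmem s 5 0 * neval s r ^ n)%N).
- by rewrite muln1.
- move=> i s1 hi ag h; rewrite !denE.
  set s2 := setn _ 6 _ _.
  have n5 : nmem s2 5 0 = (nmem s 5 0 * neval s r ^ i)%N by rewrite !stateE.
  have er : neval s2 r = neval s r.
    rewrite /s2 !neval_setn; try by unw hr.
    by apply: (neval_agree ag); unw hr.
  forloop (fun j s' => nmem s' 6 0 = (j * (nmem s 5 0 * neval s r ^ i))%N).
  + by rewrite nmem_setn.
  + move=> j s3 _ ag3 h3; rewrite den_nset !nmem_setn /= !nmem_setn /= h3.
    by rewrite (ag3.1 5 isT) n5 mulSnr.
  + move=> s3 [-> _ h3]; rewrite er in h3.
    by rewrite !nmem_setn /= !nmem_setn /= h3 expnSr mulnC mulnA.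
- by move=> s1 [-> _ h]; rewrite nmem_setn.
Qed.

End Setup.

(** * From a complete family of candidates to a maximiser *)

Lemma quasi_convex_max_fin (R : realType) l (A : set ('cV[R]_l * 'cV[R]_l)) g
    (F : finType) (f0 : F) (z : F -> 'cV[R]_l * 'cV[R]_l) (w : 'cV[R]_l * 'cV[R]_l) :
  jointly_quasi_convex A g -> (forall i, A (z i)) ->
  (forall a b : 'I_l -> R, exists i, \sum_y (a y * w.1 y 0 + b y * w.2 y 0)
     <= \sum_y (a y * (z i).1 y 0 + b y * (z i).2 y 0)) ->
  exists i, g w <= g (z i).
Proof.
move=> qc Az sup.
have hn : #|F|.-1.+1 = #|F| by rewrite prednK//; apply/card_gt0P; exists f0.
have [i|a b|i hi] := @quasi_convex_max R l A g _
  (fun i : 'I_#|F|.-1.+1 => z (enum_val (cast_ord hn i))) w qc.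
- exact: Az.
- have [f hf] := sup a b; exists (cast_ord (esym hn) (enum_rank f)).
  by rewrite cast_ordKV enum_rankK.
- by exists (enum_val (cast_ord hn i)).
Qed.

(** The hull is spanned by all output permutations of the candidates; [pinv] gives a permuted
    candidate the value of the candidate that is actually tried. *)
Lemma best_candidate (R : realType) l k (C : set 'M[R]_(l, k)) (p q : 'cV[R]_k)
    (g : 'cV[R]_l * 'cV[R]_l -> R) (N : nat) (produced : nat -> 'M[R]_(l, k) -> Prop) :
  let A := output_pairs C p q in
  jointly_quasi_convex A g -> permutation_invariant A g ->
  (forall i T T', produced i T -> produced i T' -> T = T') ->
  (forall (s : 'S_l) T, C T -> C (perm_mx s *m T)) ->
  (forall a b T, C T -> exists i T' (s : 'S_l), [/\ (i < N)%N, produced i T', C T' &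
     functional a b p q T <= functional a b p q (perm_mx s *m T')]) ->
  forall T, C T -> exists i T', [/\ (i < N)%N, produced i T', C T' &
    g (T *m p, T *m q) <= g (T' *m p, T' *m q)].
Proof.
move=> A qc pinv uniq permC sup T CT.
have [i0 [T0 [s0 [i0N pT0 CT0 _]]]] := sup (fun=> 0) (fun=> 0) T CT.
pose good i T' := produced i T' /\ C T'.
(* A guess without a valid candidate is represented by [T0], so that the family is total. *)
have /choice[cand hcand] (i : 'I_N) : exists T' : 'M[R]_(l, k), C T' /\
    exists2 j : 'I_N, produced j T' & forall T'', good i T'' -> T' = T''.
  have [[T' [h1 h2]]|no] := pselect (exists T', good i T').
    by exists T'; split=> //; exists i => // T'' [h _]; exact: uniq h1 h.
  exists T0; split=> //; exists (Ordinal i0N) => // T'' h.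
  by exfalso; apply: no; exists T''.
have [u|a b|[i s] /= gi] := @quasi_convex_max_fin R l A g ('I_N * 'S_l)%type
  (Ordinal i0N, 1%g)
  (fun u => (perm_mx u.2 *m cand u.1 *m p, perm_mx u.2 *m cand u.1 *m q))
  (T *m p, T *m q) qc.
- exists (perm_mx u.2 *m cand u.1) => //.
  by apply: permC; have [] := hcand u.1.
- have [i [T' [s [iN pT' CT' le]]]] := sup a b T CT.
  exists (Ordinal iN, s) => /=; have [_ [j _ e]] := hcand (Ordinal iN).
  by rewrite (e T' (conj pT' CT')).
have [Ci [j pj _]] := hcand i.
exists j, (cand i); split=> //.
apply: le_trans gi _; rewrite (pinv s (cand i *m p, cand i *m q))/= ?mulmxA//.
by exists (cand i).
Qed.

Section Search.
Variables (R : realType) (l k : nat) (p q : 'cV[R]_k).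
Variables (g : 'cV[R]_l * 'cV[R]_l -> R) (C : set 'M[R]_(l, k)).
Variables (gen test : prog) (J : state R -> Prop) (s : state R).
Let P := search gen test.
Let A := output_pairs C p q.
Hypothesis qfg : query_free gen.
Hypothesis qft : query_free test.
Hypothesis nw : all (fun a => a \notin nwrites gen ++ nwrites test) [:: 13; 22]%N.
Hypothesis rw : all (fun a => a \notin rwrites gen ++ rwrites test) [:: 3; 4]%N.
Hypothesis rw6 : (6 \notin rwrites test)%N.
Hypothesis J_agree : forall s1 s2, J s1 -> agree (nwrites P) (rwrites P) s1 s2 -> J s2.
Hypothesis J_tables : forall s1, J s1 -> tables l p q s1.
Hypothesis J_test : forall s1, J s1 -> nmem (den g test s1) 12 0 =
  if `[< C (mx_at l k s1 6) >] then 1%N else 0%N.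
Hypothesis Js : J s.
Hypothesis s13 : nmem s 13 0 = 0%N.
Hypothesis qc : jointly_quasi_convex A g.
Hypothesis pinv : permutation_invariant A g.
Hypothesis permC : forall (sg : 'S_l) T, C T -> C (perm_mx sg *m T).
Hypothesis C0 : exists T, C T.
Let produced a T := forall s1, J s1 -> nmem s1 7 0 = a -> mx_at l k (den g gen s1) 6 = T.
Hypothesis complete : forall a b T, C T -> exists i T' (sg : 'S_l),
  [/\ (i < nmem s 5 0)%N, produced i T', C T' &
     functional a b p q T <= functional a b p q (perm_mx sg *m T')].

Lemma search_solves : let s' := den g P s in
  [/\ safe A g P s, is_maximizer C p q g (output_mx l k s') &
    output_val s' = g (output_mx l k s' *m p, output_mx l k s' *m q)].
Proof.
have [sf h1 h2] := search_spec qfg qft nw rw rw6 J_agree J_tables J_test Js s13.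
(* [produced] quantifies over states, so uniqueness needs one: [s] with the guess written into array
   7. *)
have uniq i T T' : produced i T -> produced i T' -> T = T'.
  move=> hT hT'; have Ji : J (setn s 7 0 i).
    apply: J_agree Js _; apply: agree_sub (agree_setn _ _ _ _) => // a.
    by rewrite inE => /eqP->; rewrite /= !inE.
  by rewrite -(hT _ Ji) ?(hT' _ Ji)// nmem_setn.
have best := best_candidate qc pinv uniq permC complete.
have [T0 /best[i0 [T1 [i0N pT1 CT1 _]]]] := C0.
have [hv _] := h2 _ _ i0N CT1 pT1.
have [CT e] := h1 hv.
split=> //; split=> // T /best[i [T' [iN pT' CT' le]]].
apply: le_trans le _; have [_] := h2 _ _ iN CT' pT'.
by rewrite e.
Qed.

End Search.

(** The setup writes cells that later loop bounds read, so the whole program is not [frozen]. It is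
    run phase by phase, each with its bounds evaluated where it starts. *)
Lemma exec_den_seq (R : realType) l (A : set ('cV[R]_l * 'cV[R]_l)) g P Q (s s' : state R) N :
  frozen P -> query_free P -> all (fun e => neval s e <= N)%N (bounds P) ->
  (exists2 t : nat, exec A g (compile Q) (den g P s) t s' & (t <= cost_bound Q N)%N) ->
  exists2 t : nat, exec A g (compile (PSeq P Q)) s t s' & (t <= cost_bound (PSeq P Q) N)%N.
Proof.
move=> fP qP bP [t2 e2 h2].
have [t1 e1 h1] := exec_den fP (query_free_safe A g s qP) bP.
by exists (t1 + t2)%N; [exact: ExecSeq e1 e2|exact: leq_add].
Qed.

(** * The two algorithms *)

Lemma channels_perm (R : realType) l k (sg : 'S_l) (T : 'M[R]_(l, k)) :
  channels T -> channels (perm_mx sg *m T).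
Proof.
move=> [T0 T1]; split=> [y x|x]; rewrite -?row_permE; first by rewrite mxE.
rewrite -[RHS](T1 x) [RHS](reindex_inj (@perm_inj _ sg)).
by apply: eq_bigr => y _; rewrite mxE.
Qed.

Lemma ldp_channels_perm (R : realType) eps l k (sg : 'S_l) (T : 'M[R]_(l, k)) :
  ldp_channels eps T -> ldp_channels eps (perm_mx sg *m T).
Proof.
move=> [cT hT]; split; first exact: channels_perm.
by move=> y x x'; rewrite -row_permE !mxE.
Qed.

Definition constant_channel (R : realType) l k : 'M[R]_(l, k) :=
  \matrix_(y, x) (y == 0 :> nat)%:R.

Lemma constant_channelP (R : realType) l k : (0 < l)%N -> channels (constant_channel R l k).
Proof.
case: l => // l _; split=> [y x|x]; first by rewrite mxE ler0n.
rewrite (bigD1 ord0)//= mxE eqxx big1 ?addr0// => y.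
by rewrite -val_eqE mxE /= => /negbTE->.
Qed.

Lemma constant_channel_ldp (R : realType) eps l k : (0 < l)%N -> 0 <= eps ->
  ldp_channels eps (constant_channel R l k).
Proof.
move=> l0 e0; split; first exact: constant_channelP.
move=> y x x'; rewrite !mxE ler_peMl ?ler0n// -expR0 ler_expR.
exact: e0.
Qed.

Lemma distr_gt0 (R : realType) k (p : 'cV[R]_k) : is_distr p -> (0 < k)%N.
Proof.
move=> [_ h]; rewrite lt0n; apply/eqP => k0; move: p h; rewrite k0 => p.
by rewrite big_ord0 => /esym/eqP; rewrite oner_eq0.
Qed.

Lemma level_ext (R : realType) (P Q : nat -> R) k n t t' x :
  (forall j, (j < n)%N -> t j = t' j) -> level P Q k n t x = level P Q k n t' x.
Proof. by move=> h; apply: eq_bigr => j _; rewrite h. Qed.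

(** * All channels: search over thresholds *)

Definition set_identity : prog :=
  PFor 20 lE (PRSet 7 (at_l (cell 20) (cell 20)) (RLit 1)).
Definition count_channel : prog :=
  PSeq (PNSet 5 (NLit 0) (NLit 1))
    (mul_power (NAdd kE (NLit 1)) (NSub lE (NLit 1))).
(** With the identity matrix in array 7, expanding the levels sends each input deterministically to
    the output numbered by its level. *)
Definition gen_channel : prog :=
  PSeq (decode_digits 10 (NAdd kE (NLit 1)) (NSub lE (NLit 1)))
    (PSeq (levels (NSub lE (NLit 1))) expand_levels).
Definition search_channel : prog := search gen_channel check_channel.
Definition prog_channel : prog :=
  PSeq set_tables (PSeq set_table_l (PSeq set_identity
    (PSeq count_channel search_channel))).

Section Channel.
Variables (R : realType) (l k : nat) (p q : 'cV[R]_k).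
Variable (g : 'cV[R]_l * 'cV[R]_l -> R).
Hypotheses (l0 : (0 < l)%N) (dp : is_distr p) (dq : is_distr q).
Let A := output_pairs (@channels R l k) p q.
Hypothesis qc : jointly_quasi_convex A g.
Hypothesis pinv : permutation_invariant A g.
Let N := (k.+1 ^ l.-1)%N.

Definition J_channel (s : state R) : Prop :=
  [/\ tables l p q s, nmem s 5 0 = N &
    forall j y, (j < l)%N -> (y < l)%N -> rmem s 7 (j * l + y)%N = (j == y)%:R].

Lemma J_channel_agree s s' : J_channel s ->
  agree (nwrites search_channel) (rwrites search_channel) s s' -> J_channel s'.
Proof.
move=> [tb n5 r7] ag; split; first exact: tables_agree ag isT tb.
  by rewrite (ag.1 5 isT).
by rewrite (ag.2 7 isT).
Qed.

Lemma gen_channel_complete t : (forall j, (j < l.-1)%N -> (t j < k.+1)%N) ->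
  exists2 a, (a < N)%N & forall s, J_channel s -> nmem s 7 0 = a ->
    mx_at l k (den g gen_channel s) 6 =
    \matrix_(y, x) (level (mem_of p) (mem_of q) k l.-1 t x == y :> nat)%:R.
Proof.
move=> ht; have [a [aN ad _]] := @digits_encode k.+1 l.-1 0 1 t isT ht isT.
rewrite muln1 in aN; exists a => // s [tb n5 r7] n7.
have [[n00 n01 _ _ _] _] := tb.
rewrite /gen_channel !den_seq.
set s1 := den g (decode_digits _ _ _) s; set s2 := den g (levels _) s1.
have er : neval s (NAdd kE (NLit 1)) = k.+1 by rewrite /= n00 addn1.
have en : neval s (NSub lE (NLit 1)) = l.-1 by rewrite /= n01 subn1.
have := @decode_spec R l g 10 (NAdd kE (NLit 1)) (NSub lE (NLit 1)) s (or_intror erefl) isT.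
rewrite er en n7 n5 => /(_ isT (ltnW aN)) [h1 _].
have ag1 : agree [:: 23; 8; 24; 7; 8; 10; 7]%N [::] s s1.
  by apply: agree_sub (agree_den g _ _); subset_dec.
have tb1 : tables l p q s1 by exact: tables_agree ag1 isT tb.
have en1 : neval s1 (NSub lE (NLit 1)) = l.-1 by rewrite (neval_agree ag1) ?en.
have ag2 : agree [:: 25; 11; 26; 11]%N [::] s1 s2.
  by apply: agree_sub (agree_den g _ _); subset_dec.
have tb2 : tables l p q s2 by exact: tables_agree ag2 isT tb1.
have h2 x : (x < k)%N -> nmem s2 11 x = level (mem_of p) (mem_of q) k l.-1 t x.
  move=> xk; rewrite (levels_spec g tb1)// en1.
  by apply: level_ext => j jl; rewrite h1// ad.
apply/matrixP => y x; rewrite !mxE.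
have lev : (level (mem_of p) (mem_of q) k l.-1 t x < l)%N.
  by rewrite (leq_ltn_trans (level_le _ _ _ _ _ _))// prednK.
rewrite (expand_spec g tb2)//; last first.
  move=> x' xk; rewrite h2// (leq_trans (level_le _ _ _ _ _ _))//.
  by rewrite (leq_trans (leq_pred l))// leq_pmulr.
by rewrite h2// (ag2.2 7 isT) (ag1.2 7 isT) r7.
Qed.

Lemma search_channel_solves s : J_channel s -> nmem s 13 0 = 0%N ->
  let s' := den g search_channel s in
  [/\ safe A g search_channel s, is_maximizer (@channels R l k) p q g (output_mx l k s') &
    output_val s' = g (output_mx l k s' *m p, output_mx l k s' *m q)].
Proof.
move=> Js s13.
apply: (@search_solves R l k p q g _ gen_channel check_channel J_channel s) => //.
- by move=> s1 s2 J1 ag; exact: J_channel_agree J1 ag.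
- by move=> s1 [].
- by move=> s1 [tb _ _]; exact: check_channel_spec tb.
- by move=> sg T; exact: channels_perm.
- by exists (constant_channel R l k); exact: constant_channelP.
- move=> a b T CT.
  have [t [tk [sg le]]] := channel_functional_max a b l0 dp.1 dq.1 CT.
  have [i iN hi] := @gen_channel_complete t (fun j _ => tk j).
  have [_ n5 _] := Js.
  exists i, (\matrix_(y, x) (level (mem_of p) (mem_of q) k l.-1 t x == y :> nat)%:R), sg.
  split; rewrite ?n5//; split=> [y x|x]; first by rewrite mxE ler0n.
  have lev : (level (mem_of p) (mem_of q) k l.-1 t x < l)%N.
    by rewrite (leq_ltn_trans (level_le _ _ _ _ _ _))// prednK.
  rewrite (bigD1 (Ordinal lev))//= mxE eqxx big1 ?addr0// => y.
  by rewrite -val_eqE mxE /= eq_sym => /negbTE->.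
Qed.

Lemma prog_channel_solves M : (1 < k)%N ->
  [&& l <= M, l * l + l + 4 <= M, k.+1 <= M & N <= M]%N ->
  exists (t : nat) s', [/\ exec A g (compile prog_channel) (init_state l p q [::]) t s',
    (t <= cost_bound prog_channel M)%N,
    is_maximizer (@channels R l k) p q g (output_mx l k s') &
    output_val s' = g (output_mx l k s' *m p, output_mx l k s' *m q)].
Proof.
move=> k1 /and4P[lM llM kM NM].
pose s0 := init_state l p q [::].
pose s1 := den g set_tables s0; pose s2 := den g set_table_l s1.
pose s3 := den g set_identity s2; pose s4 := den g count_channel s3.
have ag1 : agree [:: 20; 2; 20; 3]%N [::] s0 s1 by apply: agree_sub (agree_den g _ _); subset_dec.
have ag2 : agree [:: 20; 4]%N [::] s1 s2 by apply: agree_sub (agree_den g _ _); subset_dec.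
have ag3 : agree [:: 20]%N [:: 7]%N s2 s3 by apply: agree_sub (agree_den g _ _); subset_dec.
have ag4 : agree [:: 5; 20; 6; 21; 6; 5]%N [::] s3 s4 by apply: agree_sub (agree_den g _ _); subset_dec.
have [a1 a2] := @set_tables_spec R l k g s0 erefl erefl erefl erefl.
have b1 : nmem s1 0 1 = l by rewrite (ag1.1 0 isT).
have b2 : nmem s1 4 0 = 0%N by rewrite (ag1.1 4 isT).
have a3 := @set_table_l_spec R l g s1 b1 a2 b2.
have tb2 : tables l p q s2.
  split; first split.
  - by rewrite (ag2.1 0 isT) (ag1.1 0 isT).
  - by rewrite (ag2.1 0 isT) b1.
  - by rewrite (ag2.1 2 isT).
  - by rewrite (ag2.1 3 isT).
  - exact: a3.
  - by rewrite (ag2.2 0 isT) (ag1.2 0 isT) (ag2.2 1 isT) (ag1.2 1 isT).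
have tb3 : tables l p q s3 by exact: tables_agree ag3 isT tb2.
have tb4 : tables l p q s4 by exact: tables_agree ag4 isT tb3.
have [[c00 c01 _ c3 _] _] := tb3.
have n5 : nmem s4 5 0 = N.
  rewrite /s4 /count_channel den_seq mul_power_spec// den_nset nmem_setn /= mul1n.
  by rewrite !nmem_setn /= c00 c01 addn1 subn1.
have id3 j y : (j < l)%N -> (y < l)%N -> rmem s3 7 (j * l + y)%N = (j == y)%:R.
  rewrite /s3 /set_identity => jl yl.
  have n20 : neval s2 lE = l by have [[_ ? _ _ _] _] := tb2.
  forloop (fun (n : nat) (s' : state R) => forall j y : nat, (j < l)%N -> (y < l)%N ->
    rmem s' 7 (j * l + y)%N = ((j == y) && (j < n)%N)%:R).
  - by move=> j' y' _ _; rewrite andbF (ag2.2 7 isT) (ag1.2 7 isT).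
  - rewrite n20 => i s5 il ag h j' y' jl' yl'; rewrite den_rset rmem_setr /=.
    have agi : agree [:: 20]%N [:: 7]%N s2 (setn s5 20 0 i).
      by apply: (agree_trans ag); apply: agree_sub (agree_setn _ _ _ _); subset_dec.
    rewrite !nmem_setn /= rmem_setn (ag.1 4 isT) a3; last by lia.
    case: eqP => [e|ne].
      by have [-> ->] := index2_inj yl' il e; rewrite eqxx ltnSn.
    rewrite h// ltnS [(j' <= i)%N]leq_eqVlt.
    case: (eqVneq j' y') => //= ejy; case: (eqVneq j' i) => //= eji.
    by exfalso; apply: ne; rewrite -ejy eji.
  - by rewrite n20 => s5 [-> _ h]; rewrite rmem_setn h// jl andbT.
have J4 : J_channel s4.
  split=> // j y jl yl; by rewrite (ag4.2 7 isT) id3.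
have s13 : nmem s4 13 0 = 0%N.
  by rewrite (ag4.1 13 isT) (ag3.1 13 isT) (ag2.1 13 isT) (ag1.1 13 isT).
have [sf mx val] := search_channel_solves J4 s13.
have [[d00 d01 _ d3 _] _] := tb4; have [[e00 e01 _ e3 _] _] := tb2.
suff [t e h] : exists2 t : nat,
    exec A g (compile prog_channel) s0 t (den g search_channel s4) &
    (t <= cost_bound prog_channel M)%N.
  by exists t, (den g search_channel s4).
rewrite /prog_channel.
apply: exec_den_seq => //; first by rewrite /= lM.
apply: exec_den_seq => //; first by rewrite /= -/s1 a2 b1 addnA llM.
apply: exec_den_seq => //; first by rewrite /= -/s1 -/s2 e01 lM.
apply: exec_den_seq => //.
  by rewrite /= -/s1 -/s2 -/s3 c00 c01 addn1 kM (leq_trans (leq_subr 1 l)).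
apply: exec_den => //.
rewrite /= -/s1 -/s2 -/s3 -/s4 n5 NM d00 d01 lM (leq_trans (leq_subr 1 l))//=.
by rewrite (leq_trans (leqnSn k)).
Qed.

End Channel.

(** For one input [k ^ l = 1], so the cost must not depend on [l]. The memory is initially zero,
    hence one write completes the matrix; as [p = q = 1], both oracle arguments are the same
    array. *)
Definition trivial_channel : cmd :=
  Seq (RSet 3 (NLit 0) (RLit 1)) (Seq (RSet 5 (NLit 0) (RLit 1)) (Query 4 (NLit 0) 5 5)).

Lemma trivial_channel_solves (R : realType) l (p q : 'cV[R]_1)
    (g : 'cV[R]_l * 'cV[R]_l -> R) :
  let C := @channels R l 1 in let A := output_pairs C p q in
  (0 < l)%N -> is_distr p -> is_distr q ->
  jointly_quasi_convex A g -> permutation_invariant A g ->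
  exists s', [/\ exec A g trivial_channel (init_state l p q [::]) 8 s',
    is_maximizer C p q g (output_mx l 1 s') &
    output_val s' = g (output_mx l 1 s' *m p, output_mx l 1 s' *m q)].
Proof.
case: l g => // l g C A _ dp dq qc pinv.
pose s1 := State (nmem (init_state l.+1 p q [::]))
  (upd (rmem (init_state l.+1 p q [::])) 3 0 1%:R).
pose s2 := State (nmem s1) (upd (rmem s1) 5 0 1%:R).
pose T0 := constant_channel R l.+1 1.
have CT0 : C T0 by exact: constant_channelP.
have rE (r : 'cV[R]_1) : is_distr r -> read_col l.+1 s2 5 = T0 *m r.
  move=> [_]; rewrite big_ord1 => r1; apply/colP => y.
  by rewrite !mxE big_ord1 mxE r1 mulr1 /= /upd /=; case: eqP.
have AT0 : A (read_col l.+1 s2 5, read_col l.+1 s2 5).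
  by rewrite {1}(rE p dp) (rE q dq); exists T0.
exists (State (nmem s2) (upd (rmem s2) 4 0 (g (read_col l.+1 s2 5, read_col l.+1 s2 5)))).
have -> : output_mx l.+1 1 (State (nmem s2)
    (upd (rmem s2) 4 0 (g (read_col l.+1 s2 5, read_col l.+1 s2 5)))) = T0.
  apply/matrixP => y x; rewrite !mxE /= /upd /= muln1 (ord1 x) addn0.
  by case: eqP.
split.
- have e1 : exec A g (RSet 3 (NLit 0) (RLit 1)) (init_state l.+1 p q [::]) 3 s1.
    exact: ExecRSet.
  have e2 : exec A g (RSet 5 (NLit 0) (RLit 1)) s1 3 s2 by exact: ExecRSet.
  exact: ExecSeq e1 (ExecSeq e2 (@ExecQuery R l.+1 A g s2 4 (NLit 0) 5 5 AT0)).
- split=> // T CT.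
  have [|||_ [T' [_ -> _ //]]] := @best_candidate R l.+1 1 C p q g 1
    (fun _ T => T = T0) qc pinv _ _ _ T CT.
  + by move=> _ T1 T2 -> ->.
  + by move=> sg T1; exact: channels_perm.
  + move=> a b T1 CT1.
    have [t [_ [sg le]]] := channel_functional_max a b isT dp.1 dq.1 CT1.
    have lev : (level (mem_of p) (mem_of q) 1 l t 0 < l.+1)%N by rewrite ltnS level_le.
    (* On one input a deterministic channel is [T0] up to a transposition of outputs, so a single
       candidate suffices. *)
    exists 0%N, T0, (sg * tperm ord0 (Ordinal lev))%g; split=> //.
    rewrite perm_mxM -mulmxA; congr (_ <= functional a b p q (_ *m _)): le.
    apply/matrixP => y x; rewrite -row_permE !mxE (ord1 x).
    congr (_%:R); rewrite -[(_ == 0 :> nat)]/(tperm ord0 (Ordinal lev) y == ord0).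
    by rewrite -(inj_eq (@perm_inj _ (tperm ord0 (Ordinal lev)))) tpermK tpermL eq_sym.
- by rewrite /output_val /= {1}(rE p dp) (rE q dq).
Qed.

(** * Private channels: search over thresholds and vertices *)

Definition digit_count : nexp := NGet 4 (NAdd (cell 3) (NAdd lE (NLit 3))).
(** The digit table has [l * l + 1] pattern rows, [l] rows of the system, its right-hand side and
    the pivots: [l * l + l + 3] rows of [l] digits, each below [l + 2]. The second factor counts the
    thresholds. *)
Definition count_ldp : prog :=
  PSeq (PNSet 5 (NLit 0) (NLit 1))
    (PSeq (mul_power (NAdd lE (NLit 2)) digit_count)
       (mul_power (NAdd kE (NLit 1)) (cell 3))).
(** The other cells of array 8 stay zero, so its content is the function [coef E], default value
    included. *)
Definition set_coef : prog :=
  PSeq (PRSet 8 (NLit 1) (RLit 1)) (PRSet 8 (NLit 2) (rcell 2)).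
Definition gen_vertex : prog :=
  PSeq load_mx (PSeq load_rhs (PSeq eliminate (PSeq solve columns))).
Definition gen_ldp : prog :=
  PSeq (decode_digits 9 (NAdd lE (NLit 2)) digit_count)
  (PSeq gen_vertex
  (PSeq (decode_digits 10 (NAdd kE (NLit 1)) (cell 3))
    (PSeq (levels (cell 3)) expand_levels))).
Definition test_ldp : prog := PSeq check_channel check_ldp.
Definition search_ldp : prog := search gen_ldp test_ldp.
Definition prog_ldp : prog :=
  PSeq set_tables (PSeq set_table_l (PSeq set_coef (PSeq count_ldp search_ldp))).

Section Ldp.
Variables (R : realType) (l k : nat) (eps : R) (p q : 'cV[R]_k).
Variable (g : 'cV[R]_l * 'cV[R]_l -> R).
Hypotheses (l0 : (0 < l)%N) (eps0 : 0 <= eps) (dp : is_distr p) (dq : is_distr q).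
Let C := @ldp_channels R eps l k.
Let A := output_pairs C p q.
Let E := expR eps.
Hypothesis qc : jointly_quasi_convex A g.
Hypothesis pinv : permutation_invariant A g.
Let n1 := ((l * l + l + 3) * l)%N.
Let N := ((l + 2) ^ n1 * k.+1 ^ (l * l))%N.
Local Notation K := (l * l).+1.

Definition J_ldp (s : state R) : Prop :=
  [/\ tables l p q s, nmem s 5 0 = N, rmem s 8 = coef E & rmem s 2 0 = E].

Lemma J_ldp_agree s s' : J_ldp s ->
  agree (nwrites search_ldp) (rwrites search_ldp) s s' -> J_ldp s'.
Proof.
move=> [tb n5 r8 r2] ag; split; first exact: tables_agree ag isT tb.
- by rewrite (ag.1 5 isT).
- by rewrite (ag.2 8 isT).
- by rewrite (ag.2 2 isT).
Qed.

Lemma gen_vertex_spec s (D : nat -> nat) : tables l p q s -> rmem s 8 = coef E ->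
  (forall i, (i < n1)%N -> nmem s 9 i = D i) ->
  let A := digit_mx E l D K in
  let b := digit_mx E l D (K + l) 0 in
  let rho c := D ((K + l).+1 * l + c)%N in
  let G := gauss A b rho l in
  let mu c := G.2 (rho c) / G.1 (rho c) c in
  (forall c, (c < l)%N -> (rho c < l)%N) ->
  forall j y, (j < K)%N -> (y < l)%N -> rmem (den g gen_vertex s) 7 (j * l + y)%N =
        if D (j * l + y)%N == 0%N
        then 1 - \sum_(y' < l) coef E (D (j * l + y')%N) * mu y'
        else coef E (D (j * l + y)%N) * mu y.
Proof.
move=> tb r8 hD A' b rho G mu rl.
have digit r c : (r < l * l + l + 3)%N -> (c < l)%N -> nmem s 9 (r * l + c)%N = D (r * l + c)%N.
  move=> hr hc; apply: hD; apply: (@leq_trans (r.+1 * l)).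
    by rewrite mulSnr ltn_add2l.
  by rewrite leq_mul2r hr orbT.
rewrite /gen_vertex !den_seq.
set s1 := den g load_mx s; set s2 := den g load_rhs s1; set s3 := den g eliminate s2.
set s4 := den g solve s3.
have ag1 : agree [:: 25; 26]%N [:: 9]%N s s1 by apply: agree_sub (agree_den g _ _); subset_dec.
have ag2 : agree [:: 25; 26]%N [:: 9; 10]%N s s2.
  apply: (@agree_trans _ _ _ s1); first by apply: agree_sub ag1; subset_dec.
  by apply: agree_sub (agree_den g _ _); subset_dec.
have ag3 : agree [:: 25; 26; 27]%N [:: 9; 10; 11]%N s s3.
  apply: (@agree_trans _ _ _ s2); first by apply: agree_sub ag2; subset_dec.
  by apply: agree_sub (agree_den g _ _); subset_dec.
have ag4 : agree [:: 25; 26; 27]%N [:: 9; 10; 11; 12]%N s s4.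
  apply: (@agree_trans _ _ _ s3); first by apply: agree_sub ag3; subset_dec.
  by apply: agree_sub (agree_den g _ _); subset_dec.
have tb1 : tables l p q s1 by exact: tables_agree ag1 isT tb.
have tb2 : tables l p q s2 by exact: tables_agree ag2 isT tb.
have tb3 : tables l p q s3 by exact: tables_agree ag3 isT tb.
have tb4 : tables l p q s4 by exact: tables_agree ag4 isT tb.
have rhoE c : (c < l)%N -> nmem s 9 ((K + l).+1 * l + c)%N = rho c.
  by move=> cl; rewrite digit//; lia.
have hA i j : (i < l)%N -> (j < l)%N -> rmem s2 9 (i * l + j)%N = A' i j.
  move=> il jl; rewrite /s2 rmem_den// (load_mx_spec g tb r8)//.
  by rewrite /A' /digit_mx digit//; lia.
have r81 : rmem s1 8 = coef E by rewrite (ag1.2 8 isT).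
have hb i : (i < l)%N -> rmem s2 10 i = b i.
  move=> il; rewrite (load_rhs_spec g tb1 r81)// (ag1.1 9 isT).
  by rewrite /b /digit_mx addn0 digit//; lia.
have rl2 c : (c < l)%N -> (nmem s2 9 ((K + l).+1 * l + c) < l)%N.
  by move=> cl; rewrite (ag2.1 9 isT) rhoE// rl.
have [g1 g2] := @eliminate_spec R l k g p q s2 A' b tb2 rl2 hA hb.
have ge : gauss A' b (fun c => nmem s2 9 ((K + l).+1 * l + c)%N) l = G.
  by apply: gauss_ext => c cl; rewrite (ag2.1 9 isT) rhoE.
rewrite ge in g1 g2.
have rl3 c : (c < l)%N -> (nmem s3 9 ((K + l).+1 * l + c) < l)%N.
  by move=> cl; rewrite (ag3.1 9 isT) rhoE// rl.
have mE c : (c < l)%N -> rmem s4 12 c = mu c.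
  move=> cl; rewrite (solve_spec g tb3 rl3)// (ag3.1 9 isT) rhoE//.
  by rewrite g1 ?g2 ?rl.
have r84 : rmem s4 8 = coef E by rewrite (ag4.2 8 isT).
move=> j y jK yl; rewrite (columns_spec g tb4 r84)// (ag4.1 9 isT).
have dj y' : (y' < l)%N -> nmem s 9 (j * l + y')%N = D (j * l + y')%N.
  by move=> yl'; rewrite digit//; lia.
rewrite dj// mE//; case: ifP => // _; congr (1 - _).
by apply: eq_bigr => y' _; rewrite dj// mE.
Qed.

Lemma gen_ldp_complete t (m : 'cV[R]_l) (V : 'M[R]_(l, K)) :
  (forall j, (t j <= k)%N) -> ldp_polytope E m V -> ldp_vertex E m V ->
  exists2 a, (a < N)%N & forall s, J_ldp s -> nmem s 7 0 = a ->
    mx_at l k (den g gen_ldp s) 6 =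
    \matrix_(y, x) V y (inord (level (mem_of p) (mem_of q) k (l * l) t x)).
Proof.
move=> tk hp hv; have [D [Dl rl hV]] := vertex_digits hp hv.
(* The thresholds form the number [a2], the part of the guess left after the digit table has been
   decoded. *)
have [a2 [a2N a2d _]] := @digits_encode k.+1 (l * l) 0 1 t isT (fun j _ => tk j) isT.
rewrite muln1 in a2N.
have l2 : (0 < l + 2)%N by rewrite addn2.
have [a [aN ad ah]] := @digits_encode (l + 2) n1 a2 _ D l2 (fun i _ => Dl i) a2N.
exists a => // s [tb n5 r8 r2] n7; have [[n00 n01 _ n3 n4] _] := tb.
rewrite /gen_ldp; do 4 rewrite den_seq.
set s1 := den g (decode_digits 9 _ _) s; set s2 := den g gen_vertex s1.
set s3 := den g (decode_digits 10 _ _) s2; set s4 := den g (levels _) s3.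
have er : neval s (NAdd lE (NLit 2)) = (l + 2)%N by rewrite /= n01.
have en : neval s digit_count = n1.
  by rewrite /= n3 n01 n4 /n1; lia.
have := @decode_spec R l g 9 (NAdd lE (NLit 2)) digit_count s (or_introl erefl) isT.
rewrite er en n7 n5 => /(_ l2 (ltnW aN)) [h1 h1'].
have ag1 : agree [:: 23; 8; 24; 7; 8; 9; 7]%N [::] s s1.
  by apply: agree_sub (agree_den g _ _); subset_dec.
have ag2 : agree [:: 25; 26; 27]%N [:: 9; 10; 11; 12; 13; 7]%N s1 s2.
  by apply: agree_sub (agree_den g _ _); subset_dec.
have ag3 : agree [:: 23; 8; 24; 7; 8; 10; 7]%N [::] s2 s3.
  by apply: agree_sub (agree_den g _ _); subset_dec.
have ag4 : agree [:: 25; 11; 26; 11]%N [::] s3 s4.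
  by apply: agree_sub (agree_den g _ _); subset_dec.
have tb1 : tables l p q s1 by exact: tables_agree ag1 isT tb.
have tb2 : tables l p q s2 by exact: tables_agree ag2 isT tb1.
have tb3 : tables l p q s3 by exact: tables_agree ag3 isT tb2.
have tb4 : tables l p q s4 by exact: tables_agree ag4 isT tb3.
have r81 : rmem s1 8 = coef E by rewrite (ag1.2 8 isT).
have h2 := @gen_vertex_spec s1 D tb1 r81 (fun i hi => etrans (h1 i hi) (ad i hi)) rl.
have [[m00 _ _ m3 _] _] := tb2.
have := @decode_spec R l g 10 (NAdd kE (NLit 1)) (cell 3) s2 (or_intror erefl) isT.
rewrite (_ : neval s2 (NAdd kE (NLit 1)) = k.+1); last by rewrite /= m00 addn1.
rewrite (_ : neval s2 (cell 3) = l * l)%N; last by rewrite /= m3.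
rewrite (ag2.1 7 isT) h1' ah (ag2.1 5 isT) (ag1.1 5 isT) n5 => /(_ isT) [|h3 _].
  by apply: (leq_trans (ltnW a2N)); rewrite leq_pmull// expn_gt0 l2.
have h4 x : (x < k)%N -> nmem s4 11 x = level (mem_of p) (mem_of q) k (l * l) t x.
  move=> xk; rewrite (levels_spec g tb3)//.
  have -> : neval s3 (cell 3) = (l * l)%N by have [[_ _ _ ? _] _] := tb3.
  by apply: level_ext => j jl; rewrite h3// a2d.
apply/matrixP => y x; rewrite !mxE (expand_spec g tb4)//; last first.
  by move=> x' xk; rewrite h4// level_le.
rewrite h4// (ag4.2 7 isT) (ag3.2 7 isT) h2//; last by rewrite ltnS level_le.
by rewrite hV inordK ?ltnS ?level_le.
Qed.

Lemma test_ldp_spec s : J_ldp s -> nmem (den g test_ldp s) 12 0 =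
  if `[< C (mx_at l k s 6) >] then 1%N else 0%N.
Proof.
move=> [tb _ _ r2]; rewrite /test_ldp den_seq.
set s1 := den g check_channel s.
have ag1 : agree [:: 12; 25; 26]%N [:: 13]%N s s1.
  by apply: agree_sub (agree_den g _ _); subset_dec.
have tb1 : tables l p q s1 by exact: tables_agree ag1 isT tb.
rewrite (check_ldp_spec g tb1) (check_channel_spec g tb) (ag1.2 2 isT) (ag1.2 6 isT) r2.
case: asboolP => [cT|nT]; last first.
  by rewrite if_same ifF//; apply/asboolP => -[].
case: asboolP => [[_ h]|nC].
  rewrite ifT//; apply/forallP => y; apply/forallP => x; apply/forallP => x'.
  by have := h y x x'; rewrite !mxE.
rewrite ifF//; apply/negP => /forallP h; apply: nC; split=> // y x x'.
by have /forallP/(_ x)/forallP/(_ x') := h y; rewrite !mxE.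
Qed.

Lemma search_ldp_solves s : J_ldp s -> nmem s 13 0 = 0%N ->
  let s' := den g search_ldp s in
  [/\ safe A g search_ldp s, is_maximizer C p q g (output_mx l k s') &
    output_val s' = g (output_mx l k s' *m p, output_mx l k s' *m q)].
Proof.
move=> Js s13.
apply: (@search_solves R l k p q g C gen_ldp test_ldp J_ldp s) => //.
- by move=> s1 s2 J1 ag; exact: J_ldp_agree J1 ag.
- by move=> s1 [].
- exact: test_ldp_spec.
- by move=> sg T; exact: ldp_channels_perm.
- by exists (constant_channel R l k); exact: constant_channel_ldp.
- move=> a b T CT.
  have [t [m [V [tk hp hv le]]]] := ldp_functional_max a b (distr_gt0 dp) dp.1 dq.1 CT.
  have [i iN hi] := gen_ldp_complete tk hp hv.
  have [_ n5 _ _] := Js.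
  (* The guessed vertices already cover every order of the outputs, so no permutation is
     involved. *)
  exists i, (\matrix_(y, x) V y (inord (level (mem_of p) (mem_of q) k (l * l) t x))), 1%g.
  rewrite perm_mx1 mul1mx; split; rewrite ?n5//.
  have [m0 mV V1] := hp.
  split; first split=> [y x|x].
  + by rewrite mxE; apply: le_trans (m0 y) _; have /andP[] := mV y (inord (level (mem_of p) (mem_of q) k (l * l) t x)).
  + by under eq_bigr do rewrite mxE; exact: V1.
  move=> y x x'; rewrite !mxE.
  have /andP[_ h1] := mV y (inord (level (mem_of p) (mem_of q) k (l * l) t x)).
  have /andP[h2 _] := mV y (inord (level (mem_of p) (mem_of q) k (l * l) t x')).
  by apply: le_trans h1 _; rewrite ler_pM2l// expR_gt0.
Qed.

Lemma prog_ldp_solves M :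
  [&& l + 2 <= M, l * l + l + 4 <= M, k.+1 <= M, n1 <= M & N <= M]%N ->
  exists (t : nat) s', [/\ exec A g (compile prog_ldp) (init_state l p q [:: E]) t s',
    (t <= cost_bound prog_ldp M)%N, is_maximizer C p q g (output_mx l k s') &
    output_val s' = g (output_mx l k s' *m p, output_mx l k s' *m q)].
Proof.
move=> /and5P[lM llM kM nM NM].
have [lM' llM1 llM2] : [/\ l <= M, l * l <= M & l * l + 1 <= M]%N.
  by move: lM llM; clear; split; lia.
pose s0 := init_state l p q [:: E].
pose s1 := den g set_tables s0; pose s2 := den g set_table_l s1.
pose s3 := den g set_coef s2; pose s4 := den g count_ldp s3.
have ag1 : agree [:: 20; 2; 20; 3]%N [::] s0 s1 by apply: agree_sub (agree_den g _ _); subset_dec.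
have ag2 : agree [:: 20; 4]%N [::] s1 s2 by apply: agree_sub (agree_den g _ _); subset_dec.
have ag3 : agree [::]%N [:: 8]%N s2 s3 by apply: agree_sub (agree_den g _ _); subset_dec.
have ag4 : agree [:: 5; 20; 6; 21]%N [::] s3 s4 by apply: agree_sub (agree_den g _ _); subset_dec.
have [a1 a2] := @set_tables_spec R l k g s0 erefl erefl erefl erefl.
have b1 : nmem s1 0 1 = l by rewrite (ag1.1 0 isT).
have b2 : nmem s1 4 0 = 0%N by rewrite (ag1.1 4 isT).
have a3 := @set_table_l_spec R l g s1 b1 a2 b2.
have tb2 : tables l p q s2.
  split; first split.
  - by rewrite (ag2.1 0 isT) (ag1.1 0 isT).
  - by rewrite (ag2.1 0 isT) b1.
  - by rewrite (ag2.1 2 isT).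
  - by rewrite (ag2.1 3 isT).
  - exact: a3.
  - by rewrite (ag2.2 0 isT) (ag1.2 0 isT) (ag2.2 1 isT) (ag1.2 1 isT).
have tb3 : tables l p q s3 by exact: tables_agree ag3 isT tb2.
have tb4 : tables l p q s4 by exact: tables_agree ag4 isT tb3.
have [[c00 c01 _ c3 c4] _] := tb3.
have dc s : tables l p q s -> neval s digit_count = n1.
  by move=> [[_ d01 _ d3 d4] _]; rewrite /= d3 d01 d4 /n1; lia.
have n5 : nmem s4 5 0 = N.
  rewrite /s4 /count_ldp !den_seq.
  set s5 := den g (PNSet _ _ _) s3; set s6 := den g (mul_power _ _) s5.
  have ag5 : agree [:: 5]%N [::] s3 s5 by apply: agree_sub (agree_den g _ _); subset_dec.
  have ag6 : agree [:: 5; 20; 6; 21]%N [::] s5 s6 by apply: agree_sub (agree_den g _ _); subset_dec.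
  have tb5 : tables l p q s5 by exact: tables_agree ag5 isT tb3.
  have tb6 : tables l p q s6 by exact: tables_agree ag6 isT tb5.
  have [[f00 f01 _ f3 _] _] := tb6; have [[_ e01 _ _ _] _] := tb5.
  rewrite mul_power_spec// mul_power_spec// (dc _ tb5).
  have -> : nmem s5 5 0 = 1%N by rewrite /s5 den_nset nmem_setn.
  by rewrite /= mul1n e01 f00 f3 addn1.
have coef3 : rmem s3 8 = coef E.
  apply/funext => d; rewrite /s3 /set_coef !denE !rmem_setr /= /coef !rmem_setr /=.
  rewrite (ag2.2 8 isT) (ag1.2 8 isT) (ag2.2 2 isT) (ag1.2 2 isT).
  by case: eqP => [->//|_]; case: eqP.
have J4 : J_ldp s4.
  split=> //; first by rewrite (ag4.2 8 isT).
  by rewrite (ag4.2 2 isT) (ag3.2 2 isT) (ag2.2 2 isT) (ag1.2 2 isT).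
have s13 : nmem s4 13 0 = 0%N.
  by rewrite (ag4.1 13 isT) (ag3.1 13 isT) (ag2.1 13 isT) (ag1.1 13 isT).
have [sf mx val] := search_ldp_solves J4 s13.
have [[d00 d01 _ d3 _] _] := tb4.
suff [t e h] : exists2 t : nat,
    exec A g (compile prog_ldp) s0 t (den g search_ldp s4) &
    (t <= cost_bound prog_ldp M)%N.
  by exists t, (den g search_ldp s4).
rewrite /prog_ldp.
apply: exec_den_seq => //; first by rewrite /= lM'.
apply: exec_den_seq => //; first by rewrite /= -/s1 a2 b1 addnA llM.
apply: exec_den_seq => //.
have dc3 := dc _ tb3; rewrite /= in dc3.
apply: exec_den_seq => //.
  by rewrite /= -/s1 -/s2 -/s3 dc3 c00 c01 c3 addn1 kM lM nM llM1.
apply: exec_den => //.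
have dc4 := dc _ tb4; rewrite /= in dc4.
by rewrite /= -/s1 -/s2 -/s3 -/s4 dc4 n5 NM d00 d01 d3 nM lM' (ltnW kM) llM1 llM2.
Qed.

End Ldp.

(** * Running time *)

(** [k >= 2] gives [k + 1 <= k ^ 2], so the number of guesses is at most [X ^ 2]; as [l < X], the
    factor 6 covers the smaller loop bounds. *)
Lemma channel_sizes (l k X : nat) : (0 < l)%N -> (1 < k)%N -> X = (k ^ l)%N ->
  [&& l <= 6 * X ^ 2, l * l + l + 4 <= 6 * X ^ 2, k.+1 <= 6 * X ^ 2 &
    k.+1 ^ l.-1 <= 6 * X ^ 2]%N.
Proof.
move=> l0 k1 eX.
have lX : (l < X)%N by rewrite eX ltn_expl.
have kX : (k <= X)%N by rewrite eX -{1}[k]expn1 leq_pexp2l// ltnW.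
have NX : (k.+1 ^ l.-1 <= X ^ 2)%N.
  rewrite eX -expnM mulnC expnM (@leq_trans (k.+1 ^ l))//.
    by rewrite leq_pexp2l// leq_pred.
  by rewrite leq_exp2r// expnS expn1; nia.
by apply/and4P; split; nia.
Qed.

(** With a natural logarithm in the exponent, the quantity [Y] below is [l ^ (l ^ 3)] to the power
    [ln 2]; this bound recovers [l ^ (l ^ 3)] from [Y ^+ 2]. *)
Lemma ln2_ge_half (R : realType) : 1 / 2 <= ln (2 : R).
Proof.
have h : expR (1 / 2) <= (2 : R).
  have := expR_ge1Dx (- (1 / 2) : R); rewrite expRN => h.
  have e0 := expR_gt0 (1 / 2 : R).
  have : (1 + - (1 / 2)) * expR (1 / 2) <= (expR (1 / 2))^-1 * expR (1 / 2) :> R.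
    by rewrite ler_pM2r.
  by rewrite mulVf ?gt_eqF//; lra.
by rewrite -[leLHS]expRK ler_ln ?posrE ?expR_gt0.
Qed.

Section Growth.
Variables (R : realType) (l : nat).
Hypothesis l0 : (0 < l)%N.
Let Y : R := 2 `^ (l%:R ^+ 3 * ln l%:R).

Let YE : Y = expR (ln 2 * ln l%:R * (l ^ 3)%:R).
Proof.
rewrite /Y /powR pnatr_eq0 /= natrX; congr expR; ring.
Qed.

Lemma lnl_ge0 : 0 <= ln (l%:R : R).
Proof. by rewrite ln_ge0// ler1n. Qed.

Lemma growth_ge1 : 1 <= Y.
Proof.
rewrite YE -[leLHS]expR0 ler_expR !mulr_ge0 ?lnl_ge0//.
by have := ln2_ge_half R; lra.
Qed.

(** The factor 2 is for [l = 1], where [Y = 1]; otherwise [2 <= l]. *)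
Lemma pow2_growth : ((2 ^ (l ^ 3))%N%:R : R) <= 2 * Y ^+ 2.
Proof.
have [->|l1] := eqVneq l 1%N.
  by have := growth_ge1; rewrite exp1n expn1 expr2; nra.
have lE : ln (2 : R) <= ln l%:R.
  by rewrite ler_ln ?posrE ?ltr0n// ler_nat; lia.
have h2 := ln2_ge_half R.
rewrite YE -expRM_natr natrX -[2 in leLHS]lnK ?posrE// -expRM_natr.
rewrite (@le_trans _ _ (expR (ln 2 * ln l%:R * (l ^ 3)%:R * 2)))//; last first.
  by rewrite ler_peMl ?expR_ge0// ler1n.
rewrite ler_expR.
have : 0 <= ((l ^ 3)%:R : R) by [].
set a := (l ^ 3)%:R; set b := ln l%:R in lE *; set c := ln 2 in h2 lE *; move=> a0.
have : 0 <= (b * 2 - 1) * (c * a) by rewrite !mulr_ge0//; lra.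
by lra.
Qed.

Lemma powl_growth : ((l ^ (l ^ 3))%N%:R : R) <= Y ^+ 2.
Proof.
have h2 := ln2_ge_half R.
rewrite YE -expRM_natr natrX -[l%:R in leLHS]lnK ?posrE ?ltr0n// -expRM_natr.
rewrite ler_expR.
have := lnl_ge0; have : 0 <= ((l ^ 3)%:R : R) by [].
set a := (l ^ 3)%:R; set b := ln _; set c := ln 2 in h2 *; move=> a0 b0.
have : 0 <= (c * 2 - 1) * (b * a) by rewrite !mulr_ge0//; lra.
by lra.
Qed.

End Growth.

Lemma leq_wexp2r (m n e : nat) : (m <= n)%N -> (m ^ e <= n ^ e)%N.
Proof. by case: e => // e mn; rewrite leq_exp2r. Qed.

(** The digits give at most [(4 * l) ^ (5 * l ^ 3) = u ^ 10 * w ^ 5] choices and the thresholds at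
    most [(2 * k) ^ (l ^ 2) <= u * X], which explains the exponents; the factor 10 covers the
    smaller loop bounds. *)
Lemma ldp_sizes (l k X u w M : nat) : (0 < l)%N -> (0 < k)%N ->
  X = (k ^ (l ^ 2))%N -> u = (2 ^ (l ^ 3))%N -> w = (l ^ (l ^ 3))%N ->
  M = (10 * (X * u ^ 11 * w ^ 5))%N ->
  [&& l + 2 <= M, l * l + l + 4 <= M, k.+1 <= M, (l * l + l + 3) * l <= M &
    (l + 2) ^ ((l * l + l + 3) * l) * k.+1 ^ (l * l) <= M]%N.
Proof.
move=> l0 k0 eX eu ew eM.
have l2 : (1 <= l ^ 2)%N by rewrite expn_gt0 l0.
have l23 : (l ^ 2 <= l ^ 3)%N by rewrite leq_pexp2l.
have ll3 : (l <= l ^ 3)%N by rewrite -{1}[l]expn1 leq_pexp2l.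
have lu : (l < u)%N.
  by rewrite eu (leq_trans (ltn_expl l (isT : 1 < 2)%N))// leq_pexp2l.
have u0 : (0 < u)%N by exact: leq_ltn_trans lu.
have kX : (k <= X)%N by rewrite eX -{1}[k]expn1 leq_pexp2l.
have X0 : (0 < X)%N by exact: leq_trans kX.
have w0 : (0 < w)%N by rewrite ew expn_gt0 l0.
have uXM e : (e <= 11)%N -> (10 * (X * u ^ e) <= M)%N.
  move=> e11; rewrite eM leq_mul2l /= -[leqLHS]muln1 leq_mul ?expn_gt0 ?w0//.
  by rewrite leq_mul2l leq_pexp2l ?orbT.
have small n : (n <= 10 * u ^ 3)%N -> (n <= M)%N.
  move=> h; apply: leq_trans (uXM 3 isT); apply: (leq_trans h).
  by rewrite leq_mul2l leq_pmull.
have bigN : ((l + 2) ^ ((l * l + l + 3) * l) * k.+1 ^ (l * l) <= X * u ^ 11 * w ^ 5)%N.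
  have h1 : ((l + 2) ^ ((l * l + l + 3) * l) <= u ^ 10 * w ^ 5)%N.
    apply: (@leq_trans ((4 * l) ^ (5 * l ^ 3))).
      apply: (@leq_trans ((4 * l) ^ ((l * l + l + 3) * l))).
        apply: leq_wexp2r; lia.
      apply: leq_pexp2l; first by rewrite muln_gt0.
      by rewrite !expnS expn0; nia.
    rewrite expnMn eu ew -!expnM.
    by rewrite -[4%N]/(2 ^ 2)%N -expnM (_ : 2 * (5 * l ^ 3) = l ^ 3 * 10)%N ?(mulnC 5)//; lia.
  have h2 : (k.+1 ^ (l * l) <= u * X)%N.
    apply: (@leq_trans ((2 * k) ^ (l ^ 2))).
      by rewrite -mulnn; apply: leq_wexp2r; lia.
    by rewrite expnMn eX leq_mul2r eu leq_pexp2l ?orbT.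
  apply: (leq_trans (leq_mul h1 h2)); rewrite [(u ^ 11)%N]expnS.
  by move: (u ^ 10)%N (w ^ 5)%N => a b; lia.
apply/and5P; split.
- by apply: small; rewrite !expnS expn0; nia.
- by apply: small; rewrite !expnS expn0; nia.
- apply: leq_trans (uXM 0%N isT); rewrite expn0; lia.
- apply: small; apply: (@leq_trans (5 * l ^ 3)); first by rewrite !expnS expn0; nia.
  by rewrite leq_mul// leq_exp2r// ltnW.
- by apply: (leq_trans bigN); rewrite eM leq_pmull.
Qed.

(** The exponent 32 is 22 from [u ^ 11] plus 10 from [w ^ 5]. *)
Lemma growth_product (R : realType) (X u w : nat) (Y : R) : 1 <= Y ->
  u%:R <= 2 * Y ^+ 2 -> w%:R <= Y ^+ 2 ->
  (11 * (X * u ^ 11 * w ^ 5))%N%:R <= (11 * 2 ^ 11)%:R * (X%:R * Y ^+ 32).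
Proof.
move=> Y1 uY wY; have Y0 : 0 <= Y by exact: le_trans ler01 Y1.
have h1 : u%:R ^+ 11 <= 2 ^+ 11 * Y ^+ 22.
  rewrite -[Y ^+ 22]/(Y ^+ (2 * 11)) exprM -exprMn lerXn2r// nnegrE ?ler0n//.
  by rewrite mulr_ge0// exprn_ge0.
have h2 : w%:R ^+ 5 <= Y ^+ 10.
  by rewrite -[Y ^+ 10]/(Y ^+ (2 * 5)) exprM lerXn2r// nnegrE ?ler0n// exprn_ge0.
have h3 : u%:R ^+ 11 * w%:R ^+ 5 <= (2 ^+ 11 * Y ^+ 22) * Y ^+ 10.
  by apply: ler_pM => //; rewrite exprn_ge0.
rewrite -mulnA (natrM R 11 (X * _)) (natrM R X) (natrM R (u ^ 11)) (natrX R u) (natrX R w).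
rewrite (natrM R 11 (2 ^ 11)) (natrX R 2).
rewrite -[leRHS]mulrA; apply: ler_wpM2l => //; rewrite [leRHS]mulrCA.
apply: ler_wpM2l => //.
by apply: (le_trans h3); rewrite -mulrA -exprD.
Qed.

Theorem corollary1p18 (R : realType) :
  (exists (c : cmd) (P : {poly R}),
     forall (l k : nat) (p q : 'cV[R]_k) (g : 'cV[R]_l * 'cV[R]_l -> R),
       (0 < l)%N -> is_distr p -> is_distr q ->
       let C := @channels R l k in
       let A := output_pairs C p q in
       jointly_quasi_convex A g -> permutation_invariant A g ->
       solves_max_within C p q [::] g c P.[k%:R ^+ l])
  /\
  (exists (c : cmd) (P : {poly {poly R}}),
     forall (l k : nat) (eps : R) (p q : 'cV[R]_k)
            (g : 'cV[R]_l * 'cV[R]_l -> R),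
       (0 < l)%N -> 0 <= eps -> is_distr p -> is_distr q ->
       let C := @ldp_channels R eps l k in
       let A := output_pairs C p q in
       jointly_quasi_convex A g -> permutation_invariant A g ->
       solves_max_within C p q [:: expR eps] g c
         P.[k%:R ^+ (l ^ 2), 2 `^ (l%:R ^+ 3 * ln l%:R)]).
Proof.
split.
- have [c0 [d0 hcost]] := cost_bound_poly prog_channel.
  exists (If (BLeN kE (NLit 1)) trivial_channel (compile prog_channel)).
  (* 13 is the exact cost of the run with one input, 5 for the branch and 8 for the body;
     [7 * X ^ 2] absorbs the successor of the size bound [6 * X ^ 2]. *)
  exists ((13%:R)%:P + (c0%:R)%:P * (7%:R *: 'X^2) ^+ d0).
  move=> l k p q g l0 dp dq C A qc pinv.
  have k0 := distr_gt0 dp.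
  have -> : (13%:R%:P + c0%:R%:P * (7%:R *: 'X^2) ^+ d0).[k%:R ^+ l] =
      (13 + c0 * (7 * (k ^ l) ^ 2) ^ d0)%N%:R :> R.
    rewrite hornerD hornerM horner_exp hornerZ hornerXn !hornerC.
    by rewrite natrD natrM natrX natrM !natrX.
  rewrite /solves_max_within.
  have [k1|k1] := leqP k 1.
    have ek : k = 1%N by lia.
    subst k.
    have [s [e m v]] := trivial_channel_solves l0 dp dq qc pinv.
    exists 13%N, s; split=> //; last by rewrite ler_nat leq_addr.
    have hb : beval (init_state l p q [::]) (BLeN kE (NLit 1)) by [].
    exact: ExecIfTrue _ hb e.
  have sz := channel_sizes l0 k1 erefl.
  have [t [s [e ht m v]]] := prog_channel_solves l0 dp dq qc pinv k1 sz.
  exists (4 + t).+1, s; split=> //.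
    have hb : ~~ beval (init_state l p q [::]) (BLeN kE (NLit 1)).
      by rewrite /= -ltnNge.
    exact: ExecIfFalse _ hb e.
  rewrite ler_nat; apply: (@leq_trans (13 + t)); first by lia.
  rewrite leq_add2l (leq_trans ht)// (leq_trans (hcost _))// leq_mul2l.
  apply/orP; right; case: d0 hcost => // d hcost; rewrite leq_exp2r//.
  have : (0 < (k ^ l) ^ 2)%N by rewrite !expn_gt0 k0.
  by lia.
- have [c0 [d0 hcost]] := cost_bound_poly prog_ldp.
  exists (compile prog_ldp).
  (* The outer variable stands for [k ^ (l ^ 2)], the inner one for the second quantity; 11 in place
     of 10 absorbs the successor in [M.+1]. *)
  exists ((c0%:R)%:P%:P * (((11 * 2 ^ 11)%:R)%:P%:P * ('X * ('X^32)%:P)) ^+ d0).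
  move=> l k eps p q g l0 eps0 dp dq C A qc pinv.
  have k0 := distr_gt0 dp.
  have sz := ldp_sizes l0 k0 erefl erefl erefl erefl.
  have [t [s [e ht m v]]] := prog_ldp_solves l0 eps0 dp dq qc pinv sz.
  exists t, s; split=> //.
  set Y := 2 `^ _.
  rewrite hornerM horner_exp !hornerM hornerX !hornerC horner_exp.
  rewrite hornerM hornerM hornerXn !hornerC.
  set X := (k ^ (l ^ 2))%N in sz ht; set u := (2 ^ (l ^ 3))%N in sz ht.
  set w := (l ^ (l ^ 3))%N in sz ht; set M := (10 * _)%N in sz ht.
  have Y1 : 1 <= Y := growth_ge1 R l0.
  have uY : (u%:R : R) <= 2 * Y ^+ 2 := pow2_growth R l0.
  have wY : (w%:R : R) <= Y ^+ 2 := powl_growth R l0.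
  have M1 : (M.+1 <= 11 * (X * u ^ 11 * w ^ 5))%N.
    have : (0 < X * u ^ 11 * w ^ 5)%N by rewrite !muln_gt0 !expn_gt0 k0 l0.
    by rewrite /M; lia.
  apply: (@le_trans _ _ ((c0 * M.+1 ^ d0)%N%:R)).
    by rewrite ler_nat (leq_trans ht)// hcost.
  rewrite natrM natrX ler_wpM2l//; case: d0 hcost => // d hcost.
  rewrite lerXn2r ?nnegrE ?ler0n//.
    by rewrite !mulr_ge0 ?exprn_ge0// (le_trans ler01).
  apply: (@le_trans _ _ ((11 * (X * u ^ 11 * w ^ 5))%N%:R)); first by rewrite ler_nat.
  by rewrite -natrX -/X; exact: growth_product.
Qed.
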